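(* Let $\mathbf{X}=(X_k,\ k\in\mathbb{Z})$ be a strictly stationary sequence of real-valued random variables on a probability space $(\Omega,\mathcal{F},P)$. For each $r\ge 0$ define $$G(r):=\int_0^\infty t\cdot P(|X_0|>t+r)\,dt .$$ Suppose that $0<G(r)<\infty$ for all $r\ge 0$, and that for every $\varepsilon>0$, $$\lim_{r\to\infty}\frac{G(r+\varepsilon)}{G(r)}=0 .$$ Then for each $r\ge 0$, $E[|U_r(X_0)|^2]<\infty$. Suppose also that at least one of the following two conditions holds: (i) $\rho(\mathbf{X},1)<1$ and $\sum_{n=1}^\infty \rho(\mathbf{X},2^n)<\infty$; or (ii) $\rho^*(\mathbf{X},1)<1$, and $\alpha(\mathbf{X},n)\to 0$ as $n\to\infty$. Then there exists a sequence $(r(n),\ n\in\mathbb{N})$ of positive numbers with $r(n)\to\infty$ as $n\to\infty$, such that as $n\to\infty$, $$\bigl[U_{r(n)}(X_1)+U_{r(n)}(X_2)+\cdots+U_{r(n)}(X_n)\bigr]-n\cdot m_{r(n)}\ \Rightarrow\ N(0,1),$$ where for each $r\ge 0$, $m_r:=E[U_r(X_0)]$.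
   Context: Shrinking operators: for $r\ge 0$, $U_r:\mathbb{R}\to\mathbb{R}$ is defined by $U_r(0):=0$ and $U_r(x):=\max\{|x|-r,0\}\cdot x/|x|$ for $x\ne 0$; that is, $U_r(x)=x-r$ if $x>r$, $U_r(x)=0$ if $-r\le x\le r$, and $U_r(x)=x+r$ if $x<-r$. Measures of dependence: for $\sigma$-fields $\mathcal{A},\mathcal{B}\subset\mathcal{F}$, $$\alpha(\mathcal{A},\mathcal{B}):=\sup\{|P(A\cap B)-P(A)P(B)|:A\in\mathcal{A},B\in\mathcal{B}\},$$ $$\rho(\mathcal{A},\mathcal{B}):=\sup\{|\mathrm{Corr}(f,g)|: f\in L_2(\mathcal{A}),\ g\in L_2(\mathcal{B})\},$$ where $L_2(\mathcal{A})$ is the family of square-integrable $\mathcal{A}$-measurable random variables and $\mathrm{Corr}$ is the correlation (taken as $0$ when $f$ or $g$ is degenerate). For a strictly stationary sequence $\mathbf{X}=(X_k,k\in\mathbb{Z})$ and each positive integer $n$, $$\alpha(\mathbf{X},n):=\alpha(\sigma(X_k,k\le 0),\sigma(X_k,k\ge n)),\qquad \rho(\mathbf{X},n):=\rho(\sigma(X_k,k\le 0),\sigma(X_k,k\ge n)),$$ $$\rho^*(\mathbf{X},n):=\sup\rho(\sigma(X_k,k\in S),\sigma(X_k,k\in T)),$$ the last supremum being over all pairs of nonempty disjoint sets $S,T\subset\mathbb{Z}$ with $\mathrm{dist}(S,T):=\min_{s\in S,t\in T}|s-t|\ge n$ (the sets may be interlaced). Here $\sigma(\cdots)$ is the generated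 $\sigma$-field. Strict stationarity: for all integers $j,\ell$ and every integer $m\ge 0$, $(X_j,\dots,X_{j+m})$ and $(X_\ell,\dots,X_{\ell+m})$ have the same distribution. The symbol $\Rightarrow$ denotes convergence in distribution. *)

(* Defs.v *)
From HB Require Import structures.
From mathcomp Require Import all_boot all_order all_algebra.
From mathcomp Require Import all_classical all_reals all_analysis.
From mathcomp Require Import measurable_realfun.

Set Implicit Arguments.
Unset Strict Implicit.
Unset Printing Implicit Defensive.

Import Order.TTheory GRing.Theory Num.Theory.
Import numFieldNormedType.Exports.

Local Open Scope classical_set_scope.
Local Open Scope ring_scope.

Section shrinking.
Context {R : realType}.
Implicit Types r x : R.

Definition shrink r x : R :=
  if x == 0 then 0 else Num.max (`|x| - r) 0 * (x / `|x|).

Lemma shrink_pos r x : 0 < x -> shrink r x = Num.max (x - r) 0.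
Proof.
by move=> x0; rewrite /shrink gt_eqF// gtr0_norm// divff ?gt_eqF// mulr1.
Qed.

Lemma shrink_neg r x : x < 0 -> shrink r x = - Num.max (- x - r) 0.
Proof.
move=> x0; rewrite /shrink lt_eqF// ltr0_norm// invrN mulrN divff ?lt_eqF//.
by rewrite mulrN1.
Qed.

Lemma shrinkE r x : 0 <= r ->
  shrink r x = if r < x then x - r else if x < - r then x + r else 0.
Proof.
move=> r0; have [x0|x0|->] := ltgtP x 0.
- rewrite shrink_neg// ltNge (ltW (lt_le_trans x0 r0))/=.
  have [xr|rx] := ltP x (- r).
    by rewrite /Num.max ltNge subr_ge0 lerNr (ltW xr)/= opprB opprK addrC.
  by rewrite (max_idPr _) ?oppr0// subr_le0 lerNl.
- rewrite shrink_pos// [x < - r]ltNge (le_trans _ (ltW x0)) ?oppr_le0//=.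
  have [rx|xr] := ltP r x; last by apply/max_idPr; rewrite subr_le0.
  by apply/max_idPl; rewrite subr_ge0 ltW.
- by rewrite /shrink eqxx oppr_gt0 !ltNge r0.
Qed.

Lemma measurable_shrink r : measurable_fun [set: R] (shrink r).
Proof.
rewrite (_ : shrink r = fun x => if 0 < x then Num.max (x - r) 0 else
    if x < 0 then - Num.max (- x - r) 0 else 0); last first.
  apply/funext => x; have [x0|x0|->] := ltgtP x 0.
  - by rewrite shrink_neg.
  - by rewrite shrink_pos.
  - by rewrite /shrink eqxx.
apply: measurable_fun_ifT.
- exact: measurable_fun_ltr.
- by apply: measurable_maxr => //; exact: measurable_funB.
- apply: measurable_fun_ifT => //; first exact: measurable_fun_ltr.
  apply: measurableT_comp => //; apply: measurable_maxr => //.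
  exact: measurable_funB.
Qed.

HB.instance Definition _ r :=
  isMeasurableFun.Build _ _ R R (shrink r) (measurable_shrink r).

End shrinking.

Section dependence.
Context {d : measure_display} {Omega : measurableType d} {R : realType}.
Variable P : probability Omega R.

(* The division convention [x / 0 = 0] gives the value 0 when [f] or [g] is
   degenerate. *)
Definition corr (f g : Omega -> R) : R :=
  fine (covariance P f g) /
  (Num.sqrt (fine (variance P f)) * Num.sqrt (fine (variance P g))).

Definition L2 (A : set_system Omega) : set (Omega -> R) :=
  [set f | f \in Lfun P 2%:E /\
           forall B : set R, measurable B -> A (f @^-1` B)].

Definition alpha_coef (A B : set_system Omega) : \bar R :=
  ereal_sup [set (`|P (U `&` V) - P U * P V|)%E | U in A & V in B].

Definition rho_coef (A B : set_system Omega) : \bar R :=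
  ereal_sup [set (`|corr f g|)%:E | f in L2 A & g in L2 B].

End dependence.

Section sequences_of_random_variables.
Context {d : measure_display} {Omega : measurableType d} {R : realType}.
Variables (P : probability Omega R) (X : int -> {RV P >-> R}).

Definition sigma_gen (S : set int) : set_system Omega :=
  <<s \bigcup_(k in S) preimage_set_system [set: Omega] (X k) measurable >>.

Definition strictly_stationary : Prop :=
  forall (j l : int) (m : nat) (B : set (m.+1.-tuple R)), measurable B ->
  pushforward P (fun w => [tuple X (j + i%:Z) w | i < m.+1]) B =
  pushforward P (fun w => [tuple X (l + i%:Z) w | i < m.+1]) B.

Definition alpha_mix (n : nat) : \bar R :=
  alpha_coef P (sigma_gen [set k | k <= 0]) (sigma_gen [set k | n%:Z <= k]).

Definition rho_mix (n : nat) : \bar R :=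
  rho_coef P (sigma_gen [set k | k <= 0]) (sigma_gen [set k | n%:Z <= k]).

(* The infimum is attained, hence is the minimum, when [S] and [T] are nonempty. *)
Definition set_dist (S T : set int) : \bar R :=
  ereal_inf [set (`|s - t|%:~R)%:E | s in S & t in T].

Definition rho_star_mix (n : nat) : \bar R :=
  ereal_sup [set rho_coef P (sigma_gen ST.1) (sigma_gen ST.2) |
    ST in [set ST : set int * set int |
      [/\ ST.1 !=set0, ST.2 !=set0, ST.1 `&` ST.2 = set0 &
          (n%:R%:E <= set_dist ST.1 ST.2)%E]]].

Definition tail_moment (r : R) : \bar R :=
  (\int[lebesgue_measure]_(t in `[0%R, +oo[)
     (t%:E * P [set w | (t + r < `|X 0 w|)%R]))%E.

Definition shrunk_mean (r : R) : R := fine 'E_P[shrink r \o X 0].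

Definition centered_shrunk_sum (r : R) (n : nat) : Omega -> R :=
  fun w => \sum_(1 <= k < n.+1) shrink r (X k%:Z w) - n%:R * shrunk_mean r.

Lemma measurable_centered_shrunk_sum r n :
  measurable_fun [set: Omega] (centered_shrunk_sum r n).
Proof.
apply: measurable_funB => //; apply: measurable_sum => k.
exact: (measurableT_comp (measurable_shrink r)).
Qed.

HB.instance Definition _ r n := isMeasurableFun.Build _ _ Omega R
  (centered_shrunk_sum r n) (measurable_centered_shrunk_sum r n).

End sequences_of_random_variables.

(* Pointwise convergence of the distribution functions at every continuity
   point of the limit distribution function. *)
Definition cvg_in_distribution (d : measure_display) (Omega : measurableType d)
    (R : realType) (P : probability Omega R) (Y : nat -> {RV P >-> R})
    (mu : probability (measurableTypeR R) R) : Prop :=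
  forall x : R, {for x, continuous (fun t : R => mu [set` `]-oo, t]%R])} ->
  cdf (Y n) x @[n --> \oo] --> mu [set` `]-oo, x]%R].

Arguments cvg_in_distribution {d Omega R} P Y mu.

(* Main.v *)
From HB Require Import structures.
Require Import Defs.
From mathcomp Require Import all_boot all_order all_algebra.
From mathcomp Require Import all_classical all_reals all_analysis.
From mathcomp Require Import measurable_realfun.
From mathcomp Require Import ring lra.
From mathcomp Require Import zify.

Set Implicit Arguments.
Unset Strict Implicit.
Unset Printing Implicit Defensive.

Import Order.TTheory GRing.Theory Num.Theory.
Import numFieldNormedType.Exports.

Local Open Scope classical_set_scope.
Local Open Scope ring_scope.

(** * Second-order geometry of a stationary sequence *)

Section shift_invariant_forms.
Context {R : rcfType}.
Implicit Types (p q r : {poly R}) (B : {poly R} -> {poly R} -> R).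

(* A polynomial [p] stands for the finite linear combination of the shifts of
   a second-order stationary sequence with coefficients [p`_i], and [B p q] for
   the covariance of two such combinations. *)

(** The variables [shrink r (X k)] are unbounded and change with n, so a Lindeberg condition has to
    come from the tail. Since E U_r(X_0)^2 = 2 G(r), the ratio hypothesis says that U_{r+eps} is
    negligible in L2 next to U_r for large r; hence U_r is nearly the difference U_r - U_{r+eps},
    which is bounded by eps. For large n the level r(n) is the last one at which the sum has
    standard deviation 1, so no normalization appears. What remains is a central limit theorem for
    uniformly small functions that vary with n, and every variance estimate must be uniform in the
    function: this is why estimates are proved for abstract forms, with constants depending on the
    mixing coefficients only. Characteristic functions are compared with Gaussian ones along
    repeated halvings of the block, a short gap separating the halves. Under (i) the merge errors
    are summable over dyadic scales and the smallest blocks have fixed length. Under (ii) strong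
    mixing has no rate, only a fixed number of halvings is affordable, and the smallest blocks are a
    fixed fraction of n; a fourth moment bound drawn from [rho_star_mix] controls them. *)

Record stationary_form B : Prop := StationaryForm {
  formC : forall p q, B p q = B q p;
  formDl : forall p q r, B (p + q) r = B p r + B q r;
  formZl : forall a p q, B (a *: p) q = a * B p q;
  form_ge0 : forall p, 0 <= B p p;
  formX : forall p q, B ('X * p) ('X * q) = B p q }.

Definition form_norm B p := Num.sqrt (B p p).

Definition block a m : {poly R} := \sum_(i < m) 'X^(a + i).

Lemma blockD a m k : block a (m + k) = block a m + block (a + m) k.
Proof.
rewrite /block big_split_ord/=; congr (_ + _).
by apply: eq_bigr => i _; rewrite addnA.
Qed.

Lemma block_shift a k m : block (k + a) m = 'X^k * block a m.
Proof. by rewrite /block mulr_sumr; apply: eq_bigr => i _; rewrite -exprD addnA. Qed.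

Lemma block0 a : block a 0 = 0. Proof. by rewrite /block big_ord0. Qed.

Lemma block1 a : block a 1 = 'X^a.
Proof. by rewrite /block big_ord1 addn0. Qed.

Lemma coef_block a m i : (block a m)`_i = (a <= i < a + m)%N%:R.
Proof.
elim: m => [|m IH]; first by rewrite block0 coef0; case: andP => //; lia.
rewrite -addn1 blockD block1 coefD IH coefXn -natrD; congr _%:R.
by case: (ltngtP i (a + m)%N) => ?; lia.
Qed.

Lemma coef_block_lt a m i : (i < a)%N -> (block a m)`_i = 0.
Proof. by rewrite coef_block ltnNge => /negbTE ->. Qed.

Lemma size_block a m : (size (block a m) <= a + m)%N.
Proof. by apply/leq_sizeP => j aj; rewrite coef_block; case: andP => //; lia. Qed.

Section inner_product.
Variable B : {poly R} -> {poly R} -> R.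
Hypothesis hB : stationary_form B.
Local Notation nm := (form_norm B).

Lemma formDr p q r : B p (q + r) = B p q + B p r.
Proof. by rewrite (formC hB) (formDl hB) !(formC hB p). Qed.

Lemma formZr a p q : B p (a *: q) = a * B p q.
Proof. by rewrite (formC hB) (formZl hB) (formC hB p). Qed.

Lemma form0l p : B 0 p = 0.
Proof. by rewrite -(scale0r 0) (formZl hB) mul0r. Qed.

Lemma form0r p : B p 0 = 0. Proof. by rewrite (formC hB) form0l. Qed.

Lemma formNl p q : B (- p) q = - B p q.
Proof. by rewrite -scaleN1r (formZl hB) mulN1r. Qed.

Lemma formNr p q : B p (- q) = - B p q.
Proof. by rewrite (formC hB) formNl (formC hB). Qed.

Lemma form_suml I (s : seq I) (P : pred I) F p :
  B (\sum_(i <- s | P i) F i) p = \sum_(i <- s | P i) B (F i) p.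
Proof.
elim/big_rec2 : _ => [|i y x _ <-]; first by rewrite form0l.
by rewrite (formDl hB).
Qed.

Lemma form_sumr I (s : seq I) (P : pred I) F p :
  B p (\sum_(i <- s | P i) F i) = \sum_(i <- s | P i) B p (F i).
Proof.
by rewrite (formC hB) form_suml; apply: eq_bigr => i _; rewrite (formC hB).
Qed.

Lemma formDD p q : B (p + q) (p + q) = B p p + B q q + 2 * B p q.
Proof. by rewrite (formDl hB) !formDr (formC hB q p); ring. Qed.

Lemma formBB p q : B (p - q) (p - q) = B p p + B q q - 2 * B p q.
Proof. by rewrite formDD formNr formNl formNr; ring. Qed.

Lemma form_shift k p q : B ('X^k * p) ('X^k * q) = B p q.
Proof. by elim: k => [|k IH]; rewrite ?expr0 ?mul1r// exprS -!mulrA (formX hB). Qed.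

Lemma form_norm_ge0 p : 0 <= nm p. Proof. exact: sqrtr_ge0. Qed.

Lemma form_normE p : nm p ^+ 2 = B p p.
Proof. by rewrite sqr_sqrtr// (form_ge0 hB). Qed.

Lemma form_CS p q : `|B p q| <= nm p * nm q.
Proof.
rewrite -(@ler_pXn2r _ 2)// ?nnegrE ?mulr_ge0 ?form_norm_ge0//.
rewrite real_normK ?num_real// exprMn !form_normE.
have h a b : 0 <= a ^+ 2 * B p p + b ^+ 2 * B q q + 2 * a * b * B p q.
  have := form_ge0 hB (a *: p + b *: q).
  by rewrite formDD !(formZl hB) !formZr; congr (_ <= _); ring.
have pp := form_ge0 hB p; have qq := form_ge0 hB q.
(* These coefficients give the claim multiplied by [B q q] and by [B p p]. The coefficients 1 and -1
   take over when both vanish. *)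
have := h (B q q) (- B p q); have := h (B p q) (- B p p).
move: pp qq (h 1 1) (h 1 (-1)).
move: (B p p) (B q q) (B p q) => x y z x0 y0 h1 h2 h3 h4.
have [x1|x1] := ltP 0 x; first nra.
have [y1|y1] := ltP 0 y; first nra.
have x_0 : x = 0 by lra.
have y_0 : y = 0 by lra.
have z_0 : z = 0 by move: h1 h2; rewrite x_0 y_0; lra.
by rewrite z_0 x_0 expr0n mul0r.
Qed.

Lemma form_normD p q : nm (p + q) <= nm p + nm q.
Proof.
rewrite -(@ler_pXn2r _ 2)// ?nnegrE ?addr_ge0 ?form_norm_ge0//.
rewrite form_normE formDD sqrrD !form_normE.
have := form_CS p q; have := ler_norm (B p q); lra.
Qed.

Lemma form_normN p : nm (- p) = nm p.
Proof. by rewrite /form_norm formNl formNr opprK. Qed.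

Lemma form_norm_block a m : nm (block a m) = nm (block 0 m).
Proof. by rewrite /form_norm -(addn0 a) block_shift form_shift. Qed.

End inner_product.

End shift_invariant_forms.
Arguments form_norm {R} B p.
Arguments block {R} a m.

(** * Upper variance bound from correlations summable over dyadic gaps *)

Lemma ler_mul2_weighted (R : realFieldType) (a b t : R) : 0 < t ->
  2 * (a * b) <= t^-1 * a ^+ 2 + t * b ^+ 2.
Proof.
move=> t0; rewrite -subr_ge0.
rewrite (_ : _ - _ = t^-1 * (a - t * b) ^+ 2).
  by rewrite mulr_ge0 ?invr_ge0 ?sqr_ge0// ltW.
by field; rewrite gt_eqF.
Qed.

(** Each value of [l %/ k] is taken by exactly [k] indices. The halvings use a gap of about
    [2 ^ (l %/ k)] terms at scale [2 ^ l], so this turns a bound on the sum over gap sizes into one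
    on the sum over scales. *)
Lemma ler_sum_divn (R : numDomainType) (f : nat -> R) (k N : nat) : (0 < k)%N ->
  (forall i, 0 <= f i) ->
  \sum_(l < N) f (l %/ k)%N <= k%:R * \sum_(i < N) f i.
Proof.
move=> k0 f0.
have -> : k%:R * \sum_(i < N) f i = \sum_(l < N * k) f (l %/ k)%N.
  elim: N => [|N IH]; first by rewrite mul0n !big_ord0 mulr0.
  rewrite big_ord_recr/= mulrDr IH mulSnr big_split_ord/=; congr (_ + _).
  under eq_bigr => i _ do rewrite divnMDl// divn_small// addn0.
  by rewrite sumr_const card_ord mulr_natl.
rewrite -(big_mkord xpredT (fun l => f (l %/ k)%N)).
rewrite -(big_mkord xpredT (fun l => f (l %/ k)%N)).
rewrite (@big_cat_nat _ _ _ N 0 (N * k))//= ?leq_pmulr//.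
by rewrite lerDl sumr_ge0.
Qed.

Lemma sum_exp2V_le (R : realFieldType) N : \sum_(i < N) (2 ^+ i)^-1 <= 2 :> R.
Proof.
suff -> : \sum_(i < N) (2 ^+ i)^-1 = 2 - 2 * (2 ^+ N)^-1 :> R.
  by rewrite gerBl mulr_ge0// invr_ge0 exprn_ge0.
elim: N => [|N IH]; first by rewrite big_ord0 expr0 invr1; ring.
rewrite big_ord_recr/= IH exprS invfM; field.
by rewrite expf_neq0.
Qed.

Lemma bounded_sum_tail (R : realType) (g : nat -> R) (M eps : R) :
  (forall i, 0 <= g i) -> (forall N, \sum_(i < N) g i <= M) -> 0 < eps ->
  exists N0, forall N, \sum_(N0 <= i < N) g i <= eps.
Proof.
move=> g0 gM e0; pose A := [set \sum_(i < N) g i | N in [set: nat]].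
have supA : has_sup A.
  by split; [exists (\sum_(i < 0) g i); exists 0%N|exists M => _ [N _ <-]].
have [_ [N0 _ <-] hN0] := sup_adherent e0 supA.
exists N0 => N; have [NN0|NN0] := leqP N N0; first by rewrite big_geq// ltW.
have /(ub_le_sup supA.2) : A (\sum_(i < N) g i) by exists N.
rewrite -(big_mkord xpredT g) (@big_cat_nat _ _ _ N0)//= 1?ltnW// big_mkord.
move: hN0; set x := \sum_(i < N0) _; set y := \sum_(_ <= _ < _) _; lra.
Qed.

Section dyadic_bounds.
Context {R : realType}.
Implicit Types (B : {poly R} -> {poly R} -> R) (rho : nat -> R).

(* [rho n] bounds the correlation across a gap of [n] missing indices, hence
   corresponds to the mixing coefficient of index [n.+1]. *)
Definition gap_bound B rho := forall n c (p q : {poly R}), (size p <= c)%N ->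
  (forall i, (i < c + n)%N -> q`_i = 0) ->
  `|B p q| <= rho n * (form_norm B p * form_norm B q).

Section one_form.
Variables (B : {poly R} -> {poly R} -> R) (rho : nat -> R).
Hypothesis hB : stationary_form B.
Hypothesis hrho : gap_bound B rho.
Hypothesis rho0 : forall n, 0 <= rho n.
Local Notation nm := (form_norm B).
Local Notation s m := (form_norm B (block 0 m)).
Local Notation v := (B 1 1).

Lemma sqr_norm_blockD m1 m2 : s (m1 + m2) ^+ 2 =
  s m1 ^+ 2 + s m2 ^+ 2 + 2 * B (block 0 m1) (block m1 m2).
Proof.
rewrite (form_normE hB) blockD (formDD hB) -(form_normE hB (block 0 m1)).
by rewrite add0n -(form_normE hB (block m1 m2)) (form_norm_block hB m1).
Qed.

(** Cutting the last [q] terms off the first block opens a gap before the second one: the kept part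
    is controlled by [rho q], the cut part by Cauchy-Schwarz. *)
Lemma adjacent_blocks_cov a m1 m2 q : (q <= m1)%N ->
  `|B (block a m1) (block (a + m1) m2)| <=
  rho q * (s (m1 - q) * s m2) + s q * s m2.
Proof.
move=> qm1; rewrite -[X in block a X](subnK qm1) blockD (formDl hB).
apply: (le_trans (ler_normD _ _)); apply: lerD.
  apply: (le_trans (@hrho q (a + (m1 - q))%N _ _ _ _)).
  - exact: size_block.
  - by move=> i hi; rewrite coef_block_lt//; lia.
  - by rewrite !(form_norm_block hB a) !(form_norm_block hB (a + m1)%N).
apply: (le_trans (form_CS hB _ _)).
by rewrite !(form_norm_block hB (a + _)%N).
Qed.

(** The gap used at scale [2 ^ j] has about [2 ^ (j %/ 4)] terms: long enough for its correlation
    bounds to be summable over the scales, short enough for its own variance to be negligible next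
    to that of the halves. Each halving costs a factor [1 + x], absorbed in [expR x]. *)
Lemma sqr_norm_block_ub j m : (m <= 2 ^ j)%N -> s m ^+ 2 <=
  expR (\sum_(l < j) (rho (2 ^ (l %/ 4)).-1 + 2 * (2 ^+ (l %/ 4))^-1)) *
  (m%:R * v).
Proof.
have v0 := form_ge0 hB 1.
pose x (i : nat) := rho (2 ^ i).-1 + 2 * (2 ^+ i)^-1.
have x0 i : 0 <= x i by rewrite addr_ge0// mulr_ge0// invr_ge0 exprn_ge0.
elim: j m => [|j IH] m mj.
  rewrite big_ord0 expR0 mul1r.
  have [->|->] : m = 0%N \/ m = 1%N by lia.
    by rewrite block0 form_normE// form0l// mul0r.
  by rewrite block1 form_normE// mul1r.
have [mj'|mj'] := leqP m (2 ^ j).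
  apply: (le_trans (IH _ mj')); apply: ler_wpM2r; first by rewrite mulr_ge0.
  by rewrite ler_expR big_ord_recr/= lerDl; exact: x0.
rewrite big_ord_recr/= -/(x _) expRD.
set K := expR _ in IH *; have K0 : 0 <= K by exact: expR_ge0.
set i := (j %/ 4)%N.
have i8 : (2 ^ (3 * i) <= m)%N.
  by rewrite ltnW// (leq_ltn_trans _ mj')// leq_exp2l//; lia.
pose q := (2 ^ i).-1; pose m1 := m./2; pose m2 := uphalf m.
have mE : m = (m1 + m2)%N by rewrite /m1 /m2; lia.
have jj : (2 ^ j.+1 = 2 * 2 ^ j)%N by rewrite expnS.
have m1j : (m1 <= 2 ^ j)%N by rewrite /m1; lia.
have m2j : (m2 <= 2 ^ j)%N by rewrite /m2; lia.
have qm1 : (q <= m1)%N.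
  have [i0|i0] := posnP i; first by rewrite /q i0.
  have : (2 * 2 ^ i <= 2 ^ (3 * i))%N by rewrite -expnS leq_exp2l//; lia.
  by rewrite /q /m1; lia.
have := adjacent_blocks_cov 0 m2 qm1; rewrite add0n.
set c := B _ _ => hc.
rewrite {1}mE sqr_norm_blockD -/c.
set t : R := (2 ^+ i)^-1.
have t0 : 0 < t by rewrite invr_gt0 exprn_gt0.
have h1 := IH _ m1j; have h2 := IH _ m2j.
have h3 : s (m1 - q) ^+ 2 <= K * (m1%:R * v).
  apply: (le_trans (IH _ _)); first by lia.
  by rewrite ler_wpM2l// ler_wpM2r// ler_nat leq_subr.
(* The gap has variance of order [t^-1], and [t^-1 ^+ 3 <= m] makes this at most [t ^+ 2 * m]; one
   power of [t] pays for the weight. *)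
have h4 : t^-1 * s q ^+ 2 <= K * (t * m%:R * v).
  have qj : (q <= 2 ^ j)%N by lia.
  rewrite -ler_pdivlMl ?invr_gt0// invrK.
  apply: (le_trans (IH _ qj)); rewrite [leRHS]mulrCA ler_wpM2l//.
  rewrite !mulrA ler_wpM2r//.
  have /le_trans -> // : q%:R <= 2 ^+ i :> R by rewrite -natrX ler_nat leq_pred.
  have z0 : 2 ^+ i != 0 :> R by rewrite expf_neq0.
  have -> : 2 ^+ i = t * (t * (2 ^+ i) ^+ 3) by rewrite /t; field.
  rewrite -mulrA !ler_wpM2l ?(ltW t0)//.
  by rewrite -exprM -natrX ler_nat mulnC.
have ab : 2 * (s (m1 - q) * s m2) <= K * (m%:R * v).
  have := ler_mul2_weighted (s (m1 - q)) (s m2) ltr01.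
  rewrite invr1 !mul1r => /le_trans; apply.
  by apply: (le_trans (lerD h3 h2)); rewrite mE natrD; lra.
have cd : 2 * (s q * s m2) <= K * (2 * t * m%:R * v).
  apply: (le_trans (ler_mul2_weighted _ _ t0)).
  have : t * s m2 ^+ 2 <= K * (t * m%:R * v).
    have -> : K * (t * m%:R * v) = t * (K * (m%:R * v)) by ring.
    rewrite ler_wpM2l ?(ltW t0)//; apply: (le_trans h2).
    by rewrite ler_wpM2l// ler_wpM2r// ler_nat; lia.
  by move: h4; lra.
have rab := ler_wpM2l (rho0 q) ab.
have c2 : 2 * c <= K * (x i * (m%:R * v)).
  apply: (@le_trans _ _ (2 * `|c|)); first by rewrite ler_wpM2l// ler_norm.
  move: hc rab cd; rewrite /x -/t -/q; move: (rho q) => r; lra.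
have : K * (1 + x i) * (m%:R * v) <= K * expR (x i) * (m%:R * v).
  by rewrite ler_wpM2r ?mulr_ge0// ler_wpM2l// expR_ge1Dx.
apply: le_trans; move: c2 h1 h2; rewrite mE natrD; lra.
Qed.

End one_form.

(** The constant depends on [M] only. This uniformity over the forms is essential, since the form
    will come from a function that changes with the number of terms. *)
Lemma block_variance_ub rho M : (forall n, 0 <= rho n) ->
  (forall N, \sum_(i < N) rho (2 ^ i).-1 <= M) ->
  exists2 C : R, 0 < C & forall B, stationary_form B -> gap_bound B rho ->
    forall m, form_norm B (block 0 m) ^+ 2 <= C * (m%:R * B 1 1).
Proof.
move=> rho0 rhoM; exists (expR (4 * (M + 4))); first exact: expR_gt0.
move=> B hB hrho m.
have mj : (m <= 2 ^ m)%N by rewrite ltnW// ltn_expl.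
apply: (le_trans (sqr_norm_block_ub hB hrho rho0 mj)).
rewrite ler_wpM2r ?mulr_ge0 ?(form_ge0 hB)// ler_expR.
pose x (i : nat) := rho (2 ^ i).-1 + 2 * (2 ^+ i)^-1.
have x0 i : 0 <= x i by rewrite addr_ge0// mulr_ge0// invr_ge0 exprn_ge0.
apply: (le_trans (@ler_sum_divn _ x 4 m isT x0)); rewrite ler_wpM2l//.
rewrite big_split/= -mulr_sumr; apply: lerD; first exact: rhoM.
by have := @sum_exp2V_le R m; lra.
Qed.

End dyadic_bounds.

(** * Lower variance bound: growth of the block variances *)

Lemma bernoulli_ineq (R : realDomainType) (x : R) n : 0 <= x ->
  1 + n%:R * x <= (1 + x) ^+ n.
Proof.
move=> x0; elim: n => [|n IH]; first by rewrite expr0 mul0r addr0.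
rewrite exprS; apply: (@le_trans _ _ ((1 + x) * (1 + n%:R * x))).
  have -> : (1 + x) * (1 + n%:R * x) = 1 + n.+1%:R * x + n%:R * (x * x).
    by rewrite -natr1; ring.
  by rewrite lerDl !mulr_ge0.
by rewrite ler_wpM2l// addr_ge0.
Qed.

Lemma exp_ge_nat (R : realType) (b K : R) : 1 < b -> exists w, K <= b ^+ w.
Proof.
move=> b1; have x0 : 0 < b - 1 by lra.
exists (Num.truncn (K / (b - 1))).+1.
have := bernoulli_ineq (Num.truncn (K / (b - 1))).+1 (ltW x0).
rewrite (_ : 1 + (b - 1) = b); last by ring.
apply: le_trans.
have := truncnS_gt (K / (b - 1)); rewrite ltr_pdivrMr//.
by move=> /ltW /le_trans; apply; rewrite lerDr.
Qed.

Section variance_growth.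
Context {R : realType}.
Variables (B : {poly R} -> {poly R} -> R) (rho : nat -> R).
Hypothesis hB : stationary_form B.
Hypothesis hrho : gap_bound B rho.
Hypothesis rho0 : forall n, 0 <= rho n.
Hypothesis rho1 : rho 0%N < 1.
Local Notation nm := (form_norm B).
Local Notation s m := (form_norm B (block 0 m)).
Local Notation v := (B 1 1).

(** With norms a, b and correlation at most r, the square of the sum is at least a^2 + b^2 - 2 r a
    b; completing the square in one norm leaves 1 - r^2 times the square of the other. *)
Lemma past_future_norm c (p q : {poly R}) : (size p <= c)%N ->
    (forall i, (i < c)%N -> q`_i = 0) ->
  (1 - rho 0%N ^+ 2) * B p p <= B (p + q) (p + q) /\
  (1 - rho 0%N ^+ 2) * B q q <= B (p + q) (p + q).
Proof.
move=> pc qc; have h : `|B p q| <= rho 0%N * (nm p * nm q).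
  by apply: (@hrho 0%N c) => // i; rewrite addn0; exact: qc.
rewrite (formDD hB) -!(form_normE hB).
have := ler_norm (- B p q); rewrite normrN.
move: (nm p) (nm q) (B p q) h => a b z h1 h2; move: rho1 (rho0 0%N).
move: (rho 0%N) h1 => r h1 r1 r0.
have h3 : 0 <= a ^+ 2 + b ^+ 2 + 2 * z - (a ^+ 2 + b ^+ 2 - 2 * r * (a * b)) by lra.
split.
  apply: le_trans (_ : a ^+ 2 + b ^+ 2 - 2 * r * (a * b) <= _); last by lra.
  by have := sqr_ge0 (b - r * a); rewrite sqrrB; nra.
apply: le_trans (_ : a ^+ 2 + b ^+ 2 - 2 * r * (a * b) <= _); last by lra.
by have := sqr_ge0 (a - r * b); rewrite sqrrB; nra.
Qed.

Lemma block_norm_almost_mono m m' : (m <= m')%N ->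
  (1 - rho 0%N ^+ 2) * s m ^+ 2 <= s m' ^+ 2.
Proof.
move=> mm'; rewrite !(form_normE hB) -(subnKC mm') blockD.
apply: (@past_future_norm m _ _ _ _).1; first exact: size_block.
by move=> i im; rewrite coef_block_lt.
Qed.

(** Two windows of length [L] shifted by [d] differ by two blocks of length [d] that stand at least
    [n] apart. Their weak correlation keeps the norm of the difference large, and polarization turns
    this into an upper bound on the covariance. *)
Lemma cov_shifted_blocks a L d n : (d + n <= L)%N ->
  B (block a L) (block (a + d) L) <= s L ^+ 2 - (1 - rho n) * s d ^+ 2.
Proof.
move=> dnL.
have e : block a L - block (a + d) L = block a d - block (a + L) d :> {poly R}.
  have -> : block a L = block a d + block (a + d) L - block (a + L) d :> {poly R}.
    by rewrite -blockD addnC blockD addrK.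
  by rewrite addrAC addrK.
have := congr1 (fun p => B p p) e.
rewrite !(formBB hB) -!(form_normE hB).
rewrite !(form_norm_block hB a) !(form_norm_block hB (a + _)%N).
have gap i : (i < a + d + n)%N -> (block (a + L) d)`_i = 0 :> R.
  by move=> hi; rewrite coef_block_lt//; lia.
have := hrho (size_block a d) gap.
rewrite !(form_norm_block hB a) !(form_norm_block hB (a + _)%N).
rewrite -expr2; have := ler_norm (B (block a d) (block (a + L) d)); lra.
Qed.

(* The average of [N] windows of length [L] shifted by multiples of [n] has
   variance at most [s L ^+ 2 - (1 - rho n0) (1 - N^-1) x], but it contains a
   full window of length at least [n], which the almost monotonicity of the
   norm bounds below by [c0 x]. *)
Lemma variance_growth_step n0 n N L (x : R)
    (c0 := (1 - rho 0%N ^+ 2) ^+ 2) :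
  (0 < N)%N -> (n0 <= n)%N -> 0 <= x -> (forall k, (n <= k)%N -> x <= s k ^+ 2) ->
  rho n0 <= c0 / 4 -> N%:R^-1 <= c0 / 4 -> (N.+1 * n <= L)%N ->
  (1 + c0 / 2) * x <= s L ^+ 2.
Proof.
move=> N0 n0n x0 hx r0 N4 nL.
have nL' : (N * n + n <= L)%N by rewrite addnC -mulSn.
have NL : (N * n <= L)%N := leq_trans (leq_addr _ _) nL'.
have rr := rho0 n0; have rr1 := rho1; have rr0 := rho0 0%N.
have c01 : 0 <= c0 <= 1.
  by rewrite /c0 sqr_ge0/= expr_le1//; nra.
pose W k : {poly R} := block (k * n) L.
pose y := (1 - rho n0) * x.
have y0 : 0 <= y by rewrite mulr_ge0//; lra.
have covW (k l : 'I_N) : B (W k) (W l) <= s L ^+ 2 - y + y * (l == k)%:R.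
  have aux (a b : nat) : (a < b < N)%N -> B (W a) (W b) <= s L ^+ 2 - y.
    move=> abN; have -> : W b = block (a * n + (b - a) * n) L.
      by rewrite /W -mulnDl subnKC// ltnW//; case/andP: abN.
    apply: (le_trans (@cov_shifted_blocks _ _ _ n0 _)).
      apply: leq_trans nL; rewrite mulSn addnC leq_add// leq_mul2r.
      case/andP: abN => _ bN; rewrite (leq_trans (leq_subr _ _)) ?orbT//.
      exact: ltnW.
    rewrite lerB// /y ler_wpM2l//; first lra.
    by apply: hx; rewrite leq_pmull// subn_gt0; case/andP: abN.
  have [->|lk] := eqVneq l k.
    rewrite mulr1 subrK -(form_normE hB (W k)) /W.
    by rewrite (form_norm_block hB (_ * n)).
  rewrite mulr0 addr0; have [lt|lt|e] := ltngtP k l.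
  - by apply: aux; rewrite lt ltn_ord.
  - by rewrite (formC hB); apply: aux; rewrite lt ltn_ord.
  - by move/eqP: lk; case; apply: val_inj.
pose T : {poly R} := \sum_(k < N) W k.
have N0' : 0 < N%:R :> R by rewrite ltr0n.
have ub : B T T <= N%:R ^+ 2 * (s L ^+ 2 - y) + N%:R * y.
  rewrite form_suml//; under eq_bigr do rewrite form_sumr//.
  apply: (@le_trans _ _ (\sum_(k < N) \sum_(l < N) (s L ^+ 2 - y + y * (l == k)%:R))).
    by apply: ler_sum => k _; apply: ler_sum => l _; exact: covW.
  under eq_bigr => k _.
    rewrite big_split/= sumr_const card_ord (bigD1 k)//= eqxx mulr1.
    rewrite big1 ?addr0; last by move=> l /negbTE ->; rewrite mulr0.
    over.
  rewrite sumr_const card_ord -[(_ *+ N + _) *+ N]mulr_natl.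
  rewrite -[(_ - _) *+ N]mulr_natl; lra.
(* All [N] windows contain [Mid], whose length is at least [n]. [Left] precedes it and [Right]
   follows it, so each is discarded at the price of one factor [1 - rho 0%N ^+ 2]; hence the square
   in [c0]. *)
pose Left : {poly R} := \sum_(k < N) block (k * n) (N * n - k * n).
pose Mid : {poly R} := block (N * n) (L - N * n).
pose Right : {poly R} := \sum_(k < N) block L (k * n).
have TE : T = Left + (N%:R *: Mid + Right).
  rewrite scaler_nat -[N in Mid *+ N]card_ord -sumr_const.
  rewrite -big_split -big_split/=.
  apply: eq_bigr => k _; rewrite addrA.
  have kN : (k * n <= N * n)%N by rewrite leq_mul2r ltnW ?orbT.
  have -> : Mid = block (k * n + (N * n - k * n)) (L - N * n).
    by rewrite subnKC.
  rewrite -blockD.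
  have -> : block L (k * n) =
      block (k * n + (N * n - k * n + (L - N * n))) (k * n) :> {poly R}.
    by rewrite addnA subnKC// subnKC.
  rewrite -blockD; congr block.
  by rewrite addnAC subnK// subnKC.
have lb : c0 * (N%:R ^+ 2 * x) <= B T T.
  have h1 : (1 - rho 0%N ^+ 2) * B (N%:R *: Mid + Right) (N%:R *: Mid + Right)
      <= B T T.
    rewrite TE; apply: (@past_future_norm (N * n) _ _ _ _).2.
      apply: (leq_trans (size_sum _ _ _)); apply/bigmax_leqP => k _.
      by apply: (leq_trans (size_block _ _)); rewrite subnKC// leq_mul2r ltnW ?orbT.
    move=> i hi; rewrite coefD coefZ coef_block coef_sum big1 => [|k _].
      by rewrite addr0 -coef_block coef_block_lt// mulr0.
    by rewrite coef_block_lt// (leq_trans hi).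
  have h2 : (1 - rho 0%N ^+ 2) * B (N%:R *: Mid) (N%:R *: Mid) <=
      B (N%:R *: Mid + Right) (N%:R *: Mid + Right).
    apply: (@past_future_norm L _ _ _ _).1.
      apply: (leq_trans (size_scale_leq _ _)).
      by apply: (leq_trans (size_block _ _)); rewrite subnKC.
    move=> i hi; rewrite coef_sum big1// => k _.
    by rewrite coef_block_lt.
  have h3 : N%:R ^+ 2 * x <= B (N%:R *: Mid) (N%:R *: Mid).
    rewrite (formZl hB) (formZr hB) mulrA -expr2 -(form_normE hB Mid).
    rewrite (form_norm_block hB) ler_wpM2l ?sqr_ge0//.
    by apply: hx; rewrite leq_subRL.
  have d0 : 0 <= 1 - rho 0%N ^+ 2 by nra.
  rewrite /c0 expr2 -mulrA; apply: le_trans h1; rewrite ler_wpM2l//.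
  by apply: le_trans h2; rewrite ler_wpM2l.
have := le_trans lb ub.
have : N%:R * y <= N%:R ^+ 2 * (c0 / 4 * y).
  have -> : N%:R ^+ 2 * (c0 / 4 * y) = N%:R * (N%:R * (c0 / 4) * y) by ring.
  rewrite ler_wpM2l ?(ltW N0')// ler_peMl//.
  by rewrite -ler_pdivrMl// mulr1.
have : c0 / 4 * y <= c0 / 4 * x.
  by rewrite ler_wpM2l ?/y ?ler_piMl//; lra.
have : rho n0 * x <= c0 / 4 * x by rewrite ler_wpM2r.
set n2 := N%:R ^+ 2; have n20 : 0 < n2 by rewrite exprn_gt0.
move=> g1 g2 g3 g4.
rewrite -(ler_pM2l n20); rewrite -(ler_pM2l n20) in g2.
rewrite -(ler_pM2l n20) in g1.
move: g1 g2 g3 g4; rewrite /y; lra.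
Qed.

End variance_growth.

Section variance_lower_bound.
Context {R : realType}.
Variables (rho : nat -> R) (M : R).
Hypothesis rho0 : forall n, 0 <= rho n.
Hypothesis rho1 : rho 0%N < 1.
Hypothesis rho_le : forall n, rho n <= rho 0%N.
Hypothesis rhoM : forall N, \sum_(i < N) rho (2 ^ i).-1 <= M.
Local Notation s B m := (form_norm B (block 0 m)).

(** Iterating the growth step gains a fixed factor above 1 each time the length is multiplied by a
    fixed integer, starting from the variance of one term. Block variances thus grow at least like
    some power of the length, uniformly over the forms. *)
Lemma block_norm_exp_growth : exists n0 N, exists2 b : R, 1 < b &
  exists2 c : R, 0 < c & (0 < n0)%N /\
  forall B, stationary_form B -> gap_bound B rho ->
  (forall k, (0 < k)%N -> c * B 1 1 <= s B k ^+ 2) /\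
  forall j k, (n0 * N ^ j <= k)%N -> b ^+ j * (c * B 1 1) <= s B k ^+ 2.
Proof.
have r0 := rho0 0%N; have r1 := rho1.
pose c1 := 1 - rho 0%N ^+ 2; have c1_gt0 : 0 < c1 by rewrite /c1; nra.
pose c0 := c1 ^+ 2; have c0_gt0 : 0 < c0 by rewrite exprn_gt0.
have c04 : 0 < c0 / 4 by rewrite divr_gt0.
have rhop i : 0 <= rho (2 ^ i).-1 by exact: rho0.
have [i hi] := bounded_sum_tail rhop rhoM c04.
have {}hi : rho (2 ^ i).-1 <= c0 / 4 by have := hi i.+1; rewrite big_nat1.
pose N := (Num.truncn (c0 / 4)^-1).+1.
have N4 : N%:R^-1 <= c0 / 4.
  rewrite -[leRHS]invrK lef_pV2 ?posrE ?invr_gt0 ?ltr0n//.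
  exact/ltW/truncnS_gt.
exists (2 ^ i)%N, N.+1, (1 + c0 / 2); first by rewrite ltrDl divr_gt0.
exists c1 => //; split; first by rewrite expn_gt0.
move=> B hB hrho; have v0 := form_ge0 hB 1.
have base k : (0 < k)%N -> c1 * B 1 1 <= s B k ^+ 2.
  move=> k0; apply: le_trans (block_norm_almost_mono hB hrho rho0 rho1 k0).
  by rewrite (form_normE hB (block 0 1)) block1.
split=> //; elim=> [|j IH] k hk.
  rewrite expn0 muln1 in hk; rewrite expr0 mul1r; apply: base.
  by apply: leq_trans hk; rewrite expn_gt0.
rewrite exprS -mulrA.
apply: (@variance_growth_step _ _ _ hB hrho rho0 rho1 (2 ^ i).-1 (2 ^ i * N.+1 ^ j) N) => //.
- apply: (leq_trans (leq_pred _)); rewrite leq_pmulr// expn_gt0//.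
- rewrite mulr_ge0 ?exprn_ge0 ?mulr_ge0 ?(ltW c1_gt0)//.
  by rewrite addr_ge0// divr_ge0// ltW.
- by rewrite mulnCA -expnS.
Qed.

(** Power growth measured against the gap: a gap of [2 ^ i] terms has variance of order [2 ^ i], so
    a block dominating [8 ^+ i] leaves a factor [4 ^ i]. The weighted inequality spends one half of
    it and keeps a relative cost of order [2 ^ i] inverse. *)
Lemma block_norm_dyadic_growth : exists2 k, (0 < k)%N & exists2 c : R, 0 < c &
  forall B, stationary_form B -> gap_bound B rho ->
  forall i m, (2 ^ (k * i) <= m)%N -> 8 ^+ i * (c * B 1 1) <= s B m ^+ 2.
Proof.
have [n0 [N [b b1 [c c0 [n00 growth]]]]] := block_norm_exp_growth.
have [w bw] := exp_ge_nat 8 b1.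
pose k := (N ^ w).+1.
have e0 n : 0 < 8 ^+ n :> R by rewrite exprn_gt0.
(* The first [n0] of the [i] gains are given up: [2 ^ (k * n0)] absorbs the starting length [n0],
   and the constant absorbs [8 ^+ n0]. *)
exists k => //; exists (c / 8 ^+ n0); first by rewrite divr_gt0.
move=> B hB hrho i m im; have v0 := form_ge0 hB 1.
have [growth0 growthS] := growth _ hB hrho.
have [h|h] := leqP n0 i; last first.
  have m0 : (0 < m)%N by rewrite (leq_trans _ im)// expn_gt0.
  apply: le_trans (growth0 _ m0).
  rewrite mulrA ler_wpM2r// mulrCA ger_pMr// ler_pdivrMr// mul1r.
  by rewrite ler_eXn2l ?ltr1n// ltnW.
apply: le_trans (growthS (w * (i - n0))%N m _); last first.
  apply: leq_trans im; rewrite -[X in (_ <= 2 ^ (k * X))%N](subnKC h) mulnDr expnD.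
  apply: leq_mul.
    by rewrite ltnW// (leq_trans (ltn_expl n0 (ltnSn 1)))// leq_exp2l// leq_pmull.
  rewrite !expnM; have [->//|in0] := posnP (i - n0)%N.
  by rewrite leq_exp2r// ltnW// ltnW// ltn_expl.
rewrite -[X in 8 ^+ X](subnKC h) exprD.
have -> : 8 ^+ n0 * 8 ^+ (i - n0) * (c / 8 ^+ n0 * B 1 1) =
  8 ^+ (i - n0) * (c * B 1 1) by field; rewrite gt_eqF.
rewrite ler_wpM2r ?mulr_ge0 ?(ltW c0)// exprM lerXn2r ?nnegrE ?exprn_ge0//.
by rewrite ltW// (lt_trans ltr01).
Qed.

(* Once the norms of the two halves grow polynomially, dropping a
   logarithmically small gap between them costs a summable relative error. *)
Lemma block_variance_bounds : exists C, exists2 c : R, 0 < C /\ 0 < c &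
  exists N0, forall B, stationary_form B -> gap_bound B rho -> forall m,
  s B m ^+ 2 <= C * (m%:R * B 1 1) /\
  ((N0 <= m)%N -> c * (m%:R * B 1 1) <= s B m ^+ 2).
Proof.
have [C C0 hC] := block_variance_ub rho0 rhoM.
have [k k0 [c c0 hc]] := block_norm_dyadic_growth.
(* The gap is paid for twice, once when it is cut from the first half and once when the shortened
   half is compared with the full one. Each payment is [C / c + 1] in units of [2 ^+ i] inverse. *)
pose K := 2 * (C / c + 1); have K0 : 0 <= K.
  by rewrite mulr_ge0// addr_ge0// divr_ge0 ?ltW.
pose x (i : nat) := rho (2 ^ i).-1 + K * (2 ^+ i)^-1.
have x0 i : 0 <= x i by rewrite addr_ge0// mulr_ge0// invr_ge0 exprn_ge0.
have xM J : \sum_(l < J) x (l %/ k)%N <= k%:R * (M + K * 2).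
  apply: (le_trans (@ler_sum_divn _ x k J k0 x0)); rewrite ler_wpM2l//.
  rewrite big_split/= -mulr_sumr; apply: lerD; first exact: rhoM.
  by rewrite ler_wpM2l// sum_exp2V_le.
have half : 0 < 1 / 2 :> R by rewrite divr_gt0.
(* Beyond the scale [j0] the relative losses add up to at most one half, so half of the bound
   survives all halvings. Dividing [c] by [2 ^+ j0.+1] makes the bound valid at the starting
   scale. *)
have [j0 tail] := bounded_sum_tail (fun l => x0 (l %/ k)%N) xM half.
pose c' := c / 2 ^+ j0.+1; have c'0 : 0 < c' by rewrite divr_gt0// exprn_gt0.
exists C, (c' / 2); first by rewrite C0 divr_gt0.
exists (2 ^ j0)%N => B hB hrho m; have v0 := form_ge0 hB 1.
have {}hC := hC _ hB hrho; have {}hc := hc _ hB hrho.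
split=> // mj0.
have main d m' : (2 ^ (j0 + d) <= m' <= 2 ^ (j0 + d).+1)%N ->
    c' * (1 - \sum_(j0 <= l < j0 + d) x (l %/ k)%N) * (m'%:R * B 1 1) <= s B m' ^+ 2.
  elim: d m' => [|d IH] {mj0}m.
    rewrite addn0 => /andP[mj mj'].
    rewrite big_geq// subr0 mulr1.
    have /hc : (2 ^ (k * 0) <= m)%N.
      by rewrite muln0 (leq_trans _ mj)// expn_gt0.
    rewrite expr0 mul1r; apply: le_trans.
    rewrite mulrA ler_wpM2r// /c' mulrAC ler_pdivrMr ?exprn_gt0//.
    by rewrite ler_wpM2l ?(ltW c0)// -natrX ler_nat.
  rewrite addnS => /andP[mj mj']; set j := (j0 + d)%N in mj mj' IH *.
  (* A nonpositive factor makes the bound trivial; otherwise [x i <= 1], which the products below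
     need. *)
  have [neg|pos] := leP (1 - \sum_(j0 <= l < j.+1) x (l %/ k)%N) 0.
    apply: le_trans (sqr_ge0 _); rewrite mulr_le0_ge0 ?mulr_ge0//.
    by rewrite mulr_ge0_le0// ltW.
  set i := (j %/ k)%N; pose q := (2 ^ i).-1; pose m1 := m./2; pose m2 := uphalf m.
  have mE : m = (m1 + m2)%N by rewrite /m1 /m2; clear; lia.
  have jj : (2 ^ j.+1 = 2 * 2 ^ j)%N by rewrite expnS.
  have jj' : (2 ^ j.+2 = 2 * 2 ^ j.+1)%N by rewrite expnS.
  have m1j : (2 ^ j <= m1 <= 2 ^ j.+1)%N by rewrite /m1; clear - jj jj' mj mj'; lia.
  have m2j : (2 ^ j <= m2 <= 2 ^ j.+1)%N by rewrite /m2; clear - jj jj' mj mj'; lia.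
  have ij : (2 ^ i <= 2 ^ j)%N by rewrite leq_exp2l// leq_div.
  have qm1 : (q <= m1)%N by rewrite /q; case/andP: m1j; clear - ij; lia.
  have := adjacent_blocks_cov hB hrho 0 m2 qm1; rewrite add0n.
  have := IH m1 m1j; have := IH m2 m2j.
  have s1q : s B (m1 - q) <= s B m1 + s B q.
    have -> : block 0 (m1 - q) = block 0 m1 - block (m1 - q) q :> {poly R}.
      by rewrite -[X in block 0 X - _](subnK qm1) blockD addrK.
    apply: (le_trans (form_normD hB _ _)); rewrite (form_normN hB).
    by rewrite (form_norm_block hB (m1 - q)).
  set t : R := (2 ^+ i)^-1; have t0 : 0 < t by rewrite invr_gt0 exprn_gt0.
  have sq : t^-1 * s B q ^+ 2 <= C / c * t * s B m2 ^+ 2.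
    have h1 : s B q ^+ 2 <= C * (t^-1 * B 1 1).
      apply: (le_trans (hC q)); rewrite ler_wpM2l ?(ltW C0)// ler_wpM2r//.
      by rewrite /t invrK -natrX ler_nat leq_pred.
    have h2 : t^-1 ^+ 3 * (c * B 1 1) <= s B m2 ^+ 2.
      rewrite /t invrK -exprM mulnC exprM -natrX; apply: hc.
      have /andP[m2lo _] := m2j.
      by rewrite (leq_trans _ m2lo)// leq_exp2l// mulnC leq_divM.
    apply: (@le_trans _ _ (t^-1 * (C * (t^-1 * B 1 1)))).
      by rewrite ler_wpM2l// invr_ge0 ltW.
    have -> : t^-1 * (C * (t^-1 * B 1 1)) = C / c * t * (t^-1 ^+ 3 * (c * B 1 1)).
      by field; rewrite !gt_eqF.
    by rewrite ler_wpM2l// mulr_ge0 ?divr_ge0 ?(ltW t0) ?(ltW c0) ?(ltW C0)//.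
  have r1 : rho q <= 1 by rewrite (le_trans (rho_le q))// ltW.
  have rq := rho0 q.
  have jj0 : (j0 <= j)%N by exact: leq_addr.
  rewrite big_nat_recr//= -/i in pos *; rewrite mE sqr_norm_blockD//.
  have S0 : 0 <= \sum_(j0 <= l < j) x (l %/ k)%N by rewrite sumr_ge0.
  have n1 := form_norm_ge0 B (block 0 m1).
  have n2 := form_norm_ge0 B (block 0 m2).
  have sq2 := ler_mul2_weighted (s B q) (s B m2) t0.
  have xi0 := x0 i; have xE : x i = rho q + K * t by [].
  set b := B (block 0 m1) _ => ih2 ih1 hb.
  have := ler_norm (- b); rewrite normrN => hb'.
  have y2 : 2 * (s B q * s B m2) <= K / 2 * t * s B m2 ^+ 2.
    by apply: (le_trans sq2); move: sq; rewrite /K; lra.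
  have hq : rho q * (s B (m1 - q) * s B m2) <=
      rho q * (s B m1 * s B m2) + s B q * s B m2.
    apply: (@le_trans _ _ (rho q * ((s B m1 + s B q) * s B m2))).
      by rewrite ler_wpM2l// ler_wpM2r.
    rewrite mulrDl mulrDr lerD2l ler_piMl// mulr_ge0//; exact: form_norm_ge0.
  have hs : rho q * (2 * (s B m1 * s B m2)) <=
      rho q * (s B m1 ^+ 2 + s B m2 ^+ 2).
    by rewrite ler_wpM2l//; have := ler_mul2_weighted (s B m1) (s B m2) ltr01; lra.
  have ht : K * t * s B m2 ^+ 2 <= K * t * (s B m1 ^+ 2 + s B m2 ^+ 2).
    by rewrite ler_wpM2l ?lerDr ?sqr_ge0// mulr_ge0// ltW.
  have lb : (1 - x i) * (s B m1 ^+ 2 + s B m2 ^+ 2) <=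
      s B m1 ^+ 2 + s B m2 ^+ 2 + 2 * b.
    by rewrite xE; move: hb hb' y2 hq hs ht; lra.
  apply: le_trans lb; rewrite natrD.
  set S := \sum_(_ <= _ < _) _ in S0 pos ih1 ih2 *.
  have x1 : 0 <= 1 - x i by move: pos S0; lra.
  apply: (@le_trans _ _ ((1 - x i) * (c' * (1 - S) * ((m1%:R + m2%:R) * B 1 1)))).
    have : 0 <= x i * S * c' * ((m1%:R + m2%:R) * B 1 1).
      apply: mulr_ge0; first by apply: mulr_ge0; [exact: mulr_ge0|exact: ltW].
      by apply: mulr_ge0 => //; exact: addr_ge0.
    by lra.
  by rewrite ler_wpM2l//; move: ih1 ih2; lra.
have m0 : (0 < m)%N by rewrite (leq_trans _ mj0)// expn_gt0.
have [d mE] : exists d, trunc_log 2 m = (j0 + d)%N.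
  by exists (trunc_log 2 m - j0)%N; rewrite subnKC// trunc_log_max.
apply: le_trans (main d m _); last first.
  by rewrite -mE; case/andP: (@trunc_log_bounds 2 m isT m0) => -> /ltnW.
rewrite ler_wpM2r ?mulr_ge0// ler_wpM2l ?(ltW c'0)//.
by have := tail (j0 + d)%N; lra.
Qed.

End variance_lower_bound.

(** * Variance bounds from correlations across disjoint, possibly interlaced, index sets *)

Section disjoint_supports.
Context {R : rcfType}.
Variables (B : {poly R} -> {poly R} -> R) (r : R).
Hypothesis hB : stationary_form B.
Hypothesis r01 : 0 <= r < 1.
Hypothesis hr : forall p q : {poly R}, (forall i, p`_i = 0 \/ q`_i = 0) ->
  `|B p q| <= r * (form_norm B p * form_norm B q).

(** Each new sign is chosen so that its cross term with the previous sum points in the wanted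
    direction, leaving the diagonal as a bound. [sg] decides whether the diagonal bounds from below
    or from above. *)
Lemma greedy_signs (sg : bool) (F : nat -> R) n :
  exists e : nat -> bool,
    let p : {poly R} := \sum_(i < n) ((-1) ^+ e i * F i) *: 'X^i in
    0 <= (-1) ^+ sg * (B p p - (\sum_(i < n) F i ^+ 2) * B 1 1).
Proof.
elim: n => [|n [e IH]].
  exists (fun=> false); cbv zeta.
  by rewrite !big_ord0 form0l// mul0r subrr mulr0.
set p : {poly R} := \sum_(i < n) _ in IH.
pose b := (-1) ^+ sg * (2 * (F n * B p 'X^n)) < 0.
exists (fun i => if i == n then b else e i); cbv zeta.
rewrite !big_ord_recr/= eqxx.
have -> : \sum_(i < n) ((-1) ^+ (if i == n :> nat then b else e i) * F i) *: 'X^i = p.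
  by apply: eq_bigr => i _; rewrite ltn_eqF.
rewrite (formDD hB) (formZl hB) !(formZr hB) -[X in B 'X^n X]mulr1.
rewrite -[X in B X ('X^n * _)]mulr1 (form_shift hB).
have -> : (-1) ^+ sg * (B p p + (-1) ^+ b * F n * ((-1) ^+ b * F n * B 1 1) +
     2 * ((-1) ^+ b * F n * B p 'X^n) -
     (\sum_(i < n) F i ^+ 2 + F n ^+ 2) * B 1 1) =
  (-1) ^+ sg * (B p p - (\sum_(i < n) F i ^+ 2) * B 1 1) +
  (-1) ^+ b * ((-1) ^+ sg * (2 * (F n * B p 'X^n))).
  by case: (b); case: sg IH @b => IH; ring.
rewrite addr_ge0// /b; case: ltP => h; first by rewrite mulN1r oppr_ge0 ltW.
by rewrite mul1r.
Qed.

(** A sign change turns [a + d] into [a - d] with [a] and [d] of disjoint supports. Twice the cross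
    term is at most [r] times [B a a + B d d], so both squared norms lie within the factors [1 - r]
    and [1 + r] of that sum. *)
Lemma sign_change_norm (F : nat -> R) n (e : nat -> bool) :
  let p : {poly R} := \sum_(i < n) F i *: 'X^i in
  let q : {poly R} := \sum_(i < n) ((-1) ^+ e i * F i) *: 'X^i in
  (1 - r) * B p p <= (1 + r) * B q q /\ (1 - r) * B q q <= (1 + r) * B p p.
Proof.
move=> p q.
pose a : {poly R} := \sum_(i < n | ~~ e i) F i *: 'X^i.
pose d : {poly R} := \sum_(i < n | e i) F i *: 'X^i.
have pE : p = a + d by rewrite /p (bigID (fun i : 'I_n => e i))/= addrC.
have qE : q = a - d.
  rewrite /q (bigID (fun i : 'I_n => e i))/= addrC -sumrN; congr (_ + _).
    by apply: eq_bigr => i /negbTE ->; rewrite mul1r.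
  by apply: eq_bigr => i ->; rewrite mulN1r scaleNr.
have coefs (P : pred 'I_n) k : (forall i : 'I_n, P i -> i != k :> nat) ->
    (\sum_(i < n | P i) F i *: 'X^i : {poly R})`_k = 0.
  move=> h; rewrite coef_sum big1// => i /h ik.
  by rewrite coefZ coefXn eq_sym (negbTE ik) mulr0.
have had : `|B a d| <= r * (form_norm B a * form_norm B d).
  apply: hr => k; have [ek|ek] := boolP (e k).
    by left; apply: coefs => i; apply: contraNneq => ->.
  by right; apply: coefs => i; apply: contraTneq => ->.
rewrite pE qE (formDD hB) (formBB hB).
have h1 := ler_mul2_weighted (form_norm B a) (form_norm B d) ltr01.
rewrite invr1 !mul1r !(form_normE hB) in h1.
case/andP: r01 => r0 r1; have h2 := ler_wpM2l r0 h1.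
have h3 := le_trans (ler_norm _) had.
have h4 : - B a d <= r * (form_norm B a * form_norm B d).
  by apply: le_trans had; rewrite -normrN ler_norm.
have h5 : (1 - r) * (2 * B a d) <= (1 - r) * (r * (B a a + B d d)).
  by apply: ler_wpM2l; lra.
have h6 : (1 - r) * (2 * - B a d) <= (1 - r) * (r * (B a a + B d d)).
  by apply: ler_wpM2l; lra.
have h7 : (1 + r) * (2 * B a d) <= (1 + r) * (r * (B a a + B d d)).
  by apply: ler_wpM2l; lra.
have h8 : (1 + r) * (2 * - B a d) <= (1 + r) * (r * (B a a + B d d)).
  by apply: ler_wpM2l; lra.
split; lra.
Qed.

(** Greedy signs give a comparison with the diagonal; returning to the original signs costs the
    ratio of [1 + r] and [1 - r]. *)
Lemma disjoint_variance_bounds (F : nat -> R) n :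
  let p : {poly R} := \sum_(i < n) F i *: 'X^i in
  (1 - r) * B p p <= (1 + r) * ((\sum_(i < n) F i ^+ 2) * B 1 1) /\
  (1 - r) * ((\sum_(i < n) F i ^+ 2) * B 1 1) <= (1 + r) * B p p.
Proof.
move=> p; case/andP: r01 => r0 r1.
have [e] := greedy_signs true F n; have [e'] := greedy_signs false F n.
rewrite /= expr1 mulN1r oppr_ge0 expr0 mul1r subr_le0 subr_ge0 => h' h; split.
  apply: le_trans (sign_change_norm F n e).1 _.
  by rewrite ler_wpM2l// addr_ge0.
apply: le_trans (sign_change_norm F n e').2.
by rewrite ler_wpM2l// subr_ge0 ltW.
Qed.

End disjoint_supports.

(** * Real-valued expectations and bounded random variables *)

Section mean.
Context {d : measure_display} {Omega : measurableType d} {R : realType}.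
Variable P : probability Omega R.
Implicit Types f g : Omega -> R.

(** Since [fine] returns a number even for an infinite expectation, the linearity rules carry
    membership in [Lfun]. *)
Definition mean f : R := fine 'E_P[f].

Lemma mean_cst c : mean (fun=> c) = c.
Proof. by rewrite /mean (expectation_cst P c). Qed.

Lemma meanD f g : f \in Lfun P 1 -> g \in Lfun P 1 ->
  mean (fun w => f w + g w) = mean f + mean g.
Proof. by move=> hf hg; rewrite /mean (expectationD hf hg) fineD ?expectation_fin_num. Qed.

Lemma meanB f g : f \in Lfun P 1 -> g \in Lfun P 1 ->
  mean (fun w => f w - g w) = mean f - mean g.
Proof. by move=> hf hg; rewrite /mean (expectationB hf hg) fineB ?expectation_fin_num. Qed.

Lemma meanZ c f : f \in Lfun P 1 -> mean (fun w => c * f w) = c * mean f.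
Proof.
move=> hf; rewrite /mean.
have -> : (fun w => c * f w) = c \o* f by apply/funext => w /=; rewrite mulrC.
by rewrite expectationZl// fineM// expectation_fin_num.
Qed.

Lemma mean_sum I (s : seq I) (F : I -> Omega -> R) :
  (forall i, F i \in Lfun P 1) ->
  mean (fun w => \sum_(i <- s) F i w) = \sum_(i <- s) mean (F i).
Proof.
move=> hF.
suff : (fun w => \sum_(i <- s) F i w) \in Lfun P 1 /\
    mean (fun w => \sum_(i <- s) F i w) = \sum_(i <- s) mean (F i) by case.
elim: s => [|i s [IH1 IH2]].
  rewrite big_nil; under eq_fun do rewrite big_nil.
  by split; [exact: (Lfun_cst P 0 1)|rewrite mean_cst].
rewrite big_cons -IH2; under eq_fun do rewrite big_cons.
by split; [exact: rpredD|rewrite meanD].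
Qed.

Lemma mean_ge0 f : (forall w, 0 <= f w) -> 0 <= mean f.
Proof. by move=> f0; rewrite fine_ge0// expectation_ge0. Qed.

Lemma le_mean f g : f \in Lfun P 1 -> g \in Lfun P 1 ->
  (forall w, f w <= g w) -> mean f <= mean g.
Proof.
move=> hf hg fg; rewrite -subr_ge0 -meanB//.
by apply: mean_ge0 => w; rewrite subr_ge0.
Qed.

Lemma ler_norm_mean f : f \in Lfun P 1 -> `|mean f| <= mean (fun w => `|f w|).
Proof.
move=> hf; have hf' : (fun w => `|f w|) \in Lfun P 1 by exact: Lfun_norm.
rewrite ler_norml; apply/andP; split; last first.
  by apply: le_mean => // w; exact: ler_norm.
rewrite -[leRHS]opprK lerN2 -mulN1r -meanZ//; apply: le_mean => //.
  have -> : (fun w => -1 * f w) = \- f by apply/funext => w /=; rewrite mulN1r.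
  by rewrite rpredN.
by move=> w; rewrite mulN1r -normrN ler_norm.
Qed.

Lemma Lfun2_sub_Lfun1 f : f \in Lfun P 2%:E -> f \in Lfun P 1.
Proof. by apply: Lfun_subset12; rewrite fin_num_measure. Qed.

Lemma Lfun_measurable (p : \bar R) f : f \in Lfun P p -> measurable_fun setT f.
Proof. by move=> /andP[+ _]; rewrite inE. Qed.

Lemma Lfun2_of_sqr f : measurable_fun setT f ->
  ('E_P[fun w => (f w ^+ 2)%R] < +oo)%E -> f \in Lfun P 2%:E.
Proof.
move=> mf; rewrite unlock => h; apply/andP; split; first by rewrite inE.
rewrite inE /= /finite_norm unlock /Lnorm; apply: poweR_lty.
apply: le_lt_trans h; rewrite le_eqVlt; apply/orP; left; apply/eqP.
by apply: eq_integral => w _ /=; rewrite powR_mulrn// real_normK// num_real.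
Qed.

(** The bound holds everywhere rather than almost everywhere, so no null sets have to be tracked
    through sums, products and compositions. *)
Definition bounded_rv f :=
  measurable_fun setT f /\ exists M, forall w, `|f w| <= M.

Lemma bounded_rv_cst c : bounded_rv (fun=> c).
Proof. by split=> //; exists `|c|. Qed.

Lemma bounded_rvD f g : bounded_rv f -> bounded_rv g ->
  bounded_rv (fun w => f w + g w).
Proof.
move=> [mf [M hM]] [mg [N hN]]; split; first exact: measurable_funD.
by exists (M + N) => w; rewrite (le_trans (ler_normD _ _))// lerD.
Qed.

Lemma bounded_rvM f g : bounded_rv f -> bounded_rv g ->
  bounded_rv (fun w => f w * g w).
Proof.
move=> [mf [M hM]] [mg [N hN]]; split; first exact: measurable_funM.
by exists (M * N) => w; rewrite normrM ler_pM.
Qed.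

Lemma bounded_rvZ c f : bounded_rv f -> bounded_rv (fun w => c * f w).
Proof. exact/bounded_rvM/bounded_rv_cst. Qed.

Lemma bounded_rvN f : bounded_rv f -> bounded_rv (fun w => - f w).
Proof.
by move=> /(bounded_rvZ (-1)); under eq_fun do rewrite mulN1r.
Qed.

Lemma bounded_rvB f g : bounded_rv f -> bounded_rv g ->
  bounded_rv (fun w => f w - g w).
Proof. by move=> hf /bounded_rvN; exact: bounded_rvD. Qed.

Lemma bounded_rvX f n : bounded_rv f -> bounded_rv (fun w => f w ^+ n).
Proof.
move=> hf; elim: n => [|n IH]; first exact: bounded_rv_cst.
by under eq_fun do rewrite exprS; exact: bounded_rvM.
Qed.

Lemma bounded_rv_norm f : bounded_rv f -> bounded_rv (fun w => `|f w|).
Proof.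
move=> [mf [M hM]]; split; first exact: measurableT_comp.
by exists M => w; rewrite normr_id.
Qed.

Lemma bounded_rv_sum I (s : seq I) (F : I -> Omega -> R) :
  (forall i, bounded_rv (F i)) -> bounded_rv (fun w => \sum_(i <- s) F i w).
Proof.
move=> hF; elim: s => [|i s IH].
  by under eq_fun do rewrite big_nil; exact: bounded_rv_cst.
by under eq_fun do rewrite big_cons; exact: bounded_rvD.
Qed.

Lemma bounded_rv_comp (h : R -> R) f M : measurable_fun setT h ->
  (forall x, `|h x| <= M) -> measurable_fun setT f ->
  bounded_rv (fun w => h (f w)).
Proof.
by move=> mh hM mf; split; [exact: (measurableT_comp mh)|exists M].
Qed.

Lemma bounded_rv_Lfun2 f : bounded_rv f -> f \in Lfun P 2%:E.
Proof.
move=> [mf [M hM]]; apply: Lfun2_of_sqr => //.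
rewrite unlock; apply: (@le_lt_trans _ _ (\int[P]_w (M ^+ 2)%:E)%E).
  apply: ge0_le_integral => //=.
  - by move=> w _; rewrite lee_fin sqr_ge0.
  - by apply/measurable_EFinP; exact: measurable_funX.
  - move=> w _; rewrite lee_fin -real_normK ?num_real//.
    by rewrite lerXn2r ?nnegrE// (le_trans _ (hM w)).
by rewrite integral_cst//= probability_setT mule1 ltry.
Qed.

Lemma bounded_rv_Lfun1 f : bounded_rv f -> f \in Lfun P 1.
Proof. by move=> /bounded_rv_Lfun2; exact: Lfun2_sub_Lfun1. Qed.

Lemma mean_bound f M : measurable_fun setT f -> (forall w, `|f w| <= M) ->
  `|mean f| <= M.
Proof.
move=> mf hM; have bf : bounded_rv f by split => //; exists M.
apply: (le_trans (ler_norm_mean (bounded_rv_Lfun1 bf))).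
rewrite -[leRHS]mean_cst; apply: le_mean => //.
  exact/bounded_rv_Lfun1/bounded_rv_norm.
exact/bounded_rv_Lfun1/bounded_rv_cst.
Qed.

Lemma Lfun2_mean_sqr f : f \in Lfun P 2%:E -> (fun w => f w ^+ 2) \in Lfun P 1.
Proof. by move=> hf; have := Lfun2_mul_Lfun1 hf hf. Qed.

Lemma Lfun2_mean_mul f g : f \in Lfun P 2%:E -> g \in Lfun P 2%:E ->
  (fun w => f w * g w) \in Lfun P 1.
Proof. exact: Lfun2_mul_Lfun1. Qed.

Lemma mean_CS f g : f \in Lfun P 2%:E -> g \in Lfun P 2%:E ->
  mean (fun w => f w * g w) ^+ 2 <=
  mean (fun w => f w ^+ 2) * mean (fun w => g w ^+ 2).
Proof.
move=> hf hg; have ff := Lfun2_mean_sqr hf; have gg := Lfun2_mean_sqr hg.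
have fg := Lfun2_mean_mul hf hg.
have h a b : 0 <= a ^+ 2 * mean (fun w => f w ^+ 2) +
    b ^+ 2 * mean (fun w => g w ^+ 2) + 2 * a * b * mean (fun w => f w * g w).
  have Z c k : k \in Lfun P 1 -> (fun w => c * k w) \in Lfun P 1.
    move=> hk; have -> : (fun w => c * k w) = c \o* k.
      by apply/funext => w /=; rewrite mulrC.
    exact: Lfun_scale.
  rewrite -!meanZ// -meanD ?Z// -meanD ?Z//; last by rewrite rpredD// Z.
  by apply: mean_ge0 => w; have := sqr_ge0 (a * f w + b * g w); lra.
move: (h 1 1) (h 1 (-1)) (h (mean (fun w => g w ^+ 2)) (- mean (fun w => f w * g w)))
  (h (mean (fun w => f w * g w)) (- mean (fun w => f w ^+ 2))).
have := mean_ge0 (fun w => sqr_ge0 (f w)); have := mean_ge0 (fun w => sqr_ge0 (g w)).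
move: (mean _) (mean _) (mean _) => z x y y0 x0 h1 h2 h3 h4.
have [x1|x1] := ltP 0 x; first nra.
have [y1|y1] := ltP 0 y; first nra.
have x_0 : x = 0 by lra.
have y_0 : y = 0 by lra.

have z_0 : z = 0 by move: h1 h2; rewrite x_0 y_0; lra.
by rewrite z_0 x_0 expr0n mul0r.
Qed.

Lemma mean_CS_norm f : f \in Lfun P 2%:E ->
  `|mean f| <= Num.sqrt (mean (fun w => f w ^+ 2)).
Proof.
move=> hf; have h1 : (fun=> 1) \in Lfun P 2%:E by exact: (Lfun_cst P 1 2).
have := mean_CS hf h1; under eq_fun do rewrite mulr1.
under [X in _ <= _ * mean X]eq_fun do rewrite expr1n.
rewrite mean_cst mulr1 => h; rewrite -sqrtr_sqr; exact: ler_wsqrtr.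
Qed.

Definition cov f g : R := fine (covariance P f g).

Lemma covE f g : f \in Lfun P 2%:E -> g \in Lfun P 2%:E ->
  cov f g = mean (fun w => f w * g w) - mean f * mean g.
Proof.
move=> hf hg; have f1 := Lfun2_sub_Lfun1 hf; have g1 := Lfun2_sub_Lfun1 hg.
have fg := Lfun2_mean_mul hf hg.
rewrite /cov covarianceE// fineB ?fin_numM ?expectation_fin_num//.
by rewrite fineM ?expectation_fin_num.
Qed.

End mean.

(** * Stationarity of finite windows and measurability for generated sigma-fields *)

Section windows.
Context {d : measure_display} {Omega : measurableType d} {R : realType}.
Variables (P : probability Omega R) (X : int -> {RV P >-> R}).
Hypothesis X_stationary : strictly_stationary X.

Definition window (a : int) m : Omega -> m.+1.-tuple R :=
  fun w => [tuple X (a + i%:Z) w | i < m.+1].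

Lemma measurable_window a m : measurable_fun setT (window a m).
Proof.
apply/measurable_fun_tnthP => i.
rewrite (_ : _ \o _ = X (a + i%:Z)); first exact: measurable_funPT.
by apply/funext => w; rewrite /window /= tnth_mktuple.
Qed.

HB.instance Definition _ a m :=
  isMeasurableFun.Build _ _ _ _ (window a m) (@measurable_window a m).

(** Stationarity identifies the laws of two windows as measures on tuples; integrating [F] against
    the common law transfers every functional of a window. *)
Lemma mean_window_shift m (F : m.+1.-tuple R -> R) a b :
  measurable_fun setT F ->
  (fun w => F (window a m w)) \in Lfun P 1 ->
  (fun w => F (window b m w)) \in Lfun P 1 ->
  mean P (fun w => F (window a m w)) = mean P (fun w => F (window b m w)).
Proof.
move=> mF /Lfun1_integrable ia /Lfun1_integrable ib.
rewrite /mean unlock; congr fine.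
have mEF : measurable_fun setT (EFin \o F) by apply/measurable_EFinP.
rewrite -(@integral_distribution _ _ _ _ _ P (window a m) (EFin \o F) mEF ia).
rewrite -(@integral_distribution _ _ _ _ _ P (window b m) (EFin \o F) mEF ib).
apply: eq_measure_integral => B mB _.
exact: (X_stationary a b mB).
Qed.

(** [measurable_fun] takes the sigma-algebra from the source type, so measurability for a smaller
    sigma-field is phrased by preimages, in the form that [L2] requires. *)
Definition measurable_wrt (A : set_system Omega) (f : Omega -> R) :=
  forall B : set R, measurable B -> A (f @^-1` B).

Lemma measurable_wrt_sigmaE G (f : Omega -> R) :
  measurable_wrt <<s G >> f <->
  measurable_fun setT (f : g_sigma_algebraType G -> R).
Proof.
split=> [h _ B mB|h B mB]; first by rewrite setTI; exact: h.
by have := h measurableT B mB; rewrite setTI.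
Qed.

Lemma measurable_wrt_comp A (h : R -> R) f : measurable_fun setT h ->
  measurable_wrt A f -> measurable_wrt A (fun w => h (f w)).
Proof.
move=> mh mf B mB; rewrite (_ : _ @^-1` B = f @^-1` (h @^-1` B))//.
by apply: mf; rewrite -[_ @^-1` _]setTI; exact: mh.
Qed.

Lemma measurable_wrt_sum S I (s : seq I) (F : I -> Omega -> R) :
  (forall i, measurable_wrt (sigma_gen X S) (F i)) ->
  measurable_wrt (sigma_gen X S) (fun w => \sum_(i <- s) F i w).
Proof.
move=> hF; apply/measurable_wrt_sigmaE; apply: measurable_sum => i.
exact/measurable_wrt_sigmaE.
Qed.

Lemma measurable_wrt_gen (S : set int) k : S k -> measurable_wrt (sigma_gen X S) (X k).
Proof.
move=> Sk B mB; apply: sub_sigma_algebra; exists k => //.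
by exists B => //; rewrite setTI.
Qed.

Lemma measurable_wrt_cst S c : measurable_wrt (sigma_gen X S) (fun=> c).
Proof. by apply/measurable_wrt_sigmaE. Qed.

End windows.

(** * Covariances and the correlation coefficient of two sigma-fields *)

Section covariance_facts.
Context {d : measure_display} {Omega : measurableType d} {R : realType}.
Variable P : probability Omega R.
Implicit Types f g h : Omega -> R.

Lemma cov_centered f g :
  cov P f g = mean P (fun w => (f w - mean P f) * (g w - mean P g)).
Proof. by rewrite /cov /mean unlock. Qed.

Lemma covC f g : cov P f g = cov P g f.
Proof. by rewrite /cov covarianceC. Qed.

Lemma cov_ge0 f : 0 <= cov P f f.
Proof. by rewrite cov_centered mean_ge0// => w; rewrite -expr2 sqr_ge0. Qed.

Lemma covDl f g h : f \in Lfun P 2%:E -> g \in Lfun P 2%:E -> h \in Lfun P 2%:E ->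
  cov P (fun w => f w + g w) h = cov P f h + cov P g h.
Proof.
move=> hf hg hh; rewrite /cov (covarianceDl hf hg hh) fineD//;
  by apply: covariance_fin_num;
    [exact: Lfun2_sub_Lfun1|exact: Lfun2_sub_Lfun1|exact: Lfun2_mean_mul].
Qed.

Lemma covZl c f g : f \in Lfun P 2%:E -> g \in Lfun P 2%:E ->
  cov P (fun w => c * f w) g = c * cov P f g.
Proof.
move=> hf hg; have fg := Lfun2_mean_mul hf hg.
have f1 := Lfun2_sub_Lfun1 hf; have g1 := Lfun2_sub_Lfun1 hg.
have -> : (fun w => c * f w) = c \o* f by apply/funext => w /=; rewrite mulrC.
by rewrite /cov covarianceZl// fineM// covariance_fin_num.
Qed.

Lemma cov_cstl c g : cov P (fun=> c) g = 0.
Proof. by rewrite /cov (covariance_cst_l P c). Qed.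

Lemma Lfun2Z c f : f \in Lfun P 2%:E -> (fun w => c * f w) \in Lfun P 2%:E.
Proof.
move=> hf; have -> : (fun w => c * f w) = c \o* f by apply/funext => w /=; rewrite mulrC.
by apply: (@Lfun_scale _ _ _ _ f c 2); rewrite ?ler1n.
Qed.

Lemma Lfun2D f g : f \in Lfun P 2%:E -> g \in Lfun P 2%:E ->
  (fun w => f w + g w) \in Lfun P 2%:E.
Proof.
move=> hf hg; have [_ h] := Lfun_submod_closed P (lee1n 2).
by have := h 1 f g hf hg; rewrite scale1r.
Qed.

Lemma Lfun2_cst c : (fun=> c) \in Lfun P 2%:E.
Proof. exact: (Lfun_cst P c 2). Qed.

Lemma Lfun2B f g : f \in Lfun P 2%:E -> g \in Lfun P 2%:E ->
  (fun w => f w - g w) \in Lfun P 2%:E.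
Proof.
move=> hf /(Lfun2Z (-1)) hg; have := Lfun2D hf hg.
by under eq_fun do rewrite mulN1r.
Qed.

Lemma Lfun2_sum I (s : seq I) (F : I -> Omega -> R) :
  (forall i, F i \in Lfun P 2%:E) -> (fun w => \sum_(i <- s) F i w) \in Lfun P 2%:E.
Proof.
move=> hF; elim: s => [|i s IH].
  by under eq_fun do rewrite big_nil; exact: Lfun2_cst.
by under eq_fun do rewrite big_cons; exact: Lfun2D.
Qed.

Lemma cov_CS f g : f \in Lfun P 2%:E -> g \in Lfun P 2%:E ->
  `|cov P f g| <= Num.sqrt (cov P f f) * Num.sqrt (cov P g g).
Proof.
move=> hf hg; rewrite -sqrtrM ?cov_ge0// -sqrtr_sqr; apply: ler_wsqrtr.
have cf := Lfun2B hf (Lfun2_cst (mean P f)).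
have cg := Lfun2B hg (Lfun2_cst (mean P g)).
by rewrite !cov_centered; have := mean_CS cf cg.
Qed.

Lemma cov_rho A B (r : R) f g : (rho_coef P A B <= r%:E)%E ->
  L2 P A f -> L2 P B g ->
  `|cov P f g| <= r * (Num.sqrt (cov P f f) * Num.sqrt (cov P g g)).
Proof.
move=> hr Af Bg; have [hf _] := Af; have [hg _] := Bg.
set s := (X in r * X).
(* If a standard deviation vanishes, [corr] is 0 by the division convention and carries no
   information on the covariance; Cauchy-Schwarz does. *)
have [s0|s0] := eqVneq s 0.
  by have := cov_CS hf hg; rewrite -/s s0 mulr0.
have sgt0 : 0 < s by rewrite lt_neqAle eq_sym s0 mulr_ge0// sqrtr_ge0.
have : (`|corr P f g|%:E <= r%:E)%E.
  apply: le_trans hr; apply: ereal_sup_ubound.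
  by exists f => //; exists g.
rewrite lee_fin /corr -/(cov P f g) /variance -/(cov P f f) -/(cov P g g) -/s.
by rewrite normrM normrV ?unitfE// (gtr0_norm sgt0) ler_pdivrMr.
Qed.

(** A supremum over an empty family would be [-oo]. The zero function lies in both spaces as soon as
    the two systems contain [set0] and [setT]. *)
Lemma rho_coef_ge0 A B : A set0 -> A setT -> B set0 -> B setT ->
  (0 <= rho_coef P A B)%E.
Proof.
have L20 C : C set0 -> C setT -> L2 P C (fun=> 0).
  move=> C0 CT; split; first exact: Lfun2_cst.
  move=> D _; have [D0|D0] := pselect (D 0).
    by rewrite (_ : _ @^-1` _ = setT)//; apply/seteqP; split.
  by rewrite (_ : _ @^-1` _ = set0)//; apply/seteqP; split.
move=> A0 AT B0 BT; apply: le_ereal_sup_tmp; exists (`|corr P (fun=> 0) (fun=> 0)|)%:E.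
  by exists (fun=> 0); [exact: L20|exists (fun=> 0) => //; exact: L20].
by rewrite lee_fin.
Qed.

Lemma rho_coef_le (A A' B B' : set_system Omega) : A `<=` A' -> B `<=` B' ->
  (rho_coef P A B <= rho_coef P A' B')%E.
Proof.
move=> AA BB; apply: ereal_sup_le => _ [f [hf Af] [g [hg Bg] <-]].
exists f; first by split=> // C mC; exact/AA/Af.
by exists g => //; split=> // C mC; exact/BB/Bg.
Qed.

End covariance_facts.

(** * Linear combinations along the process *)

Section process.
Context {d : measure_display} {Omega : measurableType d} {R : realType}.
Variables (P : probability Omega R) (X : int -> {RV P >-> R}).

Implicit Types (p q : {poly R}) (psi : R -> R) (a : int) (w : Omega).

(** The starting time [a] is kept apart from the polynomial: exponents are natural numbers, whereas
    the mixing coefficients look at times on both sides of 0. *)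
Definition lin (psi : R -> R) (a : int) (p : {poly R}) (w : Omega) : R :=
  \sum_(i < size p) p`_i * psi (X (a + i%:Z) w).

Lemma lin_widen psi a p n w : (size p <= n)%N ->
  lin psi a p w = \sum_(i < n) p`_i * psi (X (a + i%:Z) w).
Proof.
move=> pn; rewrite /lin.
rewrite (big_ord_widen n (fun i => p`_i * psi (X (a + i%:Z) w)) pn).
rewrite [RHS](bigID (fun i : 'I_n => (i < size p)%N))/= [X in _ = _ + X]big1 ?addr0// => i.
by rewrite -leqNgt => /(nth_default 0) ->; rewrite mul0r.
Qed.

Lemma linD psi a p q w : lin psi a (p + q) w = lin psi a p w + lin psi a q w.
Proof.
pose n := maxn (size p) (size q).
rewrite !(@lin_widen _ _ _ n) ?leq_maxl ?leq_maxr ?size_polyD// -big_split/=.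
by apply: eq_bigr => i _; rewrite coefD mulrDl.
Qed.

Lemma linZ psi a c p w : lin psi a (c *: p) w = c * lin psi a p w.
Proof.
rewrite (@lin_widen _ _ (c *: p) (size p)) ?size_scale_leq// /lin mulr_sumr.
by apply: eq_bigr => i _; rewrite coefZ mulrA.
Qed.

Lemma lin0 psi a w : lin psi a 0 w = 0.
Proof. by rewrite /lin size_poly0 big_ord0. Qed.

Lemma lin_sumX psi a n (F : nat -> R) w :
  lin psi a (\sum_(i < n) F i *: 'X^i) w = \sum_(i < n) F i * psi (X (a + i%:Z) w).
Proof.
rewrite -poly_def (@lin_widen _ _ _ n) ?size_poly//.
by apply: eq_bigr => i _; rewrite coef_poly ltn_ord.
Qed.

Lemma lin_block psi a b m w :
  lin psi a (block b m) w = \sum_(i < m) psi (X (a + (b + i)%:Z) w).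
Proof.
elim: m => [|m IH]; first by rewrite block0 lin0 big_ord0.
rewrite -addn1 blockD linD IH block1 addn1 big_ord_recr/=; congr (_ + _).
rewrite /lin size_polyXn big_ord_recr/= coefXn eqxx mul1r big1 ?add0r// => i _.
by rewrite coefXn ltn_eqF// mul0r.
Qed.

Lemma lin1 psi a w : lin psi a 1 w = psi (X a w).
Proof. by rewrite /lin size_poly1 big_ord1 coef1 mul1r addr0. Qed.

Lemma linX psi a p w : lin psi a ('X * p) w = lin psi (a + 1) p w.
Proof.
rewrite mulrC (@lin_widen _ _ _ (size p).+1) ?size_mulX_leq//; last first.
  by have [->|p0] := eqVneq p 0; rewrite ?mul0r ?size_poly0// size_mulX.
rewrite big_ord_recl coefMX mul0r add0r; apply: eq_bigr => i _.
by rewrite coefMX/= /bump/= add1n -addn1 PoszD [(i%:Z + 1)]addrC addrA.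
Qed.

Lemma measurable_lin psi a p : measurable_fun setT psi ->
  measurable_fun setT (lin psi a p).
Proof.
move=> mpsi; apply: measurable_sum => i; apply: measurable_funM => //.
exact: (measurableT_comp mpsi).
Qed.

Lemma lin_measurable_wrt psi a p (S : set int) : measurable_fun setT psi ->
  (forall i : nat, p`_i != 0 -> S (a + i%:Z)) ->
  measurable_wrt (sigma_gen X S) (lin psi a p).
Proof.
move=> mpsi pS; apply: measurable_wrt_sum => i.
have [->|/pS hS] := eqVneq p`_i 0.
  by under eq_fun do rewrite mul0r; exact: measurable_wrt_cst.
apply: (@measurable_wrt_comp _ _ _ _ (fun x => p`_i * psi x)).
  exact: measurable_funM.
exact: measurable_wrt_gen.
Qed.

Section square_integrable.
Variable psi : R -> R.
Hypothesis mpsi : measurable_fun setT psi.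
Hypothesis psi2 : forall k, (fun w => psi (X k w)) \in Lfun P 2%:E.

Lemma lin_Lfun2 a p : lin psi a p \in Lfun P 2%:E.
Proof. by apply: Lfun2_sum => i; exact: Lfun2Z. Qed.

End square_integrable.

Hypothesis X_stationary : strictly_stationary X.

Lemma mean_lin_shift psi (h : R -> R -> R) p q a b : measurable_fun setT psi ->
  measurable_fun setT (fun z : R * R => h z.1 z.2) ->
  (forall a, (fun w => h (lin psi a p w) (lin psi a q w)) \in Lfun P 1) ->
  mean P (fun w => h (lin psi a p w) (lin psi a q w)) =
  mean P (fun w => h (lin psi b p w) (lin psi b q w)).
Proof.
move=> mpsi mh hL; pose m := maxn (size p) (size q).
pose L (r : {poly R}) (t : m.+1.-tuple R) := \sum_(i < m.+1) r`_i * psi (tnth t i).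
have mL r : measurable_fun setT (L r).
  apply: measurable_sum => i; apply: measurable_funM => //.
  exact: (measurableT_comp mpsi (measurable_tnth i)).
pose F t := h (L p t) (L q t).
have mF : measurable_fun setT F.
  exact: (measurableT_comp mh (measurable_fun_pair (mL p) (mL q))).
have E c : (fun w => h (lin psi c p w) (lin psi c q w)) = (fun w => F (window X c m w)).
  apply/funext => w; rewrite /F /L.
  rewrite (@lin_widen _ _ p m.+1) ?(@lin_widen _ _ q m.+1); last 2 first.
  - by rewrite leqW// leq_maxr.
  - by rewrite leqW// leq_maxl.
  by congr h; apply: eq_bigr => i _; rewrite tnth_mktuple.
rewrite !E; apply: (mean_window_shift X_stationary mF); rewrite -E; exact: hL.
Qed.

End process.

(** * The covariance inequality for strong mixing *)

Section alpha_covariance.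
Context {d : measure_display} {Omega : measurableType d} {R : realType}.
Variable P : probability Omega R.
Implicit Types f g : Omega -> R.

Lemma cov_bound f g M N : measurable_fun setT f -> measurable_fun setT g ->
  (forall w, `|f w| <= M) -> (forall w, `|g w| <= N) ->
  `|cov P f g| <= 2 * (M * N).
Proof.
move=> mf mg fM gN.
have bf : bounded_rv f by split=> //; exists M.
have bg : bounded_rv g by split=> //; exists N.
rewrite covE ?bounded_rv_Lfun2// (le_trans (ler_normB _ _))//.
rewrite (_ : 2 * _ = M * N + M * N); last by ring.
apply: lerD; last by rewrite normrM ler_pM// mean_bound.
apply: mean_bound; first exact: measurable_funM.
by move=> w; rewrite normrM ler_pM.
Qed.

Lemma covBl f g h : f \in Lfun P 2%:E -> g \in Lfun P 2%:E -> h \in Lfun P 2%:E ->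
  cov P (fun w => f w - g w) h = cov P f h - cov P g h.
Proof.
move=> hf hg hh.
rewrite -[cov P g h]mul1r -mulNr -covZl// -covDl ?Lfun2Z//.
by congr cov; apply/funext => w; rewrite mulN1r.
Qed.

Lemma cov_suml I (s : seq I) (F : I -> Omega -> R) g :
  (forall i, F i \in Lfun P 2%:E) -> g \in Lfun P 2%:E ->
  cov P (fun w => \sum_(i <- s) F i w) g = \sum_(i <- s) cov P (F i) g.
Proof.
move=> hF hg; elim: s => [|i s IH].
  by rewrite big_nil; under eq_fun do rewrite big_nil; rewrite cov_cstl.
rewrite big_cons -IH; under eq_fun do rewrite big_cons.
by rewrite covDl// Lfun2_sum.
Qed.

(** For [x] between 0 and 1 this is [x] rounded down to a multiple of [n.+1%:R^-1], written as an
    average of indicators of level sets. *)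
Definition staircase n (x : R) : R :=
  n.+1%:R^-1 * \sum_(i < n.+1) (i.+1%:R <= n.+1%:R * x)%R%:R.

Lemma staircase_close n x : 0 <= x <= 1 -> `|x - staircase n x| <= n.+1%:R^-1.
Proof.
move=> /andP[x0 x1]; set y := n.+1%:R * x.
have y0 : 0 <= y by rewrite mulr_ge0.
have n0 : 0 < n.+1%:R :> R by rewrite ltr0n.
have tn : (Num.truncn y <= n.+1)%N.
  rewrite -(ler_nat R); apply: (@le_trans _ _ y); first by rewrite truncn_le.
  by rewrite /y ger_pMr.
have -> : staircase n x = n.+1%:R^-1 * (Num.truncn y)%:R.
  rewrite /staircase -/y -natr_sum; congr (_ * _%:R).
  under eq_bigr => i _ do rewrite -truncn_ge_nat//.
  suff h k N : (\sum_(i < N) (i < k)%N = minn k N)%N by rewrite h (minn_idPl tn).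
  elim: N => [|N IH]; first by rewrite big_ord0 minn0.
  by rewrite big_ord_recr/= IH; clear; lia.
have -> : x = n.+1%:R^-1 * y by rewrite /y mulKf// gt_eqF.
rewrite -mulrBr normrM gtr0_norm ?invr_gt0// ger_pMr ?invr_gt0//.
rewrite ger0_norm ?subr_ge0 ?truncn_le//.
by have := truncnS_gt y; rewrite -natr1; lra.
Qed.

(** The covariance of two averages of indicators is an average of covariances of events, each at
    most [a]. Rounding the two functions costs [2 * n.+1%:R^-1] each, which tends to 0. *)
Lemma cov_alpha01 A B (a : R) f g : (alpha_coef P A B <= a%:E)%E ->
  measurable_fun setT f -> measurable_fun setT g ->
  measurable_wrt A f -> measurable_wrt B g ->
  (forall w, 0 <= f w <= 1) -> (forall w, 0 <= g w <= 1) ->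
  `|cov P f g| <= a.
Proof.
move=> ha mf mg Af Bg f01 g01; apply/ler_addgt0Pr => e e0.
have [n hn] : exists n, 4 * n.+1%:R^-1 <= e.
  exists (Num.truncn (4 / e)); rewrite ler_pdivrMr ?ltr0n// mulrC -ler_pdivrMr//.
  exact/ltW/truncnS_gt.
pose U (i : nat) := [set w | i.+1%:R <= n.+1%:R * f w].
pose V (i : nat) := [set w | i.+1%:R <= n.+1%:R * g w].
have mset (k : nat) : measurable [set x : R | k.+1%:R <= n.+1%:R * x].
  rewrite (_ : [set x | _] = `[k.+1%:R / n.+1%:R, +oo[%classic)//.
  by apply/seteqP; split=> x /=; rewrite in_itv/= andbT ler_pdivrMr ?ltr0n// mulrC.
have AU i : A (U i) by exact: (Af _ (mset i)).
have BV i : B (V i) by exact: (Bg _ (mset i)).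
have mU i : measurable (U i) by rewrite -[U i]setTI; exact: (mf measurableT _ (mset i)).
have mV i : measurable (V i) by rewrite -[V i]setTI; exact: (mg measurableT _ (mset i)).
pose fn w := staircase n (f w); pose gn w := staircase n (g w).
have indE (W : set Omega) : measurable W -> bounded_rv (\1_W : Omega -> R).
  by move=> mW; split => //; exists 1 => w; rewrite indicE; case: (_ \in _); rewrite ?normr1 ?normr0.
have stair (h : Omega -> R) w : staircase n (h w) =
    \sum_(i < n.+1) n.+1%:R^-1 * \1_[set w | i.+1%:R <= n.+1%:R * h w] w.
  rewrite /staircase mulr_sumr; apply: eq_bigr => i _; congr (_ * _).
  rewrite indicE; congr ((nat_of_bool _)%:R).
  by apply/idP/idP; rewrite inE.
have fnE : fn = fun w => \sum_(i < n.+1) n.+1%:R^-1 * \1_(U i) w.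
  by apply/funext => w; exact: stair.
have gnE : gn = fun w => \sum_(i < n.+1) n.+1%:R^-1 * \1_(V i) w.
  by apply/funext => w; exact: stair.
have bfn : bounded_rv fn.
  by rewrite fnE; apply: bounded_rv_sum => i; apply: bounded_rvZ; exact: indE.
have bgn : bounded_rv gn.
  by rewrite gnE; apply: bounded_rv_sum => i; apply: bounded_rvZ; exact: indE.
have bf : bounded_rv f.
  by split=> //; exists 1 => w; case/andP: (f01 w) => f0 f1; rewrite ger0_norm.
have bg : bounded_rv g.
  by split=> //; exists 1 => w; case/andP: (g01 w) => g0 g1; rewrite ger0_norm.
have n1 : n.+1%:R^-1 <= 1 :> R by rewrite invf_le1 ?ltr0n// ler1n.
have f1 := fun w => staircase_close n (f01 w).
have g1 := fun w => staircase_close n (g01 w).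
have fn1 w : `|fn w| <= 1.
  rewrite /fn /staircase normrM ger0_norm ?invr_ge0// ler_pdivrMl ?ltr0n// mulr1.
  rewrite ger0_norm ?sumr_ge0// -natr_sum ler_nat.
  rewrite -[leqRHS](card_ord n.+1) -sum1_card.
  by apply: leq_sum => i _; exact: leq_b1.
have cUV : `|cov P fn gn| <= a.
  rewrite fnE cov_suml; last 2 first.
  - by move=> i; apply/bounded_rv_Lfun2/bounded_rvZ/indE.
  - exact: bounded_rv_Lfun2.
  have cij (i j : nat) : `|cov P (\1_(U i)) (\1_(V j))| <= a.
    rewrite covE ?bounded_rv_Lfun2//; try exact: indE.
    have -> : (fun w => \1_(U i) w * \1_(V j) w) = \1_(U i `&` V j) :> (Omega -> R).
      by apply/funext => w; rewrite indicI.
    rewrite /mean !expectation_indic//; last exact: measurableI.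
    have : (`|P (U i `&` V j) - P (U i) * P (V j)| <= a%:E)%E.
      apply: le_trans ha; apply: ereal_sup_ubound.
      by exists (U i) => //; exists (V j).
    move=> h; rewrite -lee_fin (le_trans _ h)// -abse_EFin EFinB EFinM.
    by rewrite !fineK ?fin_num_measure//; exact: measurableI.
  apply: (le_trans (ler_norm_sum _ _ _)).
  rewrite [leRHS](_ : a = \sum_(i < n.+1) n.+1%:R^-1 * a); last first.
    by rewrite sumr_const card_ord -[RHS]mulr_natl mulrA mulfV ?mul1r ?pnatr_eq0.
  apply: ler_sum => i _; rewrite covZl; last 2 first.
  - exact/bounded_rv_Lfun2/indE.
  - exact: bounded_rv_Lfun2.
  rewrite normrM ger0_norm ?invr_ge0// ler_wpM2l ?invr_ge0//.
  rewrite covC gnE cov_suml; last 2 first.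
  - by move=> j; apply/bounded_rv_Lfun2/bounded_rvZ/indE.
  - exact/bounded_rv_Lfun2/indE.
  apply: (le_trans (ler_norm_sum _ _ _)).
  rewrite [leRHS](_ : a = \sum_(i < n.+1) n.+1%:R^-1 * a); last first.
    by rewrite sumr_const card_ord -[RHS]mulr_natl mulrA mulfV ?mul1r ?pnatr_eq0.
  apply: ler_sum => j _; rewrite covZl; last 2 first.
  - exact/bounded_rv_Lfun2/indE.
  - exact/bounded_rv_Lfun2/indE.
  by rewrite normrM ger0_norm ?invr_ge0// ler_wpM2l ?invr_ge0// covC.
have e1 : `|cov P (fun w => f w - fn w) g| <= 2 * n.+1%:R^-1.
  rewrite -[X in 2 * X]mulr1; apply: cov_bound => //.
    by apply: measurable_funB => //; exact: bfn.1.
  by move=> w; case/andP: (g01 w) => ? ?; rewrite ger0_norm.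
have e2 : `|cov P (fun w => g w - gn w) fn| <= 2 * n.+1%:R^-1.
  rewrite -[X in 2 * X]mulr1; apply: cov_bound => //; last exact: bfn.1.
  by apply: measurable_funB => //; exact: bgn.1.
move: e1 e2; rewrite !covBl ?bounded_rv_Lfun2// (covC P gn) (covC P g fn).
move: cUV hn; rewrite !ler_norml.
move: (n.+1%:R^-1) => z /andP[? ?] ? /andP[? ?] /andP[? ?].
by apply/andP; split; lra.
Qed.

(** Mapping the ranges affinely onto the unit interval divides the covariance by [4 * (M * N)]. *)
Lemma cov_alpha A B (a : R) f g (M N : R) : (alpha_coef P A B <= a%:E)%E ->
  measurable_fun setT f -> measurable_fun setT g ->
  measurable_wrt A f -> measurable_wrt B g -> 0 < M -> 0 < N ->
  (forall w, `|f w| <= M) -> (forall w, `|g w| <= N) ->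
  `|cov P f g| <= 4 * a * (M * N).
Proof.
move=> ha mf mg Af Bg M0 N0 fM gN.
pose u (K : R) x := (2 * K)^-1 * (x + K).
have mu K : measurable_fun setT (u K) by apply: measurable_funM => //; exact: measurable_funD.
have u01 K x : 0 < K -> `|x| <= K -> 0 <= u K x <= 1.
  move=> K0; rewrite ler_norml => /andP[h1 h2].
  rewrite /u mulr_ge0 ?invr_ge0 ?mulr_ge0 ?(ltW K0)//=; last by lra.
  by rewrite ler_pdivrMl ?mulr_gt0// mulr1; lra.
have bf : bounded_rv f by split=> //; exists M.
have bg : bounded_rv g by split=> //; exists N.
have h : `|cov P (fun w => u M (f w)) (fun w => u N (g w))| <= a.
  apply: (cov_alpha01 ha).
  - exact: (measurableT_comp (mu M)).
  - exact: (measurableT_comp (mu N)).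
  - exact: (measurable_wrt_comp (mu M)).
  - exact: (measurable_wrt_comp (mu N)).
  - by move=> w; exact: u01.
  - by move=> w; exact: u01.
have cu K k l : bounded_rv k -> bounded_rv l ->
    cov P (fun w => u K (k w)) l = (2 * K)^-1 * cov P k l.
  move=> bk bl; have kK : bounded_rv (fun w => k w + K) by apply/bounded_rvD/bounded_rv_cst.
  rewrite covZl ?bounded_rv_Lfun2// (@covDl _ _ _ _ k (fun=> K)) ?bounded_rv_Lfun2//.
    by rewrite cov_cstl addr0.
  exact: bounded_rv_cst.
have bu (K : R) (k : Omega -> R) : bounded_rv k -> bounded_rv (fun w => u K (k w)).
  by move=> bk; apply/bounded_rvZ/bounded_rvD/bounded_rv_cst.
have e1 := cu M f _ bf (bu N g bg); have e2 := cu N g f bg bf.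
have MN0 : 0 < (4 * (M * N))^-1 by rewrite invr_gt0 !mulr_gt0.
move: h; rewrite e1 (covC P f) e2 (covC P g).
have -> : (2 * M)^-1 * ((2 * N)^-1 * cov P f g) = (4 * (M * N))^-1 * cov P f g.
  by field; rewrite !gt_eqF.
rewrite normrM (gtr0_norm MN0) ler_pdivrMl ?mulr_gt0//.
by congr (_ <= _); ring.
Qed.

End alpha_covariance.

(** * Mixing coefficients applied to functions of linear combinations *)

Section process_covariances.
Context {d : measure_display} {Omega : measurableType d} {R : realType}.
Variables (P : probability Omega R) (X : int -> {RV P >-> R}).
Implicit Types (p q : {poly R}) (psi h : R -> R) (a : int) (w : Omega).

Local Notation lin := (lin X).

Lemma sigma_gen_set0 S : sigma_gen X S set0.
Proof. exact: sigma_algebra0. Qed.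

Lemma sigma_gen_setT S : sigma_gen X S setT.
Proof. by have := sigma_algebraCD (@sigma_gen_set0 S); rewrite setTD setC0. Qed.

Lemma sigma_gen_sub (S T : set int) : S `<=` T -> sigma_gen X S `<=` sigma_gen X T.
Proof.
move=> ST; apply: sub_sigma_algebra2 => A [k Sk hk].
by exists k => //; exact: ST.
Qed.

Lemma rho_mix_ge0 n : (0 <= rho_mix X n)%E.
Proof. by apply: rho_coef_ge0; try exact: sigma_gen_set0; exact: sigma_gen_setT. Qed.

Lemma rho_mix_le m n : (m <= n)%N -> (rho_mix X n <= rho_mix X m)%E.
Proof.
move=> mn; apply: rho_coef_le => //; apply: sigma_gen_sub => k /=.
by apply: le_trans; rewrite lez_nat.
Qed.

Lemma measurable_h_lin psi h a p : measurable_fun setT psi -> measurable_fun setT h ->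
  measurable_fun setT (fun w => h (lin psi a p w)).
Proof. by move=> mpsi mh; exact: (measurableT_comp mh (@measurable_lin _ _ _ _ X psi a p mpsi)). Qed.

Lemma h_lin_wrt psi h a p (S : set int) :
  measurable_fun setT psi -> measurable_fun setT h ->
  (forall i : nat, p`_i != 0 -> S (a + i%:Z)) ->
  measurable_wrt (sigma_gen X S) (fun w => h (lin psi a p w)).
Proof.
move=> mpsi mh pS; apply: (measurable_wrt_comp mh).
exact: lin_measurable_wrt.
Qed.

(** Distinct integers are at distance at least 1, so disjoint supports qualify for the coefficient
    of index 1. The functions [h1] and [h2] are kept general because squares of sums are needed for
    the fourth moments. *)
Lemma cov_lin_rho_star r psi h1 h2 p q : (rho_star_mix X 1 <= r%:E)%E -> 0 <= r ->
  measurable_fun setT psi -> measurable_fun setT h1 -> measurable_fun setT h2 ->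
  (fun w => h1 (lin psi 0 p w)) \in Lfun P 2%:E ->
  (fun w => h2 (lin psi 0 q w)) \in Lfun P 2%:E ->
  (forall i, p`_i = 0 \/ q`_i = 0) ->
  let f w := h1 (lin psi 0 p w) in let g w := h2 (lin psi 0 q w) in
  is_true (`|cov P f g| <= r * (Num.sqrt (cov P f f) * Num.sqrt (cov P g g))).
Proof.
move=> hr r0 mpsi mh1 mh2 L1 L2' pq f g.
have rhs0 : 0 <= r * (Num.sqrt (cov P f f) * Num.sqrt (cov P g g)).
  by rewrite !mulr_ge0// sqrtr_ge0.
have lin00 : forall w, lin psi 0 0 w = 0 by move=> w; exact: lin0.
(* The supremum in [rho_star_mix] runs over nonempty index sets, so zero polynomials are treated
   apart. *)
have [p0|p0] := eqVneq p 0.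
  have fE : f = fun=> h1 0 by apply/funext => w; rewrite /f p0 lin00.
  by have -> : cov P f g = 0; [rewrite fE cov_cstl|rewrite normr0].
have [q0|q0] := eqVneq q 0.
  have gE : g = fun=> h2 0 by apply/funext => w; rewrite /g q0 lin00.
  by have -> : cov P f g = 0; [rewrite covC gE cov_cstl|rewrite normr0].
pose S (u : {poly R}) : set int := [set k | exists2 i : nat, u`_i != 0 & k = 0 + i%:Z].
have S0 u : u != 0 -> S u !=set0.
  move=> u0; exists (0 + (size u).-1%:Z); exists (size u).-1 => //.
  by rewrite -/(lead_coef u) lead_coef_eq0.
have SI : S p `&` S q = set0.
  rewrite -subset0 => _ [/= [i pi ->] [j qj]]; rewrite !add0r => -[ij].
  by case: (pq i) => /eqP; [rewrite (negbTE pi)|rewrite ij (negbTE qj)].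
apply: (@cov_rho _ _ _ P (sigma_gen X (S p)) (sigma_gen X (S q))).
- apply: le_trans hr; apply: ereal_sup_ubound; exists (S p, S q) => //=.
  split=> //; [exact: S0|exact: S0|].
  rewrite /set_dist; apply/ereal_infP => _ [s Ss [t Tt <-]].
  rewrite lee_fin ler1z -gtz0_ge1 normr_gt0 subr_eq0.
  by apply/eqP => st; have : (S p `&` S q) s by [split=> //; rewrite st]; rewrite SI.
- by split=> // B mB; apply: (@h_lin_wrt psi h1 0 p) => // i pi; exists i.
- by split=> // B mB; apply: (@h_lin_wrt psi h2 0 q) => // i qi; exists i.
Qed.

Hypothesis X_stationary : strictly_stationary X.

Lemma cov_lin_shift psi h1 h2 p q a b : measurable_fun setT psi ->
  measurable_fun setT h1 -> measurable_fun setT h2 ->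
  (forall a, (fun w => h1 (lin psi a p w)) \in Lfun P 2%:E) ->
  (forall a, (fun w => h2 (lin psi a q w)) \in Lfun P 2%:E) ->
  cov P (fun w => h1 (lin psi a p w)) (fun w => h2 (lin psi a q w)) =
  cov P (fun w => h1 (lin psi b p w)) (fun w => h2 (lin psi b q w)).
Proof.
move=> mpsi mh1 mh2 L1 L2'; rewrite !covE//.
have m1 : measurable_fun setT (fun z : R * R => h1 z.1).
  exact: (measurableT_comp mh1 measurable_fst).
have m2 : measurable_fun setT (fun z : R * R => h2 z.2).
  exact: (measurableT_comp mh2 measurable_snd).
rewrite (@mean_lin_shift _ _ _ _ _ X_stationary psi (fun x y => h1 x * h2 y) p q a b)//; last 2 first.
- exact: measurable_funM.
- by move=> c; exact: Lfun2_mean_mul.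
rewrite (@mean_lin_shift _ _ _ _ _ X_stationary psi (fun x y => h1 x) p q a b)//; last first.
  by move=> c; exact: Lfun2_sub_Lfun1.
rewrite (@mean_lin_shift _ _ _ _ _ X_stationary psi (fun x y => h2 y) p q a b)//.
by move=> c; exact: Lfun2_sub_Lfun1.
Qed.

Lemma cov_lin_rho n r c psi h1 h2 p q : (rho_mix X n.+1 <= r%:E)%E ->
  measurable_fun setT psi -> measurable_fun setT h1 -> measurable_fun setT h2 ->
  (forall a, (fun w => h1 (lin psi a p w)) \in Lfun P 2%:E) ->
  (forall a, (fun w => h2 (lin psi a q w)) \in Lfun P 2%:E) ->
  (size p <= c)%N -> (forall i, (i < c + n)%N -> q`_i = 0) ->
  let f w := h1 (lin psi 0 p w) in let g w := h2 (lin psi 0 q w) in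
  is_true (`|cov P f g| <= r * (Num.sqrt (cov P f f) * Num.sqrt (cov P g g))).
Proof.
move=> hr mpsi mh1 mh2 L1 L2' pc qc f g; rewrite /f /g.
(* This start puts the last possible index [c - 1] of [p] at time 0 and the first possible index
   [c + n] of [q] at time [n + 1], hence the mixing coefficient of index [n.+1]. *)
pose a : int := 1 - c%:Z.
rewrite !(@cov_lin_shift psi _ _ _ _ 0 a)//.
apply: cov_rho hr _ _; split=> // B mB.
- apply: (@h_lin_wrt psi h1 a p) => // i pi /=; rewrite /a.
  have : (i < c)%N by rewrite (leq_trans _ pc)// ltnNge; apply: contra pi => /(nth_default 0) ->.
  by clear; lia.
- apply: (@h_lin_wrt psi h2 a q) => // i qi /=; rewrite /a.
  have : (c + n <= i)%N by rewrite leqNgt; apply: contra qi => /qc ->.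
  by clear; lia.
Qed.

Lemma cov_lin_alpha n r c psi h1 h2 p q (M N : R) : (alpha_mix X n.+1 <= r%:E)%E ->
  measurable_fun setT psi -> measurable_fun setT h1 -> measurable_fun setT h2 ->
  0 < M -> 0 < N -> (forall x, `|h1 x| <= M) -> (forall x, `|h2 x| <= N) ->
  (size p <= c)%N -> (forall i, (i < c + n)%N -> q`_i = 0) ->
  `|cov P (fun w => h1 (lin psi 0 p w)) (fun w => h2 (lin psi 0 q w))| <=
    4 * r * (M * N).
Proof.
move=> hr mpsi mh1 mh2 M0 N0 hM hN pc qc.
pose a : int := 1 - c%:Z.
have L h K b u : measurable_fun setT h -> (forall x, `|h x| <= K) ->
    (fun w => h (lin psi b u w)) \in Lfun P 2%:E.
  move=> mh hK; apply: bounded_rv_Lfun2.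
  by apply: (bounded_rv_comp mh hK); exact: measurable_lin.
rewrite (@cov_lin_shift psi _ _ _ _ 0 a)//; try by move=> b; apply: L.
apply: cov_alpha hr _ _ _ _ M0 N0 _ _ => //.
- exact: measurable_h_lin.
- exact: measurable_h_lin.
- apply: (@h_lin_wrt psi h1 a p) => // i pi /=; rewrite /a.
  have : (i < c)%N by rewrite (leq_trans _ pc)// ltnNge; apply: contra pi => /(nth_default 0) ->.
  by clear; lia.
- apply: (@h_lin_wrt psi h2 a q) => // i qi /=; rewrite /a.
  have : (c + n <= i)%N by rewrite leqNgt; apply: contra qi => /qc ->.
  by clear; lia.
Qed.

Definition lin_form psi p q := cov P (lin psi 0 p) (lin psi 0 q).

Section one_function.
Variable psi : R -> R.
Hypothesis mpsi : measurable_fun setT psi.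
Hypothesis psi2 : forall k, (fun w => psi (X k w)) \in Lfun P 2%:E.

Lemma lin_form_stationary : stationary_form (lin_form psi).
Proof.
have L2l a p : lin psi a p \in Lfun P 2%:E by exact: lin_Lfun2.
split.
- by move=> p q; rewrite /lin_form covC.
- move=> p q r; rewrite /lin_form -covDl//; congr cov.
  by apply/funext => w; rewrite linD.
- move=> c p q; rewrite /lin_form -covZl//; congr cov.
  by apply/funext => w; rewrite linZ.
- by move=> p; exact: cov_ge0.
- move=> p q; rewrite /lin_form.
  have E u : lin psi 0 ('X * u) = lin psi (0 + 1) u.
    by apply/funext => w; rewrite linX.
  rewrite !E.
  by rewrite (@cov_lin_shift psi id id p q (0 + 1) 0)//; exact: measurable_id.
Qed.

Lemma lin_form_gap_bound r : (forall n, (rho_mix X n.+1 <= (r n)%:E)%E) ->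
  gap_bound (lin_form psi) r.
Proof.
move=> hr n c p q pc qc; have L2l a u : lin psi a u \in Lfun P 2%:E by exact: lin_Lfun2.
apply: (@cov_lin_rho n (r n) c psi id id) => //; exact: measurable_id.
Qed.

Lemma lin_form_disjoint r p q : (rho_star_mix X 1 <= r%:E)%E -> 0 <= r ->
  (forall i, p`_i = 0 \/ q`_i = 0) ->
  `|lin_form psi p q| <= r * (form_norm (lin_form psi) p * form_norm (lin_form psi) q).
Proof.
move=> hr r0 pq; have L2l a u : lin psi a u \in Lfun P 2%:E by exact: lin_Lfun2.
apply: (@cov_lin_rho_star r psi id id) => //; exact: measurable_id.
Qed.

End one_function.

End process_covariances.

(** * Elementary trigonometric and exponential inequalities *)

Section real_bounds.
Context {R : realType}.
Implicit Types x y t : R.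

Lemma norm_sin_le x : `|sin x| <= `|x|.
Proof.
have aux y : 0 < y -> `|sin y| <= y.
  move=> y0; have [c _] := @MVT R sin cos 0 y y0 (fun x _ => is_derive_sin x)
    (continuous_subspaceT (@continuous_sin R)).
  rewrite sin0 !subr0 => ->; rewrite normrM (gtr0_norm y0) ler_piMl ?(ltW y0)//.
  exact: cos_max.
have [x0|x0|->] := ltgtP x 0; last by rewrite sin0.
- by have := aux (- x); rewrite oppr_gt0 sinN normrN [`|x|]ltr0_norm//; apply.
- by rewrite [`|x|]gtr0_norm ?aux.
Qed.

Lemma cos_half x : cos x = 1 - 2 * sin (x / 2) ^+ 2.
Proof.
rewrite {1}[x](_ : _ = x / 2 + x / 2); last by field.
by rewrite cosD -!expr2 cos2sin2; ring.
Qed.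

Lemma one_sub_cos_le x : 1 - cos x <= x ^+ 2 / 2.
Proof.
rewrite cos_half; have := norm_sin_le (x / 2).
rewrite -(@ler_pXn2r _ 2)// ?nnegrE// !real_normK ?num_real// expr_div_n; lra.
Qed.

Lemma norm_sub_sin_le x : `|x - sin x| <= `|x| ^+ 3 / 2.
Proof.
have aux y : 0 < y -> `|y - sin y| <= y ^+ 3 / 2.
  move=> y0; have [c] := @MVT R (fun x => x - sin x) (fun x => 1 - cos x) 0 y y0
      (fun x _ => is_deriveB (is_derive_id x 1) (is_derive_sin x))
    (continuous_subspaceT (fun x => cvgB (cvg_id) (@continuous_sin R x))).
  rewrite in_itv/= => /andP[c0 cy].
  rewrite sin0 !subr0 => ->; rewrite normrM (gtr0_norm y0) exprS mulrC -mulrA.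
  rewrite ler_wpM2l ?(ltW y0)// ger0_norm ?subr_ge0 ?cos_le1//.
  apply: (le_trans (one_sub_cos_le c)); rewrite ler_wpM2r//.
  by rewrite lerXn2r ?nnegrE ?ltW.
have [x0|x0|->] := ltgtP x 0; last by rewrite sin0 subrr normr0 expr0n/= mul0r.
- by have := aux (- x); rewrite oppr_gt0 sinN -opprD normrN [`|x|]ltr0_norm//; apply.
- by rewrite [`|x|]gtr0_norm// aux.
Qed.

(** The cubic bound suffices when |x| < 2, and the crude bound 2 |x| beyond. *)
Lemma norm_sub_sin_le2 x : `|x - sin x| <= x ^+ 2.
Proof.
have := norm_sub_sin_le x; have := le_trans (ler_normB x (sin x)) (lerD (lexx _) (norm_sin_le x)).
rewrite -[x ^+ 2]real_normK ?num_real//; have := normr_ge0 x.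
move: (`|x|) (`|x - sin x|) => y z y0 h1 h2.
by have [y2|y2] := leP 2 y; [nra|apply: (le_trans h2); rewrite exprS; nra].
Qed.

(** The half-angle formula exhibits twice a difference of the squares of x/2 and sin(x/2); one of
    its factors is quadratically small and the other linearly. *)
Lemma norm_cos_taylor x : `|cos x - 1 + x ^+ 2 / 2| <= `|x| ^+ 3.
Proof.
have -> : cos x - 1 + x ^+ 2 / 2 = 2 * ((x / 2 - sin (x / 2)) * (x / 2 + sin (x / 2))).
  by rewrite cos_half; field.
have h1 := norm_sub_sin_le2 (x / 2).
have h2 := le_trans (ler_normD (x / 2) (sin (x / 2))) (lerD (lexx _) (norm_sin_le (x / 2))).
rewrite !normrM ger0_norm//.
have h3 : `|x / 2| = `|x| / 2 by rewrite normrM [`|2^-1|]ger0_norm.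
have := ler_pM (normr_ge0 _) (normr_ge0 _) h1 h2.
rewrite h3 -[(x / 2) ^+ 2]real_normK ?num_real// h3.
have := normr_ge0 x; have : 0 <= `|x| ^+ 3 by rewrite exprn_ge0.
move: (`|x|) (_ * _) => y z y3 y0; rewrite !exprS; lra.
Qed.

Lemma dist_cos_le x y : `|cos x - cos y| <= `|x - y|.
Proof.
wlog xy : x y / x < y => [wl|].
  have [xy|xy|->] := ltgtP x y; [exact: wl| |by rewrite !subrr].
  by rewrite distrC [leRHS]distrC; exact: wl.
have [c _] := @MVT R cos (fun x => - sin x) x y xy (fun x _ => is_derive_cos x)
  (continuous_subspaceT (@continuous_cos R)).
rewrite distrC => ->; rewrite normrM [leRHS]distrC normrN ler_piMl//.
by rewrite ler_norml sin_geN1 sin_le1.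
Qed.

Lemma dist_sin_le x y : `|sin x - sin y| <= `|x - y|.
Proof.
wlog xy : x y / x < y => [wl|].
  have [xy|xy|->] := ltgtP x y; [exact: wl| |by rewrite !subrr].
  by rewrite distrC [leRHS]distrC; exact: wl.
have [c _] := @MVT R sin cos x y xy (fun x _ => is_derive_sin x)
  (continuous_subspaceT (@continuous_sin R)).
rewrite distrC => ->; rewrite normrM [leRHS]distrC ler_piMl//.
exact: cos_max.
Qed.

Lemma expRN_le1 x : 0 <= x -> expR (- x) <= 1.
Proof. by move=> x0; rewrite -expR0 ler_expR oppr_le0. Qed.

Lemma dist_expRN_le x y : 0 <= x -> 0 <= y ->
  `|expR (- x) - expR (- y)| <= `|x - y|.
Proof.
move=> x0 y0; wlog xy : x y x0 y0 / x <= y => [wl|].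
  have [xy|/ltW xy] := leP x y; first exact: wl.
  by rewrite distrC [leRHS]distrC; exact: wl.
have -> : - y = - x + (x - y) by ring.
have h1 := @expR_ge1Dx R (x - y).
have h2 : expR (x - y) <= 1 by rewrite -expR0 ler_expR subr_le0.
rewrite expRD -[X in X - _]mulr1 -mulrBr normrM gtr0_norm ?expR_gt0//.
apply: (@le_trans _ _ (1 - expR (x - y))).
  rewrite ger0_norm ?subr_ge0// ler_piMl ?subr_ge0//; exact: expRN_le1.
by rewrite ler0_norm ?subr_le0//; lra.
Qed.

Lemma expRN_taylor x : 0 <= x -> `|expR (- x) - 1 + x| <= x ^+ 2.
Proof.
move=> x0; have h1 := @expR_ge1Dx R (- x).
rewrite ger0_norm; last by lra.
have h2 := @expR_ge1Dx R x.
have : expR (- x) * (1 + x) <= 1.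
  by rewrite -[leRHS]expR0 -[in leRHS](addNr x) expRD ler_wpM2l ?expR_ge0.
have := expR_ge0 (- x); nra.
Qed.

(** Characteristic functions are kept as pairs of a cosine mean and a sine mean; this is the
    triangle inequality for the complex modulus of such pairs. *)
Lemma pair_triangle (x y u v a b : R) : 0 <= a -> 0 <= b ->
  x ^+ 2 + y ^+ 2 <= a ^+ 2 -> u ^+ 2 + v ^+ 2 <= b ^+ 2 ->
  (x + u) ^+ 2 + (y + v) ^+ 2 <= (a + b) ^+ 2.
Proof.
move=> a0 b0 h1 h2.
suff : x * u + y * v <= a * b by nra.
have h : (x * u + y * v) ^+ 2 <= (a * b) ^+ 2.
  have -> : (x * u + y * v) ^+ 2 =
    (x ^+ 2 + y ^+ 2) * (u ^+ 2 + v ^+ 2) - (x * v - y * u) ^+ 2 by ring.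
  rewrite exprMn lerBlDr (le_trans (ler_pM _ _ h1 h2)) ?addr_ge0 ?sqr_ge0//.
  by rewrite lerDl sqr_ge0.
rewrite (le_trans (ler_norm _))// -(@ler_pXn2r _ 2) ?nnegrE ?mulr_ge0//.
by rewrite real_normK ?num_real.
Qed.

(** Multiplicativity of the complex modulus, by the two-squares identity. *)
Lemma pair_product (x y u v a b : R) : 0 <= a -> 0 <= b ->
  x ^+ 2 + y ^+ 2 <= a ^+ 2 -> u ^+ 2 + v ^+ 2 <= b ^+ 2 ->
  (x * u - y * v) ^+ 2 + (x * v + y * u) ^+ 2 <= (a * b) ^+ 2.
Proof.
move=> a0 b0 h1 h2; rewrite exprMn.
apply: le_trans (ler_pM _ _ h1 h2); rewrite ?addr_ge0 ?sqr_ge0//.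
by rewrite le_eqVlt; apply/orP; left; apply/eqP; ring.
Qed.

End real_bounds.

(** * Characteristic functions compared with Gaussian ones *)

Section characteristic_functions.
Context {d : measure_display} {Omega : measurableType d} {R : realType}.
Variable P : probability Omega R.
Implicit Types (f g : Omega -> R) (t e : R).

Lemma measurable_cosZ t : measurable_fun setT (fun x : R => cos (t * x)).
Proof.
apply: continuous_measurable_fun => x.
by apply: (@continuous_comp _ _ _ (fun x => t * x) cos); [exact: mulrl_continuous|exact: continuous_cos].
Qed.

Lemma measurable_sinZ t : measurable_fun setT (fun x : R => sin (t * x)).
Proof.
apply: continuous_measurable_fun => x.
by apply: (@continuous_comp _ _ _ (fun x => t * x) sin); [exact: mulrl_continuous|exact: continuous_sin].
Qed.

Lemma bounded_rv_cos t f : measurable_fun setT f -> bounded_rv (fun w => cos (t * f w)).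
Proof. by apply: (bounded_rv_comp (measurable_cosZ t) (M := 1)) => x; exact: cos_max. Qed.

Lemma bounded_rv_sin t f : measurable_fun setT f -> bounded_rv (fun w => sin (t * f w)).
Proof. by apply: (bounded_rv_comp (measurable_sinZ t) (M := 1)) => x; exact: sin_max. Qed.

Lemma mean_cos_sin_le1 t f : measurable_fun setT f ->
  mean P (fun w => cos (t * f w)) ^+ 2 + mean P (fun w => sin (t * f w)) ^+ 2 <= 1 ^+ 2.
Proof.
move=> mf; have bc := bounded_rv_cos t mf; have bs := bounded_rv_sin t mf.
have h1 (b : Omega -> R) : bounded_rv b -> mean P b ^+ 2 <= mean P (fun w => b w ^+ 2).
  move=> bb; have := mean_CS (bounded_rv_Lfun2 P bb) (Lfun2_cst P 1).
  under eq_fun do rewrite mulr1.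
  under [X in _ <= _ * mean _ X]eq_fun do rewrite expr1n.
  by rewrite mean_cst mulr1.
apply: (le_trans (lerD (h1 _ bc) (h1 _ bs))).
rewrite -meanD; try exact/bounded_rv_Lfun1/bounded_rvX.
by under eq_fun do rewrite cos2Dsin2; rewrite mean_cst expr1n.
Qed.

(* The characteristic function of [f] at [t] is within [e], in modulus, of the
   one of the centered normal law with the same variance. *)
Definition cf_close t f e : Prop := 0 <= e /\
  (mean P (fun w => cos (t * f w)) - expR (- (t ^+ 2 * cov P f f / 2))) ^+ 2 +
  mean P (fun w => sin (t * f w)) ^+ 2 <= e ^+ 2.

Lemma cf_close_le t f e e' : e <= e' -> cf_close t f e -> cf_close t f e'.
Proof.
move=> ee [e0 h]; split; first exact: le_trans ee.
by apply: (le_trans h); rewrite lerXn2r ?nnegrE// (le_trans e0).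
Qed.

(** Were the summands independent, both characteristic functions and their Gaussian counterparts
    would multiply, and since all moduli are at most 1 the errors would just add. Dependence
    contributes two covariances to the real part and two to the imaginary part, hence [4 * d1], and
    the cross term in the Gaussian exponent, hence [d2]. *)
Lemma cf_close_merge t f g ea eb d1 d2 :
  measurable_fun setT f -> measurable_fun setT g ->
  f \in Lfun P 2%:E -> g \in Lfun P 2%:E ->
  (forall h1 h2 : R -> R, (h1 = cos \/ h1 = sin) -> (h2 = cos \/ h2 = sin) ->
    `|cov P (fun w => h1 (t * f w)) (fun w => h2 (t * g w))| <= d1) ->
  t ^+ 2 * `|cov P f g| <= d2 ->
  cf_close t f ea -> cf_close t g eb ->
  cf_close t (fun w => f w + g w) (ea + eb + (4 * d1 + d2)).
Proof.
move=> mf mg f2 g2 hd1 hd2 [ea0 ha] [eb0 hb].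
pose mc h := mean P (fun w => cos (t * h w)).
pose ms h := mean P (fun w => sin (t * h w)).
have bcf := bounded_rv_cos t mf; have bsf := bounded_rv_sin t mf.
have bcg := bounded_rv_cos t mg; have bsg := bounded_rv_sin t mg.
have cE : mc (fun w => f w + g w) = mc f * mc g - ms f * ms g +
    (cov P (fun w => cos (t * f w)) (fun w => cos (t * g w)) -
     cov P (fun w => sin (t * f w)) (fun w => sin (t * g w))).
  rewrite !covE ?bounded_rv_Lfun2//.
  have -> : mc (fun w => f w + g w) = mean P (fun w => cos (t * f w) * cos (t * g w))
      - mean P (fun w => sin (t * f w) * sin (t * g w)).
    rewrite -meanB; try exact/bounded_rv_Lfun1/bounded_rvM.
    by congr mean; apply/funext => w; rewrite mulrDr cosD.
  rewrite /mc /ms; ring.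
have sE : ms (fun w => f w + g w) = mc f * ms g + ms f * mc g +
    (cov P (fun w => sin (t * f w)) (fun w => cos (t * g w)) +
     cov P (fun w => cos (t * f w)) (fun w => sin (t * g w))).
  rewrite !covE ?bounded_rv_Lfun2//.
  have -> : ms (fun w => f w + g w) = mean P (fun w => sin (t * f w) * cos (t * g w))
      + mean P (fun w => cos (t * f w) * sin (t * g w)).
    rewrite -meanD; try exact/bounded_rv_Lfun1/bounded_rvM.
    by congr mean; apply/funext => w; rewrite mulrDr sinD.
  rewrite /mc /ms; ring.
have vE : cov P (fun w => f w + g w) (fun w => f w + g w) =
    cov P f f + cov P g g + 2 * cov P f g.
  have fg2 := Lfun2D f2 g2.
  rewrite covDl// (covC P f) (covC P g) !covDl// (covC P g f); ring.
have t20 : 0 <= t ^+ 2 := sqr_ge0 t.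
have Va := cov_ge0 P f; have Vb := cov_ge0 P g.
have V := cov_ge0 P (fun w => f w + g w).
pose ga := expR (- (t ^+ 2 * cov P f f / 2)).
pose gb := expR (- (t ^+ 2 * cov P g g / 2)).
have ga01 : 0 <= ga <= 1 by rewrite expR_ge0/= expRN_le1// divr_ge0// mulr_ge0.
have gE : `|expR (- (t ^+ 2 * cov P (fun w => f w + g w) (fun w => f w + g w) / 2))
    - ga * gb| <= d2.
  rewrite -expRD -opprD; apply: (le_trans (dist_expRN_le _ _)).
  - by rewrite divr_ge0// mulr_ge0.
  - by rewrite addr_ge0// divr_ge0// mulr_ge0.
  rewrite (_ : _ - _ = t ^+ 2 * cov P f g); last by rewrite vE; field.
  by rewrite normrM (ger0_norm t20).
have d10 : 0 <= d1 := le_trans (normr_ge0 _) (hd1 cos cos (or_introl erefl) (or_introl erefl)).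
have d20 : 0 <= d2 := le_trans (normr_ge0 _) gE.
have e10 : 0 <= ea * 1 by rewrite mulr1.
have e20 : 0 <= 1 * eb by rewrite mul1r.
have p1 := pair_product ea0 ler01 ha (mean_cos_sin_le1 t mg).
have g1 : ga ^+ 2 + 0 ^+ 2 <= 1 ^+ 2.
  by case/andP: ga01 => g0 g1; rewrite expr0n addr0 lerXn2r ?nnegrE.
have p2 := pair_product ler01 eb0 g1 hb.
have p12 := pair_triangle e10 e20 p1 p2.
have hcc := hd1 cos cos (or_introl erefl) (or_introl erefl).
have hss := hd1 sin sin (or_intror erefl) (or_intror erefl).
have hcs := hd1 cos sin (or_introl erefl) (or_intror erefl).
have hsc := hd1 sin cos (or_intror erefl) (or_introl erefl).
split; first by rewrite !addr_ge0// mulr_ge0.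
have e30 : 0 <= 4 * d1 + d2 by rewrite addr_ge0// mulr_ge0.
rewrite -/(mc _) -/(ms _) cE sE.
move: gE p12 hcc hss hcs hsc; rewrite -/(mc f) -/(mc g) -/(ms f) -/(ms g) -/ga -/gb.
set G := expR _; rewrite mulr1 mul1r.
move: (mc f) (mc g) (ms f) (ms g) => ca cb sa sb.
move: (cov P (fun w => cos (t * f w)) (fun w => cos (t * g w))) => cc.
move: (cov P (fun w => sin (t * f w)) (fun w => sin (t * g w))) => ss.
move: (cov P (fun w => cos (t * f w)) (fun w => sin (t * g w))) => cs.
move: (cov P (fun w => sin (t * f w)) (fun w => cos (t * g w))) => sc.
move=> gE p12 hcc hss hcs hsc.
have p3 : (cc - ss - (G - ga * gb)) ^+ 2 + (sc + cs) ^+ 2 <= (4 * d1 + d2) ^+ 2.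
  have h1 : `|cc - ss - (G - ga * gb)| <= 2 * d1 + d2.
    rewrite (le_trans (ler_normB _ _))// lerD// (le_trans (ler_normB _ _))//.
    by have := lerD hcc hss; lra.
  have h2 : `|sc + cs| <= 2 * d1.
    by rewrite (le_trans (ler_normD _ _))//; have := lerD hcs hsc; lra.
  have sq (x y : R) : `|x| <= y -> x ^+ 2 <= y ^+ 2.
    move=> xy; rewrite -real_normK ?num_real// lerXn2r ?nnegrE//.
    exact: le_trans xy.
  have := lerD (sq _ _ h1) (sq _ _ h2); have := mulr_ge0 d10 d20; nra.
have eab0 : 0 <= ea + eb by rewrite addr_ge0.
have := pair_triangle eab0 e30 p12 p3.
by congr (_ ^+ 2 + _ ^+ 2 <= _); ring.
Qed.

(** Taylor expansion: the sine loses its linear term because the mean is 0, and the quadratic term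
    of the cosine cancels against that of the Gaussian exponential. *)
Lemma cf_close_leaf t f : bounded_rv f -> mean P f = 0 ->
  cf_close t f (2 * `|t| ^+ 3 * mean P (fun w => `|f w| ^+ 3) + (t ^+ 2 * cov P f f) ^+ 2).
Proof.
move=> bf f0; have mf := bf.1.
have VE : cov P f f = mean P (fun w => f w ^+ 2).
  by rewrite covE ?bounded_rv_Lfun2// f0 mul0r subr0.
set m3 := mean P (fun w => `|f w| ^+ 3).
have b3 : bounded_rv (fun w => `|f w| ^+ 3) by apply/bounded_rvX/bounded_rv_norm.
have m30 : 0 <= m3 by apply: mean_ge0 => w; rewrite exprn_ge0.
have t30 : 0 <= `|t| ^+ 3 by rewrite exprn_ge0.
have bc := bounded_rv_cos t mf; have bs := bounded_rv_sin t mf.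
have hs : `|mean P (fun w => sin (t * f w))| <= `|t| ^+ 3 * m3.
  have -> : mean P (fun w => sin (t * f w)) = mean P (fun w => sin (t * f w) - t * f w).
    rewrite meanB ?meanZ ?f0 ?mulr0 ?subr0//; apply: bounded_rv_Lfun1 => //.
    exact: bounded_rvZ.
  have bb : bounded_rv (fun w => sin (t * f w) - t * f w).
    by apply: bounded_rvB => //; exact: bounded_rvZ.
  apply: (le_trans (ler_norm_mean (bounded_rv_Lfun1 P bb))).
  rewrite -meanZ; last exact: bounded_rv_Lfun1.
  apply: le_mean; [exact/bounded_rv_Lfun1/bounded_rv_norm|exact/bounded_rv_Lfun1/bounded_rvZ|].
  move=> w; rewrite distrC (le_trans (norm_sub_sin_le _))// normrM exprMn.
  by have := mulr_ge0 t30 (exprn_ge0 3 (normr_ge0 (f w))); lra.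
have hc : `|mean P (fun w => cos (t * f w)) - 1 + t ^+ 2 * cov P f f / 2| <= `|t| ^+ 3 * m3.
  have b2 := bounded_rvX 2 bf.
  have bq : bounded_rv (fun w => t ^+ 2 / 2 * f w ^+ 2) by exact: bounded_rvZ.
  have b1 : bounded_rv (fun w => cos (t * f w) - 1).
    by apply/bounded_rvB/bounded_rv_cst.
  have -> : mean P (fun w => cos (t * f w)) - 1 + t ^+ 2 * cov P f f / 2 =
      mean P (fun w => cos (t * f w) - 1 + t ^+ 2 / 2 * f w ^+ 2).
    rewrite meanD ?bounded_rv_Lfun1// meanZ ?bounded_rv_Lfun1//.
    rewrite meanB ?bounded_rv_Lfun1//; last exact: bounded_rv_cst.
    by rewrite mean_cst VE; ring.
  have bb : bounded_rv (fun w => cos (t * f w) - 1 + t ^+ 2 / 2 * f w ^+ 2).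
    exact: bounded_rvD.
  apply: (le_trans (ler_norm_mean (bounded_rv_Lfun1 P bb))).
  rewrite -meanZ; last exact: bounded_rv_Lfun1.
  apply: le_mean; [exact/bounded_rv_Lfun1/bounded_rv_norm|exact/bounded_rv_Lfun1/bounded_rvZ|].
  move=> w; rewrite -exprMn -normrM; apply: le_trans (norm_cos_taylor _).
  by rewrite exprMn mulrAC.
have V0 := cov_ge0 P f.
have x0 : 0 <= t ^+ 2 * cov P f f by rewrite mulr_ge0 ?sqr_ge0.
have hg := @expRN_taylor R (t ^+ 2 * cov P f f / 2) (divr_ge0 x0 (ler0n _ 2)).
move: hs hc hg x0 (mulr_ge0 t30 m30); rewrite /cf_close.
set g := expR _; set x := t ^+ 2 * _; set m := _ * m3.
move: (mean _ _) (mean _ _) => c s hs hc hg x0 m0.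
rewrite -mulrA -/m; split; first by rewrite addr_ge0 ?sqr_ge0// mulr_ge0.
have h1 : `|c - g| <= m + x ^+ 2 / 4.
  have -> : c - g = (c - 1 + x / 2) - (g - 1 + x / 2) by ring.
  apply: (le_trans (ler_normB _ _)). apply: (le_trans (lerD hc hg)).
  by rewrite expr_div_n; lra.
have sq (u y : R) : `|u| <= y -> u ^+ 2 <= y ^+ 2.
  move=> uy; rewrite -real_normK ?num_real// lerXn2r ?nnegrE//.
  exact: le_trans uy.
apply: (le_trans (lerD (sq _ _ h1) (sq _ _ hs))).
by have := sqr_ge0 x; move: (x ^+ 2) => y y0; nra.
Qed.

Lemma mean_lipschitz_close (h : R -> R) L f g :
  (forall x y, `|h x - h y| <= L * `|x - y|) -> 0 <= L ->
  f \in Lfun P 2%:E -> g \in Lfun P 2%:E ->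
  bounded_rv (fun w => h (f w)) -> bounded_rv (fun w => h (g w)) ->
  `|mean P (fun w => h (f w)) - mean P (fun w => h (g w))| <=
  L * Num.sqrt (mean P (fun w => (f w - g w) ^+ 2)).
Proof.
move=> hL L0 f2 g2 bf bg; have fg := Lfun2B f2 g2.
rewrite -meanB ?bounded_rv_Lfun1//.
have bb := bounded_rvB bf bg.
apply: (le_trans (ler_norm_mean (bounded_rv_Lfun1 P bb))).
have fg1 := Lfun_norm (Lfun2_sub_Lfun1 fg).
have nf2 : (fun w => `|f w - g w|) \in Lfun P 2%:E.
  apply: Lfun2_of_sqr.
    by apply: measurableT_comp => //; exact: Lfun_measurable fg.
  under eq_fun do rewrite real_normK ?num_real//.
  by rewrite ltey_eq expectation_fin_num// Lfun2_mean_sqr.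
apply: (@le_trans _ _ (L * mean P (fun w => `|f w - g w|))).
  rewrite -meanZ//; apply: le_mean => //.
  - exact/bounded_rv_Lfun1/bounded_rv_norm.
  - exact/Lfun2_sub_Lfun1/Lfun2Z.
rewrite ler_wpM2l//; have := mean_CS_norm nf2.
rewrite ger0_norm; last by apply: mean_ge0.
by under [X in _ <= Num.sqrt (mean _ X)]eq_fun do rewrite real_normK ?num_real//.
Qed.

End characteristic_functions.

(** Bookkeeping for a binary tree of merges. The lengths of the two halves add up to [m], so errors
    proportional to length pass through a halving unchanged, and each scale adds its rate [x j] only
    once. *)
Lemma halving_induction (R : realType) (Q : nat -> nat -> R -> Prop)
    (j0 K : nat) (beta : R) (x : nat -> R) :
  (forall a m, (2 ^ j0 <= m <= 2 ^ j0.+1)%N -> Q a m (m%:R * beta)) ->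
  (forall j a m e1 e2, (j0 <= j < j0 + K)%N -> (2 ^ j.+1 <= m <= 2 ^ j.+2)%N ->
    Q a m./2 e1 -> Q (a + m./2)%N (uphalf m) e2 ->
    Q a m (e1 + e2 + m%:R * x j)) ->
  forall k a m, (k <= K)%N -> (2 ^ (j0 + k) <= m <= 2 ^ (j0 + k).+1)%N ->
    Q a m (m%:R * (beta + \sum_(l < k) x (j0 + l)%N)).
Proof.
move=> base step; elim=> [|k IH] a m kK.
  by rewrite addn0 big_ord0 addr0; exact: base.
rewrite addnS => /andP[m1 m2]; rewrite big_ord_recr/= addrA.
set S := beta + _.
have jj : (2 ^ (j0 + k).+1 = 2 * 2 ^ (j0 + k))%N by rewrite expnS.
have jj' : (2 ^ (j0 + k).+2 = 2 * 2 ^ (j0 + k).+1)%N by rewrite expnS.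
have -> : m%:R * (S + x (j0 + k)%N) = (m./2)%:R * S + (uphalf m)%:R * S + m%:R * x (j0 + k)%N.
  rewrite -mulrDl -natrD (_ : (m./2 + uphalf m = m)%N); last by clear; lia.
  by rewrite mulrDr.
apply: step; rewrite ?leq_addr ?ltn_add2l ?m1 ?m2//; (apply: IH; first exact: ltnW).
  by clear - jj jj' m1 m2; lia.
by clear - jj jj' m1 m2; lia.
Qed.

(** * Covariances of Lipschitz functions of neighbouring blocks *)

Section lipschitz_covariances.
Context {d : measure_display} {Omega : measurableType d} {R : realType}.
Variables (P : probability Omega R).
Implicit Types f g : Omega -> R.

Lemma cov_le_mean_sqr f c : f \in Lfun P 2%:E ->
  cov P f f <= mean P (fun w => (f w - c) ^+ 2).
Proof.
move=> f2; have f1 := Lfun2_sub_Lfun1 f2.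
have e1 : (fun w => c ^+ 2 - 2 * c * f w) \in Lfun P 1.
  by apply: Lfun2_sub_Lfun1; apply: Lfun2B; [exact: Lfun2_cst|exact: Lfun2Z].
have -> : (fun w => (f w - c) ^+ 2) = (fun w => f w ^+ 2 + (c ^+ 2 - 2 * c * f w)).
  by apply/funext => w; ring.
have c1 : (fun=> c ^+ 2) \in Lfun P 1 by exact/Lfun2_sub_Lfun1/Lfun2_cst.
have cf1 : (fun w => 2 * c * f w) \in Lfun P 1 by exact/Lfun2_sub_Lfun1/Lfun2Z.
have fE : mean P (fun w => f w * f w) = mean P (fun w => f w ^+ 2).
  by congr mean; apply/funext => w; rewrite expr2.
rewrite (meanD (Lfun2_mean_sqr f2) e1) (meanB c1 cf1) (meanZ _ f1) mean_cst.
by rewrite (covE f2 f2) fE; have := sqr_ge0 (mean P f - c); lra.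
Qed.

(** The mean minimizes the mean square distance to a constant, so the variance is at most the mean
    square around [h (mean P f)], where the Lipschitz condition applies pointwise. *)
Lemma cov_lipschitz (h : R -> R) L f : 0 <= L ->
  (forall x y, `|h x - h y| <= L * `|x - y|) ->
  f \in Lfun P 2%:E -> (fun w => h (f w)) \in Lfun P 2%:E ->
  cov P (fun w => h (f w)) (fun w => h (f w)) <= L ^+ 2 * cov P f f.
Proof.
move=> L0 hL f2 hf2; apply: (le_trans (cov_le_mean_sqr (h (mean P f)) hf2)).
have fc := Lfun2B f2 (Lfun2_cst P (mean P f)).
have hc := Lfun2B hf2 (Lfun2_cst P (h (mean P f))).
rewrite [X in _ * X]cov_centered; under [X in _ * mean _ X]eq_fun do rewrite -expr2.
rewrite -meanZ ?Lfun2_mean_sqr//; apply: le_mean.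
- exact: Lfun2_mean_sqr.
- have := Lfun2_mean_sqr (Lfun2Z L fc).
  by under eq_fun do rewrite exprMn.
move=> w; rewrite -[leLHS]real_normK ?num_real// -[X in _ * X]real_normK ?num_real//.
by rewrite -exprMn lerXn2r ?nnegrE ?mulr_ge0.
Qed.

Lemma cov_lipschitz_sub (h : R -> R) L f g : 0 <= L ->
  (forall x y, `|h x - h y| <= L * `|x - y|) ->
  f \in Lfun P 2%:E -> g \in Lfun P 2%:E ->
  (fun w => h (f w) - h (g w)) \in Lfun P 2%:E ->
  let k w := h (f w) - h (g w) in
  is_true (cov P k k <= L ^+ 2 * mean P (fun w => (f w - g w) ^+ 2)).
Proof.
move=> L0 hL f2 g2 k2 k; apply: (le_trans (cov_le_mean_sqr 0 k2)).
have fg := Lfun2B f2 g2.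
under eq_fun do rewrite subr0.
rewrite -meanZ ?Lfun2_mean_sqr//; apply: le_mean.
- exact: Lfun2_mean_sqr.
- have := Lfun2_mean_sqr (Lfun2Z L fg).
  by under eq_fun do rewrite exprMn.
move=> w; rewrite -[leLHS]real_normK ?num_real// -[X in _ * X]real_normK ?num_real//.
by rewrite -exprMn lerXn2r ?nnegrE ?mulr_ge0.
Qed.

End lipschitz_covariances.

Section block_covariances.
Context {d : measure_display} {Omega : measurableType d} {R : realType}.
Variables (P : probability Omega R) (X : int -> {RV P >-> R}).
Variable psi : R -> R.
Hypothesis mpsi : measurable_fun setT psi.
Hypothesis psi2 : forall k, (fun w => psi (X k w)) \in Lfun P 2%:E.
Hypothesis psi0 : forall k, mean P (fun w => psi (X k w)) = 0.
Implicit Types p q : {poly R}.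
Local Notation lin := (lin X psi 0).
Local Notation nm := (form_norm (lin_form X psi)).

Lemma mean_lin p : mean P (lin p) = 0.
Proof.
rewrite mean_sum; last by move=> i; exact/Lfun2_sub_Lfun1/Lfun2Z.
by rewrite big1// => i _; rewrite meanZ ?psi0 ?mulr0//; exact: Lfun2_sub_Lfun1.
Qed.

Lemma lin_form_mean p : lin_form X psi p p = mean P (fun w => lin p w ^+ 2).
Proof.
have L2l : lin p \in Lfun P 2%:E by exact: lin_Lfun2.
rewrite /lin_form covE// mean_lin mul0r subr0.
by congr mean; apply/funext => w; rewrite expr2.
Qed.

Lemma cov_lipschitz_lin (h : R -> R) L p : 0 <= L ->
  (forall x y, `|h x - h y| <= L * `|x - y|) ->
  (fun w => h (lin p w)) \in Lfun P 2%:E ->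
  Num.sqrt (cov P (fun w => h (lin p w)) (fun w => h (lin p w))) <= L * nm p.
Proof.
move=> L0 hL hp; have L2l : lin p \in Lfun P 2%:E by exact: lin_Lfun2.
rewrite -[L * _]ger0_norm ?mulr_ge0 ?form_norm_ge0// -sqrtr_sqr; apply: ler_wsqrtr.
apply: (le_trans (cov_lipschitz L0 hL L2l hp)).
by rewrite exprMn /form_norm sqr_sqrtr ?cov_ge0.
Qed.

(** Substitute for bilinearity when functions are not linear: dropping [p2] changes [h1] by at most
    [L] times the dropped sum, and Cauchy-Schwarz bounds the covariance with this change. *)
Lemma cov_lipschitz_split (h1 h2 : R -> R) L p1 p2 q : 0 <= L ->
  (forall x y, `|h1 x - h1 y| <= L * `|x - y|) ->
  (forall x y, `|h2 x - h2 y| <= L * `|x - y|) ->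
  (forall p, (fun w => h1 (lin p w)) \in Lfun P 2%:E) ->
  (forall p, (fun w => h2 (lin p w)) \in Lfun P 2%:E) ->
  `|cov P (fun w => h1 (lin (p1 + p2) w)) (fun w => h2 (lin q w))| <=
  `|cov P (fun w => h1 (lin p1 w)) (fun w => h2 (lin q w))| + L ^+ 2 * (nm p2 * nm q).
Proof.
move=> L0 hL1 hL2 hp1 hp2.
have L2l p : lin p \in Lfun P 2%:E by exact: lin_Lfun2.
pose k w := h1 (lin (p1 + p2) w) - h1 (lin p1 w).
have k2 : k \in Lfun P 2%:E by exact: Lfun2B.
have -> : cov P (fun w => h1 (lin (p1 + p2) w)) (fun w => h2 (lin q w)) =
    cov P (fun w => h1 (lin p1 w)) (fun w => h2 (lin q w)) +
    cov P k (fun w => h2 (lin q w)).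
  by rewrite -covDl//; congr cov; apply/funext => w; rewrite /k; ring.
apply: (le_trans (ler_normD _ _)); rewrite lerD2l.
apply: (le_trans (cov_CS k2 (hp2 q))).
have -> : L ^+ 2 * (nm p2 * nm q) = (L * nm p2) * (L * nm q) by ring.
apply: ler_pM; rewrite ?sqrtr_ge0//; last exact: cov_lipschitz_lin.
rewrite -[L * _]ger0_norm ?mulr_ge0 ?form_norm_ge0// -sqrtr_sqr; apply: ler_wsqrtr.
apply: (le_trans (cov_lipschitz_sub L0 hL1 (L2l _) (L2l _) k2)).
rewrite exprMn [X in _ <= _ * X]sqr_sqrtr ?cov_ge0// -/(lin_form X psi p2 p2) lin_form_mean.
rewrite le_eqVlt; apply/orP; left; apply/eqP; congr (_ * mean _ _).
by apply/funext => w; rewrite linD addrC addKr.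
Qed.

End block_covariances.

(** The cost of opening the gap in one merge is put in the form length times rate that
    [halving_induction] consumes, the rate being summable over scales. The weight [t] balances the
    short gap against the long half. *)
Lemma merge_error_le (R : realType) (B : {poly R} -> {poly R} -> R) (C v r : R)
    (i m : nat) (s := fun k => form_norm B (block 0 k)) (q := (2 ^ i).-1) :
  (forall k, s k ^+ 2 <= C * (k%:R * v)) -> 0 <= C -> 0 <= v -> 0 <= r ->
  (2 ^ (3 * i) <= m)%N -> (q <= m./2)%N ->
  r * (s (m./2 - q)%N * s (uphalf m)) + s q * s (uphalf m) <=
  C * v * (m%:R * (r + (2 ^+ i)^-1)).
Proof.
move=> hs C0 v0 r0 i8 qm.
have Cv0 : 0 <= C * v by rewrite mulr_ge0.
have mE : m = (m./2 + uphalf m)%N by clear; lia.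
have sm k l : (k <= l)%N -> s k ^+ 2 <= C * v * l%:R.
  move=> kl; apply: (le_trans (hs k)); rewrite [k%:R * v]mulrC mulrA.
  by rewrite ler_wpM2l// ler_nat.
set t : R := (2 ^+ i)^-1.
have t0 : 0 < t by rewrite invr_gt0 exprn_gt0.
have h1 := sm _ _ (leq_subr q m./2); have h2 := sm _ _ (leqnn (uphalf m)).
have h3 : t^-1 * s q ^+ 2 <= C * v * (t * m%:R).
  have sq : s q ^+ 2 <= C * v * t^-1.
    apply: (le_trans (sm _ _ (leq_pred _))).
    by rewrite /t invrK -natrX.
  apply: (@le_trans _ _ (t^-1 * (C * v * t^-1))).
    by rewrite ler_wpM2l// invr_ge0 ltW.
  rewrite mulrCA ler_wpM2l//.
  have -> : t^-1 * t^-1 = t * t^-1 ^+ 3 by field; rewrite gt_eqF.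
  by rewrite ler_wpM2l ?(ltW t0)// /t invrK -exprM -natrX ler_nat mulnC.
have h4 : t * s (uphalf m) ^+ 2 <= C * v * (t * m%:R).
  rewrite [leRHS]mulrCA ler_wpM2l ?(ltW t0)//; apply: sm.
  by clear; lia.
have h5 : s (m./2 - q)%N * s (uphalf m) <= C * v * m%:R.
  have := ler_mul2_weighted (s (m./2 - q)%N) (s (uphalf m)) ltr01.
  have : C * v * m%:R = C * v * (m./2)%:R + C * v * (uphalf m)%:R.
    by rewrite -mulrDr -natrD -mE.
  have : 0 <= C * v * m%:R by rewrite mulr_ge0.
  move: h1 h2; lra.
have h6 := ler_mul2_weighted (s q) (s (uphalf m)) t0.
have h7 := ler_wpM2l r0 h5.
move: h3 h4 h6 h7; lra.
Qed.

(** * Central limit theorem for small bounded functions under rho-mixing *)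

Section clt_rho.
Context {d : measure_display} {Omega : measurableType d} {R : realType}.
Variables (P : probability Omega R) (X : int -> {RV P >-> R}).

(** A uniform central limit theorem for arrays: [eps] and [N] are fixed before [psi], which may
    therefore vary with [n]. The small sup norm plays the part of a Lindeberg condition, and [C0]
    keeps the total variance bounded. *)
Definition bounded_block_clt : Prop := forall C0 t eta : R, 0 < C0 -> 0 < eta ->
  exists2 eps : R, 0 < eps & exists N : nat, forall n (psi : R -> R), (N <= n)%N ->
  measurable_fun setT psi -> (forall x, `|psi x| <= eps) ->
  (forall k, mean P (fun w => psi (X k w)) = 0) ->
  n%:R * lin_form X psi 1 1 <= C0 ->
  cf_close P t (lin X psi 0 (block 1 n)) eta.

Lemma bounded_psi_Lfun2 (psi : R -> R) (eps : R) k : measurable_fun setT psi ->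
  (forall x, `|psi x| <= eps) -> (fun w => psi (X k w)) \in Lfun P 2%:E.
Proof.
by move=> mpsi hb; apply/bounded_rv_Lfun2/(bounded_rv_comp mpsi hb).
Qed.

Lemma lin_block_bound (psi : R -> R) (eps : R) a m w : (forall x, `|psi x| <= eps) ->
  `|lin X psi 0 (block a m) w| <= m%:R * eps.
Proof.
move=> hb; rewrite lin_block (le_trans (ler_norm_sum _ _ _))//.
rewrite mulr_natl -[X in _ *+ X]card_ord -sumr_const.
by apply: ler_sum => i _.
Qed.

Lemma cos_sin_facts (t : R) (h : R -> R) : h = cos \/ h = sin ->
  [/\ measurable_fun setT (fun x => h (t * x)), forall x, `|h (t * x)| <= 1 &
      forall x y, `|h (t * x) - h (t * y)| <= `|t| * `|x - y|].
Proof.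
case=> ->; split.
- exact: measurable_cosZ.
- by move=> x; exact: cos_max.
- by move=> x y; rewrite -normrM mulrBr dist_cos_le.
- exact: measurable_sinZ.
- by move=> x; exact: sin_max.
- by move=> x y; rewrite -normrM mulrBr dist_sin_le.
Qed.

Hypothesis X_stationary : strictly_stationary X.
Variables (rho : nat -> R) (M : R).
Hypothesis rho_mixE : forall n, (rho_mix X n.+1 <= (rho n)%:E)%E.
Hypothesis rho0 : forall n, 0 <= rho n.
Hypothesis rhoM : forall N, \sum_(i < N) rho (2 ^ i).-1 <= M.

(** Counterpart of [adjacent_blocks_cov] for Lipschitz functions of the two sums: the correlation
    bound applies to them as well, and their standard deviations are at most [L] times those of the
    sums. *)
Lemma cov_block_rho (psi : R -> R) (eps : R) (h1 h2 : R -> R) (L : R) a m1 m2 q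
    (s := fun k => form_norm (lin_form X psi) (block 0 k)) :
  measurable_fun setT psi -> (forall x, `|psi x| <= eps) ->
  (forall k, mean P (fun w => psi (X k w)) = 0) ->
  measurable_fun setT h1 -> measurable_fun setT h2 -> 0 <= L ->
  (forall x y, `|h1 x - h1 y| <= L * `|x - y|) ->
  (forall x y, `|h2 x - h2 y| <= L * `|x - y|) ->
  (forall x, `|h1 x| <= 1) -> (forall x, `|h2 x| <= 1) -> (q <= m1)%N ->
  `|cov P (fun w => h1 (lin X psi 0 (block a m1) w))
          (fun w => h2 (lin X psi 0 (block (a + m1) m2) w))| <=
  L ^+ 2 * (rho q * (s (m1 - q)%N * s m2) + s q * s m2).
Proof.
move=> mpsi hb psi0 mh1 mh2 L0 hL1 hL2 b1 b2 qm.
have psi2 k := bounded_psi_Lfun2 k mpsi hb.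
have hB := lin_form_stationary X_stationary mpsi psi2.
have hl (h : R -> R) (b : int) (p : {poly R}) : measurable_fun setT h -> (forall x, `|h x| <= 1) ->
    (fun w => h (lin X psi b p w)) \in Lfun P 2%:E.
  by move=> mh hM; apply/bounded_rv_Lfun2/(bounded_rv_comp mh hM)/measurable_lin.
rewrite -[X in block a X](subnK qm) blockD.
apply: (le_trans (cov_lipschitz_split psi2 psi0 _ _ _ L0 hL1 hL2 _ _)).
- by move=> p; exact: hl.
- by move=> p; exact: hl.
rewrite mulrDr -!/(s _) !(form_norm_block hB (a + _)) lerD2r.
apply: (le_trans (@cov_lin_rho _ _ _ _ _ X_stationary q _ (a + (m1 - q))%N _ _ _ _ _
  (rho_mixE q) mpsi mh1 mh2 _ _ _ _)).
- by move=> b; exact: hl.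
- by move=> b; exact: hl.
- exact: size_block.
- by move=> i hi; rewrite coef_block_lt//; clear - hi qm; lia.
rewrite [leRHS]mulrCA ler_wpM2l//.
have -> : L ^+ 2 * (s (m1 - q)%N * s m2) = (L * s (m1 - q)%N) * (L * s m2) by ring.
rewrite /s -(form_norm_block hB a (m1 - q)) -(form_norm_block hB (a + m1) m2).
apply: ler_pM; rewrite ?sqrtr_ge0//.
- by apply: (cov_lipschitz_lin psi2) => //; exact: hl.
- by apply: (cov_lipschitz_lin psi2) => //; exact: hl.
Qed.

Lemma rho_block_clt : bounded_block_clt.
Proof.
move=> C0 t eta C00 eta0.
have [C Cgt0 hC] := block_variance_ub rho0 rhoM.
have C_ge0 := ltW Cgt0; have C0_ge0 := ltW C00.
pose g (j : nat) := rho (2 ^ (j %/ 4)).-1 + (2 ^+ (j %/ 4))^-1.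
have y0 i : 0 <= rho (2 ^ i).-1 + (2 ^+ i)^-1 by rewrite addr_ge0// invr_ge0 exprn_ge0.
have g0 j : 0 <= g j by exact: y0.
have gM N : \sum_(j < N) g j <= 4 * (M + 2).
  apply: (le_trans (@ler_sum_divn _ (fun i => rho (2 ^ i).-1 + (2 ^+ i)^-1) 4 N isT y0)).
  rewrite ler_wpM2l// big_split/=; apply: lerD; [exact: rhoM|exact: sum_exp2V_le].
pose T := t ^+ 2; have T0 : 0 <= T := sqr_ge0 t.
(* A merge pays the same amount five times, for four trigonometric covariances and for the cross
   term of the variance. Adding 1 keeps the divisor positive when [t] is 0. *)
pose D := 5 * T * C * C0 + 1.
have D0 : 0 < D.
  by rewrite /D ltr_wpDl//; do !apply: mulr_ge0 => //.
have del0 : 0 < eta / 2 / D.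
  by rewrite !divr_gt0.
(* From the scale [j0] on, all merges together cost at most half of [eta]; blocks of length up to
   [K] are therefore left unsplit. *)
have [j0 tail] := bounded_sum_tail g0 gM del0.
pose K := (2 ^ j0.+1)%N; have K0 : 0 < K%:R :> R by rewrite ltr0n expn_gt0.
pose t3 := `|t| ^+ 3; have t30 : 0 <= t3 by rewrite exprn_ge0.
(* An unsplit block sum is bounded by [K%:R * eps], so its third absolute moment is at most that
   times its variance; [eps] brings the total over the blocks below [eta / 4]. *)
pose E := 2 * t3 * K%:R * C * C0 + 1.
have E0 : 0 < E by rewrite /E ltr_wpDl//; do !apply: mulr_ge0 => //.
pose eps := eta / 4 / E; have eps0 : 0 < eps by rewrite /eps !divr_gt0.
(* [F / n%:R] bounds the total of the squared variance terms: unsplit blocks have bounded length, so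
   each carries a share of order [1 / n] of the total variance. *)
pose F := T ^+ 2 * C ^+ 2 * K%:R * C0 ^+ 2.
have F0 : 0 <= F by rewrite /F; do !apply: mulr_ge0 => //.
exists eps => //; exists (maxn K (Num.truncn (F / (eta / 4))).+1) => n psi.
rewrite geq_max => /andP[Kn Fn] mpsi hb psi0 nv.
set v := lin_form X psi 1 1 in nv.
have psi2 k := bounded_psi_Lfun2 k mpsi hb.
have hB := lin_form_stationary X_stationary mpsi psi2.
have v0 : 0 <= v := form_ge0 hB 1.
have n0 : 0 < n%:R :> R.
  by rewrite ltr0n (leq_trans _ Kn)// expn_gt0.
have Fn' : F / n%:R <= eta / 4.
  rewrite ler_pdivrMr// mulrC -ler_pdivrMr ?divr_gt0//.
  by apply/ltW/(lt_le_trans (truncnS_gt _)); rewrite ler_nat.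
have hs k : form_norm (lin_form X psi) (block 0 k) ^+ 2 <= C * (k%:R * v).
  by apply: hC => //; apply: lin_form_gap_bound.
pose Q a m e := cf_close P t (lin X psi 0 (block a m)) e.
pose beta := v * (2 * t3 * K%:R * C * eps + T ^+ 2 * C ^+ 2 * K%:R * v).
pose x j := 5 * T * C * v * g j.
have L2l p : lin X psi 0 p \in Lfun P 2%:E by exact: lin_Lfun2.
have ml p : measurable_fun setT (lin X psi 0 p) by exact: measurable_lin.
have main k a m : (2 ^ (j0 + k) <= m <= 2 ^ (j0 + k).+1)%N ->
    Q a m (m%:R * (beta + \sum_(l < k) x (j0 + l)%N)).
  apply: (@halving_induction _ Q j0 k beta x) => //.
  - move=> {}a {}m /andP[_ mK].
    have bl : bounded_rv (lin X psi 0 (block a m)).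
      by split=> //; exists (m%:R * eps) => w; exact: lin_block_bound.
    apply: cf_close_le (cf_close_leaf t bl (mean_lin psi2 psi0 _)).
    rewrite -/(lin_form X psi (block a m) (block a m)) -(form_normE hB).
    rewrite (form_norm_block hB a) -/t3 -/T.
    have mKR : m%:R <= K%:R :> R by rewrite ler_nat.
    have m3 : mean P (fun w => `|lin X psi 0 (block a m) w| ^+ 3) <=
        K%:R * eps * (C * (m%:R * v)).
      apply: (@le_trans _ _ (mean P (fun w => K%:R * eps * (lin X psi 0 (block a m) w) ^+ 2))).
        apply: le_mean.
        - exact/bounded_rv_Lfun1/bounded_rvX/bounded_rv_norm.
        - exact/bounded_rv_Lfun1/bounded_rvZ/bounded_rvX.
        move=> w; rewrite exprS real_normK ?num_real// ler_wpM2r ?sqr_ge0//.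
        by rewrite (le_trans (lin_block_bound _ _ _ hb))// ler_wpM2r// ltW.
      rewrite meanZ ?Lfun2_mean_sqr// -(lin_form_mean psi2 psi0) -(form_normE hB).
      by rewrite (form_norm_block hB a) ler_wpM2l// mulr_ge0// ltW.
    have h2 : (T * form_norm (lin_form X psi) (block 0 m) ^+ 2) ^+ 2 <=
        T ^+ 2 * C ^+ 2 * (m%:R * K%:R) * v ^+ 2.
      apply: (@le_trans _ _ ((T * (C * (m%:R * v))) ^+ 2)).
        have sg : 0 <= T * form_norm (lin_form X psi) (block 0 m) ^+ 2.
          by rewrite mulr_ge0 ?sqr_ge0.
        have le : T * form_norm (lin_form X psi) (block 0 m) ^+ 2 <= T * (C * (m%:R * v)).
          by rewrite ler_wpM2l.
        by rewrite lerXn2r// nnegrE// (le_trans sg).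
      have -> : (T * (C * (m%:R * v))) ^+ 2 = (T * C * v) ^+ 2 * (m%:R * m%:R) by ring.
      have -> : T ^+ 2 * C ^+ 2 * (m%:R * K%:R) * v ^+ 2 =
        (T * C * v) ^+ 2 * (m%:R * K%:R) by ring.
      by rewrite ler_wpM2l ?sqr_ge0// ler_wpM2l.
    have h1 : 2 * t3 * mean P (fun w => `|lin X psi 0 (block a m) w| ^+ 3) <=
        2 * t3 * (K%:R * eps * (C * (m%:R * v))).
      by rewrite ler_wpM2l// mulr_ge0.
    apply: (le_trans (lerD h1 h2)); rewrite /beta le_eqVlt; apply/orP; left.
    by apply/eqP; ring.
  - move=> j {}a {}m e1 e2 jj0 /andP[m1 m2] Q1 Q2.
    pose i := (j %/ 4)%N; pose q := (2 ^ i).-1.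
    have i8 : (2 ^ (3 * i) <= m)%N.
      by rewrite (leq_trans _ m1)// leq_exp2l// /i; clear; lia.
    have qm : (q <= m./2)%N.
      have : (2 ^ i <= 2 ^ j)%N by rewrite leq_exp2l// leq_div.
      have : (2 ^ j.+1 = 2 * 2 ^ j)%N by rewrite expnS.
      by rewrite /q; clear - m1; lia.
    have := merge_error_le hs (ltW Cgt0) v0 (rho0 q) i8 qm.
    set kap := (X in X <= _) => hkap.
    have ab : block a m = block a m./2 + block (a + m./2) (uphalf m) :> {poly R}.
      by rewrite -blockD; congr block; clear; lia.
    rewrite /Q ab.
    have -> : lin X psi 0 (block a m./2 + block (a + m./2) (uphalf m)) =
        fun w => lin X psi 0 (block a m./2) w + lin X psi 0 (block (a + m./2) (uphalf m)) w.
      by apply/funext => w; rewrite linD.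
    apply: (@cf_close_le _ _ _ _ _ _ (e1 + e2 + (4 * (T * kap) + T * kap))).
      rewrite lerD2l /x (_ : _ + _ = 5 * T * kap); last by ring.
      have -> : m%:R * (5 * T * C * v * g j) =
          5 * T * (C * v * (m%:R * (rho q + (2 ^+ i)^-1))).
        by rewrite /g -/i -/q; ring.
      by rewrite ler_wpM2l// mulr_ge0.
    apply: cf_close_merge => //.
      move=> h1 h2 /(cos_sin_facts t)[mh1 b1 l1] /(cos_sin_facts t)[mh2 b2 l2].
      rewrite /T -[t ^+ 2]real_normK ?num_real//.
      exact: (cov_block_rho a (uphalf m) mpsi hb psi0 mh1 mh2 (normr_ge0 t) l1 l2 b1 b2 qm).
    rewrite -/T ler_wpM2l//.
    exact: (adjacent_blocks_cov hB (lin_form_gap_bound X_stationary mpsi psi2 rho_mixE)).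
have [k nk] : exists k, trunc_log 2 n = (j0 + k)%N.
  exists (trunc_log 2 n - j0)%N; rewrite subnKC// trunc_log_max//.
  by rewrite (leq_trans _ Kn)// leq_exp2l.
have nn0 : (0 < n)%N by rewrite -(ltr0n R).
apply: cf_close_le (main k 1%N n _); last first.
  by rewrite -nk; case/andP: (@trunc_log_bounds 2 n isT nn0) => -> /ltnW.
have -> : \sum_(l < k) x (j0 + l)%N = 5 * T * C * v * \sum_(j0 <= l < j0 + k) g l.
  rewrite /x -mulr_sumr; congr (_ * _).
  rewrite -[X in index_iota X _]add0n [(j0 + k)%N]addnC big_addn addnK big_mkord.
  by apply: eq_bigr => l _; rewrite addnC.
have h1 : 5 * T * C * (n%:R * v) * \sum_(j0 <= l < j0 + k) g l <= eta / 2.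
  apply: (@le_trans _ _ (D * (eta / 2 / D))); last by rewrite mulrC divfK// gt_eqF.
  apply: ler_pM => //.
  - by do !apply: mulr_ge0 => //.
  - by rewrite sumr_ge0.
  rewrite /D; apply: (@le_trans _ _ (5 * T * C * C0)); last by rewrite lerDl.
  by rewrite ler_wpM2l//; do !apply: mulr_ge0 => //.
have h2 : 2 * t3 * K%:R * C * (n%:R * v) * eps <= eta / 4.
  apply: (@le_trans _ _ (E * eps)); last by rewrite /eps mulrC divfK// gt_eqF.
  rewrite ler_wpM2r ?(ltW eps0)//.
  apply: (@le_trans _ _ (2 * t3 * K%:R * C * C0)); last by rewrite lerDl.
  by rewrite ler_wpM2l//; do !apply: mulr_ge0 => //.
have h3 : T ^+ 2 * C ^+ 2 * K%:R * (n%:R * v) * v <= eta / 4.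
  apply: le_trans Fn'; rewrite ler_pdivlMr//.
  have -> : T ^+ 2 * C ^+ 2 * K%:R * (n%:R * v) * v * n%:R =
    T ^+ 2 * C ^+ 2 * K%:R * (n%:R * v) ^+ 2 by ring.
  have nv0 : 0 <= n%:R * v by rewrite mulr_ge0.
  rewrite /F ler_wpM2l//; last by rewrite lerXn2r// nnegrE.
  by do !apply: mulr_ge0 => //.
rewrite /beta; move: h1 h2 h3; set S := \sum_(_ <= _ < _) _; lra.
Qed.

End clt_rho.

(** * Fourth moments of sums, from signs and correlations of squares *)

Section fourth_moment.
Context {d : measure_display} {Omega : measurableType d} {R : realType}.
Variables (P : probability Omega R).

(** Averaging over the two values of a sign kills the odd powers, and one of the two values does no
    worse than the average. The variable [Y] lets the induction carry the terms whose signs are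
    already fixed. *)
Lemma khintchine_signs (Z : nat -> Omega -> R) n (Y : Omega -> R) :
  (forall i, bounded_rv (Z i)) -> bounded_rv Y ->
  exists e : nat -> bool,
    let Q w := \sum_(i < n) Z i w ^+ 2 in
    mean P (fun w => (Y w + \sum_(i < n) (-1) ^+ e i * Z i w) ^+ 4) <=
    mean P (fun w => Y w ^+ 4 + 6 * (Y w ^+ 2 * Q w) + 3 * Q w ^+ 2).
Proof.
move=> bZ; elim: n Y => [|n IH] Y bY.
  exists (fun=> false); cbv zeta; rewrite le_eqVlt; apply/orP; left; apply/eqP.
  by congr mean; apply/funext => w; rewrite !big_ord0; ring.
pose Q w := \sum_(i < n) Z i w ^+ 2.
have bQ : bounded_rv Q by apply: bounded_rv_sum => i; exact: bounded_rvX.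
pose F (b : bool) w := (Y w + (-1) ^+ b * Z n w) ^+ 4 +
  6 * ((Y w + (-1) ^+ b * Z n w) ^+ 2 * Q w) + 3 * Q w ^+ 2.
have bYb b : bounded_rv (fun w => Y w + (-1) ^+ b * Z n w).
  by apply: bounded_rvD => //; exact: bounded_rvZ.
have bF b : bounded_rv (F b).
  apply: bounded_rvD; [apply: bounded_rvD|].
  - exact: bounded_rvX.
  - by apply: bounded_rvZ; apply: bounded_rvM => //; exact: bounded_rvX.
  - by apply: bounded_rvZ; exact: bounded_rvX.
pose G w := Y w ^+ 4 + 6 * (Y w ^+ 2 * (Q w + Z n w ^+ 2)) + 3 * (Q w + Z n w ^+ 2) ^+ 2.
have bQ' : bounded_rv (fun w => Q w + Z n w ^+ 2).
  by apply: bounded_rvD => //; exact: bounded_rvX.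
have bG : bounded_rv G.
  apply: bounded_rvD; [apply: bounded_rvD|].
  - exact: bounded_rvX.
  - by apply: bounded_rvZ; apply: bounded_rvM => //; exact: bounded_rvX.
  - by apply: bounded_rvZ; exact: bounded_rvX.
have FG : mean P (F false) + mean P (F true) <= 2 * mean P G.
  rewrite -meanD ?bounded_rv_Lfun1// -meanZ ?bounded_rv_Lfun1//.
  apply: le_mean; [exact/bounded_rv_Lfun1/bounded_rvD|exact/bounded_rv_Lfun1/bounded_rvZ|].
  move=> w; rewrite /F /G expr0 expr1 mul1r mulN1r.
  move: (Y w) (Z n w) (Q w) => y z q.
  have : 0 <= z ^+ 4 by rewrite -[4%N]/(2 * 2)%N exprM sqr_ge0.
  rewrite -subr_ge0 => h; rewrite -subr_ge0.
  by rewrite (_ : _ - _ = 4 * z ^+ 4 :> R); [lra|ring].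
have [b hb] : exists b, mean P (F b) <= mean P G.
  have [h|h] := leP (mean P (F false)) (mean P G); first by exists false.
  by exists true; lra.
have [e he] := IH _ (bYb b).
exists (fun i => if i == n then b else e i); cbv zeta.
have -> : (fun w => Y w ^+ 4 + 6 * (Y w ^+ 2 * (\sum_(i < n.+1) Z i w ^+ 2)) +
    3 * (\sum_(i < n.+1) Z i w ^+ 2) ^+ 2) = G.
  by apply/funext => w; rewrite !big_ord_recr.
apply: le_trans hb; apply: le_trans he.
rewrite le_eqVlt; apply/orP; left; apply/eqP; congr mean; apply/funext => w.
rewrite big_ord_recr/= eqxx; congr (_ ^+ 4).
rewrite -!addrA; congr (_ + _); rewrite addrC; congr (_ + _).
by apply: eq_bigr => i _; rewrite ltn_eqF.
Qed.

(** Weak correlation of the squares bounds their variances by the mean square of f^2 - g^2 divided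
    by 1 - r. Factoring this as (f - g)(f + g), Cauchy-Schwarz bounds it by the geometric mean of
    the two fourth moments, and the one of f + g is absorbed on the left. *)
Lemma fourth_moment_correlated (r : R) (f g : Omega -> R) :
  0 <= r < 1 -> bounded_rv f -> bounded_rv g ->
  (let f2 w := f w ^+ 2 in let g2 w := g w ^+ 2 in
   is_true (`|cov P f2 g2| <= r * (Num.sqrt (cov P f2 f2) * Num.sqrt (cov P g2 g2)))) ->
  mean P (fun w => (f w + g w) ^+ 4) <=
  64 / (1 - r) ^+ 2 * mean P (fun w => (f w - g w) ^+ 4) +
  16 * (mean P (fun w => f w ^+ 2) ^+ 2 + mean P (fun w => g w ^+ 2) ^+ 2).
Proof.
move=> /andP[r0 r1] bf bg; cbv zeta => hc.
have bf2 := bounded_rvX 2 bf; have bg2 := bounded_rvX 2 bg.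
have bfg := bounded_rvD bf bg; have bfg' := bounded_rvB bf bg.
set x := mean P (fun w => (f w - g w) ^+ 4); set y := mean P (fun w => (f w + g w) ^+ 4).
have V h : bounded_rv h -> cov P (fun w => h w ^+ 2) (fun w => h w ^+ 2) =
    mean P (fun w => h w ^+ 4) - mean P (fun w => h w ^+ 2) ^+ 2.
  move=> bh; rewrite covE ?(bounded_rv_Lfun2 P (bounded_rvX 2 bh))// -expr2.
  by congr (mean P _ - _); apply/funext => w; rewrite -exprD.
have y8 : y <= 8 * (mean P (fun w => f w ^+ 4) + mean P (fun w => g w ^+ 4)).
  have b4 := bounded_rvD (bounded_rvX 4 bf) (bounded_rvX 4 bg).
  rewrite -meanD ?(bounded_rv_Lfun1 P (bounded_rvX 4 bf)) ?(bounded_rv_Lfun1 P (bounded_rvX 4 bg))//.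
  rewrite -meanZ ?(bounded_rv_Lfun1 P b4)//.
  apply: le_mean; [exact/bounded_rv_Lfun1/bounded_rvX|exact/bounded_rv_Lfun1/bounded_rvZ|].
  move=> w; move: (f w) (g w) => a b.
  have : (a + b) ^+ 2 <= 2 * (a ^+ 2 + b ^+ 2).
    by have := sqr_ge0 (a - b); rewrite sqrrB sqrrD; lra.
  have : 0 <= (a + b) ^+ 2 := sqr_ge0 _.
  have := sqr_ge0 (a ^+ 2 - b ^+ 2).
  rewrite -[4%N]/(2 * 2)%N !exprM; move: ((a + b) ^+ 2) (a ^+ 2) (b ^+ 2) => u p q; nra.
pose z := mean P (fun w => (f w - g w) ^+ 2 * (f w + g w) ^+ 2).
have z0 : 0 <= z by apply: mean_ge0 => w; rewrite mulr_ge0 ?sqr_ge0.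
have zxy : z ^+ 2 <= x * y.
  have := mean_CS (bounded_rv_Lfun2 P (bounded_rvX 2 bfg')) (bounded_rv_Lfun2 P (bounded_rvX 2 bfg)).
  rewrite -/z; congr (_ <= _ * _); congr mean; apply/funext => w; by rewrite -exprM.
have hz : (1 - r) * (cov P (fun w => f w ^+ 2) (fun w => f w ^+ 2) +
    cov P (fun w => g w ^+ 2) (fun w => g w ^+ 2)) <= z.
  apply: (@le_trans _ _ (cov P (fun w => f w ^+ 2 - g w ^+ 2) (fun w => f w ^+ 2 - g w ^+ 2))).
    have f22 := bounded_rv_Lfun2 P bf2; have g22 := bounded_rv_Lfun2 P bg2.
    have fg22 := Lfun2B f22 g22.
    rewrite covBl// (covC P (fun w => f w ^+ 2) (fun w => _ - _)).
    rewrite (covC P (fun w => g w ^+ 2) (fun w => _ - _)) !covBl//.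
    rewrite (covC P (fun w => g w ^+ 2) (fun w => f w ^+ 2)).
    have := cov_ge0 P (fun w => f w ^+ 2); have := cov_ge0 P (fun w => g w ^+ 2).
    move: hc; set c := cov P _ (fun w => g w ^+ 2).
    move=> /ler_normlW hc v0 u0; move: hc.
    rewrite -{2}[cov P (fun w => f w ^+ 2) _]sqr_sqrtr// -{2}[cov P (fun w => g w ^+ 2) _]sqr_sqrtr//.
    rewrite -{3}[cov P (fun w => f w ^+ 2) _]sqr_sqrtr// -{3}[cov P (fun w => g w ^+ 2) _]sqr_sqrtr//.
    move: (Num.sqrt _) (Num.sqrt _) => p q hc.
    by have := mulr_ge0 r0 (sqr_ge0 (p - q)); rewrite sqrrB; lra.
  apply: (le_trans (cov_le_mean_sqr 0 (bounded_rv_Lfun2 P (bounded_rvB bf2 bg2)))).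
  rewrite le_eqVlt; apply/orP; left; apply/eqP; congr mean; apply/funext => w; ring.
have x0 : 0 <= x by apply: mean_ge0 => w; rewrite -[4%N]/(2 * 2)%N exprM sqr_ge0.
have y0 : 0 <= y by apply: mean_ge0 => w; rewrite -[4%N]/(2 * 2)%N exprM sqr_ge0.
move: hz y8; rewrite !V//.
move: (mean P (fun w => f w ^+ 4)) (mean P (fun w => g w ^+ 4)) => f4 g4.
move: (mean P (fun w => f w ^+ 2)) (mean P (fun w => g w ^+ 2)) => f2 g2 hz y8.
have r1' : 0 < 1 - r by rewrite subr_gt0.
pose k := (1 - r)^-1; have k0 : 0 < k by rewrite invr_gt0.
have hz' : f4 + g4 <= k * z + (f2 ^+ 2 + g2 ^+ 2).
  have : f4 - f2 ^+ 2 + (g4 - g2 ^+ 2) <= k * z by rewrite ler_pdivlMl.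
  lra.
have -> : 64 / (1 - r) ^+ 2 = 64 * k ^+ 2 by rewrite /k exprVn.
suff : 8 * k * z <= y / 2 + 32 * k ^+ 2 * x by lra.
have k_ge0 := ltW k0.
have l0 : 0 <= 8 * k * z by do !apply: mulr_ge0 => //.
have m0 : 0 <= y / 2 + 32 * k ^+ 2 * x.
  by apply: addr_ge0; [exact: divr_ge0|do !apply: mulr_ge0 => //].
rewrite -(@ler_pXn2r _ 2)// ?nnegrE//.
have h1 := sqr_ge0 (y / 2 - 32 * k ^+ 2 * x).
have h2 : 64 * k ^+ 2 * z ^+ 2 <= 64 * k ^+ 2 * (x * y).
  by rewrite ler_wpM2l// mulr_ge0 ?sqr_ge0.
by move: h1 h2; rewrite !exprMn sqrrB sqrrD; lra.
Qed.

End fourth_moment.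

(** * Variance and fourth moment bounds under the interlaced correlation condition *)

Section clt_rho_star.
Context {d : measure_display} {Omega : measurableType d} {R : realType}.
Variables (P : probability Omega R) (X : int -> {RV P >-> R}).
Hypothesis X_stationary : strictly_stationary X.
Variable r : R.
Hypothesis r01 : 0 <= r < 1.
Hypothesis rho_starE : (rho_star_mix X 1 <= r%:E)%E.

Let C := (1 + r) / (1 - r).

Let C_gt0 : 0 < C.
Proof. by case/andP: r01 => r0 r1; rewrite /C divr_gt0//; lra. Qed.

Lemma rho_star_variance_bounds (psi : R -> R) (F : nat -> R) n :
  measurable_fun setT psi -> (forall k, (fun w => psi (X k w)) \in Lfun P 2%:E) ->
  let p : {poly R} := \sum_(i < n) F i *: 'X^i in
  lin_form X psi p p <= C * ((\sum_(i < n) F i ^+ 2) * lin_form X psi 1 1) /\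
  C^-1 * ((\sum_(i < n) F i ^+ 2) * lin_form X psi 1 1) <= lin_form X psi p p.
Proof.
move=> mpsi psi2 p; case/andP: (r01) => r0 r1.
have hB := lin_form_stationary X_stationary mpsi psi2.
have hd (u q : {poly R}) : (forall i, u`_i = 0 \/ q`_i = 0) ->
    `|lin_form X psi u q| <= r * (form_norm (lin_form X psi) u * form_norm (lin_form X psi) q).
  exact: lin_form_disjoint.
have [h1 h2] := disjoint_variance_bounds hB r01 hd F n.
have s0 : 0 < 1 - r by lra.
have s1 : 0 < 1 + r by lra.
split; first by rewrite /C mulrAC ler_pdivlMr// mulrC.
by rewrite /C invf_div mulrAC ler_pdivrMr// [leRHS]mulrC.
Qed.

Lemma rho_star_block_bounds (psi : R -> R) m :
  measurable_fun setT psi -> (forall k, (fun w => psi (X k w)) \in Lfun P 2%:E) ->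
  form_norm (lin_form X psi) (block 0 m) ^+ 2 <= C * (m%:R * lin_form X psi 1 1) /\
  C^-1 * (m%:R * lin_form X psi 1 1) <= form_norm (lin_form X psi) (block 0 m) ^+ 2.
Proof.
move=> mpsi psi2; have hB := lin_form_stationary X_stationary mpsi psi2.
have := @rho_star_variance_bounds psi (fun=> 1) m mpsi psi2.
have -> : \sum_(i < m) 1 *: 'X^i = block 0 m :> {poly R}.
  by apply: eq_bigr => i _; rewrite scale1r.
have -> : \sum_(i < m) 1 ^+ 2 = m%:R :> R by rewrite expr1n sumr_const card_ord.
by rewrite (form_normE hB).
Qed.

Lemma mean_psi_shift (psi : R -> R) (h : R -> R) k : measurable_fun setT psi ->
  measurable_fun setT h ->
  (forall k, (fun w => h (psi (X k w))) \in Lfun P 1) ->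
  mean P (fun w => h (psi (X k w))) = mean P (fun w => h (psi (X 0 w))).
Proof.
move=> mpsi mh hL.
have E a : (fun w => h (psi (X a w))) = (fun w => h (lin X psi a 1 w)).
  by apply/funext => w; rewrite lin1.
rewrite !E; apply: (@mean_lin_shift _ _ _ _ _ X_stationary psi (fun x _ => h x) 1 1) => //.
  exact: (measurableT_comp mh measurable_fst).
by move=> a; rewrite -E.
Qed.

(** The first term is 64 times the constant 3 of the signed sum; the second counts 16 for each of
    the two squared second moments. *)
Let K4 := 192 * (C + 1) / (1 - r) ^+ 2 + 32 * C ^+ 2.

(** A Rosenthal-type inequality. Signs [e] for which the signed sum has a small fourth moment split
    the block into [pA] and [pB]. The squares of these two sums live on disjoint index sets, so
    their correlation is at most [r], which carries the bound from the difference to the sum. *)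
Lemma block_fourth_moment (psi : R -> R) (eps : R) a m :
  measurable_fun setT psi -> (forall x, `|psi x| <= eps) ->
  (forall k, mean P (fun w => psi (X k w)) = 0) ->
  let v := lin_form X psi 1 1 in
  is_true (mean P (fun w => lin X psi 0 (block a m) w ^+ 4) <=
    K4 * ((m%:R * v) ^+ 2 + m%:R * v * eps ^+ 2)).
Proof.
move=> mpsi hb psi0 v.
have psi2 k : (fun w => psi (X k w)) \in Lfun P 2%:E.
  exact: (bounded_psi_Lfun2 X k mpsi hb).
have hB := lin_form_stationary X_stationary mpsi psi2.
have v0 : 0 <= v := form_ge0 hB 1.
have bpsi k : bounded_rv (fun w => psi (X k w)) by exact: (bounded_rv_comp mpsi hb).
have ml p : measurable_fun setT (lin X psi 0 p) by exact: measurable_lin.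
have bl b p : bounded_rv (lin X psi b p).
  by apply: bounded_rv_sum => i; exact: bounded_rvZ.
have -> : mean P (fun w => lin X psi 0 (block a m) w ^+ 4) =
    mean P (fun w => lin X psi 0 (block 0 m) w ^+ 4).
  have E : lin X psi 0 (block a m) = lin X psi a%:Z (block 0 m).
    by apply/funext => w; rewrite !lin_block; apply: eq_bigr => i _; rewrite add0r add0n PoszD.
  rewrite E; apply: (@mean_lin_shift _ _ _ _ _ X_stationary psi (fun x _ => x ^+ 4)
    (block 0 m) (block 0 m)) => //.
    exact: measurable_funX.
  by move=> b; exact/bounded_rv_Lfun1/bounded_rvX.
have msq : measurable_fun setT (fun x : R => x ^+ 2).
  exact: (measurable_funX 2 (@measurable_id _ R setT)).
pose Z (i : nat) w := psi (X i%:Z w).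
have bZ i : bounded_rv (Z i) by exact: bpsi.
have [e he] := khintchine_signs P m bZ (bounded_rv_cst 0).
pose Q w := \sum_(i < m) Z i w ^+ 2.
have bQ : bounded_rv Q by apply: bounded_rv_sum => i; exact: bounded_rvX.
pose pA : {poly R} := \sum_(i < m) (~~ e i)%:R *: 'X^i.
pose pB : {poly R} := \sum_(i < m) (e i)%:R *: 'X^i.
have AB w : lin X psi 0 (block 0 m) w = lin X psi 0 pA w + lin X psi 0 pB w.
  rewrite /pA /pB (lin_sumX _ _ _ _ (fun i => (~~ e i)%:R)).
  rewrite (lin_sumX _ _ _ _ (fun i => (e i)%:R)) lin_block -big_split/=; apply: eq_bigr => i _.
  by rewrite !add0r add0n; case: (e i); rewrite ?mul0r ?mul1r ?addr0 ?add0r.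
have AmB w : lin X psi 0 pA w - lin X psi 0 pB w = 0 + \sum_(i < m) (-1) ^+ e i * Z i w.
  rewrite /pA /pB (lin_sumX _ _ _ _ (fun i => (~~ e i)%:R)).
  rewrite (lin_sumX _ _ _ _ (fun i => (e i)%:R)) -sumrB add0r; apply: eq_bigr => i _; rewrite /Z !add0r.
  by case: (e i); rewrite ?mul0r ?mul1r ?subr0 ?sub0r ?expr1 ?expr0 ?mulN1r ?mul1r.
have hD : mean P (fun w => (lin X psi 0 pA w - lin X psi 0 pB w) ^+ 4) <=
    3 * mean P (fun w => Q w ^+ 2).
  rewrite -meanZ; last exact/bounded_rv_Lfun1/bounded_rvX.
  move: he; congr (_ <= _); congr mean; apply/funext => w; rewrite ?AmB//.
  by rewrite -/(Q w); ring.
have ev k : mean P (fun w => psi (X k w) ^+ 2) = v.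
  rewrite (@mean_psi_shift psi (fun x => x ^+ 2) k)//; last first.
    by move=> j; exact/bounded_rv_Lfun1/bounded_rvX.
  rewrite /v (lin_form_mean psi2 psi0); congr mean.
  by apply/funext => w; rewrite lin1.
pose ps x := psi x ^+ 2.
have mps : measurable_fun setT ps by exact: measurable_funX.
have ps2 k : (fun w => ps (X k w)) \in Lfun P 2%:E.
  exact/bounded_rv_Lfun2/bounded_rvX.
have psv : lin_form X ps 1 1 <= eps ^+ 2 * v.
  have b1 : bounded_rv (lin X ps 0 1).
    have -> : lin X ps 0 1 = fun w => psi (X 0 w) ^+ 2 by apply/funext => w; rewrite lin1.
    exact: bounded_rvX.
  apply: (le_trans (cov_le_mean_sqr 0 (bounded_rv_Lfun2 P b1))).
  rewrite -(ev 0) -meanZ; last exact/bounded_rv_Lfun1/bounded_rvX.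
  apply: le_mean.
  - by apply/bounded_rv_Lfun1/bounded_rvX/bounded_rvB => //; exact: bounded_rv_cst.
  - exact/bounded_rv_Lfun1/bounded_rvZ/bounded_rvX.
  move=> w; rewrite lin1 subr0 /ps [leLHS]expr2 ler_wpM2r ?sqr_ge0//.
  by rewrite -real_normK ?num_real// lerXn2r ?nnegrE// (le_trans _ (hb (X 0 w))).
(* The sum of squares is itself a block sum, for the square of [psi], so its variance is linear in
   [m] by the same bounds; [psv] supplies the factor [eps ^+ 2]. *)
have EQ2 : mean P (fun w => Q w ^+ 2) <= C * (m%:R * (eps ^+ 2 * v)) + (m%:R * v) ^+ 2.
  have QE : Q = lin X ps 0 (block 0 m).
    by apply/funext => w; rewrite lin_block; apply: eq_bigr => i _; rewrite add0r add0n.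
  have -> : mean P (fun w => Q w ^+ 2) = cov P Q Q + mean P Q ^+ 2.
    rewrite covE ?bounded_rv_Lfun2// expr2 subrK.
    by congr mean; apply/funext => w; rewrite expr2.
  apply: lerD.
    have [+ _] := rho_star_block_bounds m mps ps2.
    rewrite (form_normE (lin_form_stationary X_stationary mps ps2)) {1}/lin_form -QE => /le_trans; apply.
    by rewrite ler_wpM2l ?(ltW C_gt0)// ler_wpM2l.
  rewrite /Q mean_sum; last by move=> i; exact/bounded_rv_Lfun1/bounded_rvX.
  by under eq_bigr do rewrite ev; rewrite sumr_const card_ord mulr_natl.
have half (b : nat -> bool) : let p : {poly R} := \sum_(i < m) (b i)%:R *: 'X^i in
    is_true (mean P (fun w => lin X psi 0 p w ^+ 2) ^+ 2 <= (C * (m%:R * v)) ^+ 2).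
  move=> p; have h0 : 0 <= mean P (fun w => lin X psi 0 p w ^+ 2).
    by apply: mean_ge0 => w; exact: sqr_ge0.
  have h1 : mean P (fun w => lin X psi 0 p w ^+ 2) <= C * (m%:R * v).
    rewrite -(lin_form_mean psi2 psi0).
    have [+ _] := rho_star_variance_bounds (fun i => (b i)%:R) m mpsi psi2.
    move=> /le_trans; apply; rewrite ler_wpM2l ?(ltW C_gt0)// ler_wpM2r//.
    rewrite -[m in leRHS]card_ord -sumr_const; apply: ler_sum => i _.
    by case: (b i); rewrite ?expr1n// expr0n.
  by rewrite lerXn2r// nnegrE (le_trans h0).
have hA := half (fun i => ~~ e i); have hBB := half e.
have hc := @cov_lin_rho_star _ _ _ P X r psi (fun x => x ^+ 2) (fun x => x ^+ 2) pA pB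
  rho_starE (proj1 (andP r01)) mpsi msq msq
  (bounded_rv_Lfun2 P (bounded_rvX 2 (bl 0 pA))) (bounded_rv_Lfun2 P (bounded_rvX 2 (bl 0 pB))).
have {hc} := fourth_moment_correlated r01 (bl 0 pA) (bl 0 pB) (hc _).
have -> : mean P (fun w => (lin X psi 0 pA w + lin X psi 0 pB w) ^+ 4) =
    mean P (fun w => lin X psi 0 (block 0 m) w ^+ 4).
  by congr mean; apply/funext => w; rewrite AB.
move=> h; apply: le_trans (h _) _.
  move=> k; rewrite /pA /pB -(poly_def m (fun i => (~~ e i)%:R)).
  rewrite -(poly_def m (fun i => (e i)%:R)) !coef_poly.
  by case: ltnP => _; [case: (e k); [left|right]|left].
pose q := (1 - r) ^+ 2; have q0 : 0 < q^-1.
  by rewrite invr_gt0 exprn_gt0// subr_gt0; case/andP: (r01).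
have mv0 : 0 <= m%:R * v by rewrite mulr_ge0.
have h1 : 64 / q * mean P (fun w => (lin X psi 0 pA w - lin X psi 0 pB w) ^+ 4) <=
    64 / q * (3 * (C * (m%:R * (eps ^+ 2 * v)) + (m%:R * v) ^+ 2)).
  have c0 : 0 <= 64 / q by rewrite mulr_ge0// ltW.
  by rewrite ler_wpM2l//; apply: (le_trans hD); rewrite ler_wpM2l.
apply: (le_trans (lerD h1 (ler_wpM2l (ler0n _ 16) (lerD hA hBB)))).
have qi0 := ltW q0; have Cge0 := ltW C_gt0; have e20 := sqr_ge0 eps.
have mv2 := sqr_ge0 (m%:R * v); have C2 := sqr_ge0 C.
have mve : 0 <= m%:R * v * eps ^+ 2 by rewrite mulr_ge0.
have h2 : 0 <= q^-1 * (m%:R * v * eps ^+ 2) by rewrite mulr_ge0.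
have h3 : 0 <= q^-1 * (C * (m%:R * v) ^+ 2) by rewrite mulr_ge0// mulr_ge0.
have h4 : 0 <= C ^+ 2 * (m%:R * v * eps ^+ 2) by rewrite mulr_ge0.
rewrite /K4 -/q; move: h2 h3 h4; move: (q^-1) => qi; lra.
Qed.

End clt_rho_star.

(** * Clipping, which brings unbounded covariances within reach of strong mixing *)

Section clipping.
Context {R : realType}.
Implicit Types x y M : R.

Definition clip M x : R := Num.max (- M) (Num.min M x).

Lemma measurable_clip M : measurable_fun setT (clip M).
Proof.
apply: measurable_maxr => //.
by apply: measurable_minr => //; exact: measurable_id.
Qed.

Lemma norm_clip_le M x : 0 <= M -> `|clip M x| <= M.
Proof.
move=> M0; rewrite ler_norml /clip; apply/andP; split; first by rewrite le_max lexx.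
by rewrite ge_max ge_min lexx/= (le_trans _ M0)// oppr_le0.
Qed.

Lemma clip_lipschitz M x y : 0 <= M -> `|clip M x - clip M y| <= `|x - y|.
Proof.
move=> M0; have [h1 h2] : x - y <= `|x - y| /\ y - x <= `|x - y|.
  by rewrite ler_norm -[y - x]opprB -normrN ler_norm.
have h0 := normr_ge0 (x - y); rewrite ler_norml.
pose c z := [\/ z <= - M /\ clip M z = - M, M <= z /\ clip M z = M |
  - M <= z <= M /\ clip M z = z].
have cE z : c z.
  rewrite /c /clip /Num.max /Num.min.
  case: (ltP M z) => z1; case: ifP => z2.
  - by constructor 2; split=> //; exact: ltW.
  - by constructor 2; split; [exact: ltW|move/negbT: z2; rewrite -leNgt; lra].
  - by constructor 3; split=> //; apply/andP; split => //; exact: ltW.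
  - by constructor 1; split=> //; move/negbT: z2; rewrite -leNgt.
case: (cE x) => -[hx ->]; case: (cE y) => -[hy ->]; lra.
Qed.

(** The difference vanishes unless |x| exceeds [M], and there its square is at most x^2, itself at
    most x^4 / M^2. *)
Lemma clip_error M x : 0 < M -> (x - clip M x) ^+ 2 <= x ^+ 4 / M ^+ 2.
Proof.
move=> M0; have x4 : 0 <= x ^+ 4 / M ^+ 2.
  by rewrite divr_ge0 ?sqr_ge0// -[4%N]/(2 * 2)%N exprM sqr_ge0.
have big : M ^+ 2 <= x ^+ 2 -> (x - clip M x) ^+ 2 <= x ^+ 2 ->
    (x - clip M x) ^+ 2 <= x ^+ 4 / M ^+ 2.
  move=> h /le_trans; apply; rewrite ler_pdivlMr ?exprn_gt0//.
  by rewrite -[4%N]/(2 + 2)%N exprD ler_wpM2l ?sqr_ge0.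
have [xM|Mx] := leP x M; last first.
  have cE : clip M x = M by rewrite /clip (min_idPl (ltW Mx)); apply/max_idPr; lra.
  by rewrite cE in big *; apply: big; nra.
rewrite /clip (min_idPr xM) in big *.
have [Mx|] := boolP (- M <= x); first by rewrite (max_idPr Mx) subrr expr0n.
rewrite -ltNge => xM'.
rewrite (max_idPl (ltW xM')) in big *.
by apply: big; nra.
Qed.

End clipping.

Section clip_covariance.
Context {d : measure_display} {Omega : measurableType d} {R : realType}.
Variable P : probability Omega R.

(** Strong mixing sees covariances through sup norms, and the sup norm of a long block sum is far
    too large. Clipping at [M] replaces it by a fixed level at a cost measured by fourth moments. *)
Lemma cov_clip (M : R) (f g : Omega -> R) : 0 < M -> bounded_rv f -> bounded_rv g ->
  `|cov P f g| <= `|cov P (fun w => clip M (f w)) (fun w => clip M (g w))| +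
    Num.sqrt (mean P (fun w => f w ^+ 4) / M ^+ 2) * Num.sqrt (cov P g g) +
    Num.sqrt (cov P f f) * Num.sqrt (mean P (fun w => g w ^+ 4) / M ^+ 2).
Proof.
move=> M0 bf bg; have M_ge0 := ltW M0.
have bc (h : Omega -> R) : bounded_rv h -> bounded_rv (fun w => clip M (h w)).
  move=> bh; apply: (bounded_rv_comp (measurable_clip M) (M := M)) bh.1 => x.
  exact: norm_clip_le.
have L2c h : bounded_rv h -> (fun w => clip M (h w)) \in Lfun P 2%:E.
  by move=> bh; exact/bounded_rv_Lfun2/bc.
have f2 := bounded_rv_Lfun2 P bf; have g2 := bounded_rv_Lfun2 P bg.
have bfc := bounded_rvB bf (bc _ bf); have bgc := bounded_rvB bg (bc _ bg).
have err h : bounded_rv h -> Num.sqrt (cov P (fun w => h w - clip M (h w)) (fun w => h w - clip M (h w)))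
    <= Num.sqrt (mean P (fun w => h w ^+ 4) / M ^+ 2).
  move=> bh; apply: ler_wsqrtr; have bhc := bounded_rvB bh (bc _ bh).
  apply: (le_trans (cov_le_mean_sqr 0 (bounded_rv_Lfun2 P bhc))).
  rewrite mulrC -meanZ; last exact/bounded_rv_Lfun1/bounded_rvX.
  apply: le_mean.
  - by apply/bounded_rv_Lfun1/bounded_rvX/bounded_rvB => //; exact: bounded_rv_cst.
  - exact/bounded_rv_Lfun1/bounded_rvZ/bounded_rvX.
  by move=> w; rewrite subr0 mulrC; exact: clip_error.
have e1 : cov P f g = cov P (fun w => clip M (f w)) (fun w => clip M (g w)) +
    cov P (fun w => f w - clip M (f w)) g +
    cov P (fun w => clip M (f w)) (fun w => g w - clip M (g w)).
  rewrite [X in _ = _ + X]covC covBl ?L2c// covBl ?L2c//.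
  rewrite (covC P g) (covC P (fun w => clip M (g w))); ring.
rewrite e1; apply: (le_trans (ler_normD _ _)); apply: lerD.
  apply: (le_trans (ler_normD _ _)); rewrite lerD2l.
  apply: (le_trans (cov_CS (bounded_rv_Lfun2 P bfc) g2)).
  by rewrite ler_wpM2r ?sqrtr_ge0// err.
apply: (le_trans (cov_CS (L2c _ bf) (bounded_rv_Lfun2 P bgc))).
apply: ler_pM; rewrite ?sqrtr_ge0//; last exact: err.
apply: ler_wsqrtr; rewrite -[leRHS]mul1r -(expr1n R 2).
apply: (cov_lipschitz ler01) => //; last exact: L2c.
by move=> x y; rewrite mul1r clip_lipschitz.
Qed.

End clip_covariance.

(** * Central limit theorem for small bounded functions under strong mixing *)

Section clt_alpha.
Context {d : measure_display} {Omega : measurableType d} {R : realType}.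
Variables (P : probability Omega R) (X : int -> {RV P >-> R}).
Hypothesis X_stationary : strictly_stationary X.

Lemma cov_block_alpha (psi : R -> R) (eps : R) (h1 h2 : R -> R) (L a N1 N2 : R) i m1 m2 q
    (s := fun k => form_norm (lin_form X psi) (block 0 k)) :
  (alpha_mix X q.+1 <= a%:E)%E ->
  measurable_fun setT psi -> (forall x, `|psi x| <= eps) ->
  (forall k, mean P (fun w => psi (X k w)) = 0) ->
  measurable_fun setT h1 -> measurable_fun setT h2 -> 0 <= L -> 0 < N1 -> 0 < N2 ->
  (forall x y, `|h1 x - h1 y| <= L * `|x - y|) ->
  (forall x y, `|h2 x - h2 y| <= L * `|x - y|) ->
  (forall x, `|h1 x| <= N1) -> (forall x, `|h2 x| <= N2) -> (q <= m1)%N ->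
  `|cov P (fun w => h1 (lin X psi 0 (block i m1) w))
          (fun w => h2 (lin X psi 0 (block (i + m1) m2) w))| <=
  4 * a * (N1 * N2) + L ^+ 2 * (s q * s m2).
Proof.
move=> ha mpsi hb psi0 mh1 mh2 L0 N10 N20 hL1 hL2 b1 b2 qm.
have psi2 k := bounded_psi_Lfun2 X k mpsi hb.
have hB := lin_form_stationary X_stationary mpsi psi2.
have hl (h : R -> R) (N : R) (b : int) (p : {poly R}) : measurable_fun setT h ->
    (forall x, `|h x| <= N) -> (fun w => h (lin X psi b p w)) \in Lfun P 2%:E.
  by move=> mh hM; apply/bounded_rv_Lfun2/(bounded_rv_comp mh hM)/measurable_lin.
rewrite -[X in block i X](subnK qm) blockD.
apply: (le_trans (cov_lipschitz_split psi2 psi0 _ _ _ L0 hL1 hL2 _ _)).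
- by move=> p; exact: hl b1.
- by move=> p; exact: hl b2.
rewrite -!/(s _) !(form_norm_block hB (i + _)) lerD2r.
apply: (@cov_lin_alpha _ _ _ _ _ X_stationary q _ (i + (m1 - q))%N) => //.
- exact: size_block.
- by move=> j hj; rewrite coef_block_lt//; clear - hj qm; lia.
Qed.

End clt_alpha.

(** Cauchy-Schwarz interpolates the third absolute moment between the second and the fourth. It
    serves blocks too long for a useful sup bound. *)
Lemma cf_close_third_moment (d : measure_display) (Omega : measurableType d)
    (R : realType) (P : probability Omega R) (t V W : R) (f : Omega -> R) :
  bounded_rv f -> mean P f = 0 -> cov P f f <= V ->
  0 <= W -> V * mean P (fun w => f w ^+ 4) <= W ^+ 2 ->
  cf_close P t f (2 * `|t| ^+ 3 * W + (t ^+ 2 * V) ^+ 2).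
Proof.
move=> bf f0 fV W0 hW; apply: cf_close_le (cf_close_leaf t bf f0).
have V0 := cov_ge0 P f.
have m40 : 0 <= mean P (fun w => f w ^+ 4).
  by apply: mean_ge0 => w; rewrite -[4%N]/(2 * 2)%N exprM sqr_ge0.
have m30 : 0 <= mean P (fun w => `|f w| ^+ 3).
  by apply: mean_ge0 => w; rewrite exprn_ge0.
have t30 : 0 <= `|t| ^+ 3 by rewrite exprn_ge0.
apply: lerD.
  rewrite ler_wpM2l// ?mulr_ge0// -(@ler_pXn2r _ 2)// ?nnegrE//.
  apply: le_trans hW.
  have := mean_CS (bounded_rv_Lfun2 P (bounded_rv_norm bf)) (bounded_rv_Lfun2 P (bounded_rvX 2 bf)).
  have -> : (fun w => `|f w| * f w ^+ 2) = (fun w => `|f w| ^+ 3).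
    by apply/funext => w; rewrite [RHS]exprS real_normK ?num_real.
  have -> : (fun w => (f w ^+ 2) ^+ 2) = (fun w => f w ^+ 4).
    by apply/funext => w; rewrite -exprM.
  have -> : mean P (fun w => `|f w| ^+ 2) = cov P f f.
    rewrite covE ?bounded_rv_Lfun2// f0 mul0r subr0; congr mean; apply/funext => w.
    by rewrite real_normK ?num_real// expr2.
  by move=> /le_trans; apply; rewrite ler_wpM2r.
have t2 := sqr_ge0 t.
have le : t ^+ 2 * cov P f f <= t ^+ 2 * V by rewrite ler_wpM2l.
by apply: lerXn2r => //; rewrite nnegrE ?(le_trans _ le)// mulr_ge0.
Qed.

Lemma sqrtrM_le_add (R : rcfType) (x y : R) : 0 <= x -> 0 <= y ->
  Num.sqrt x * Num.sqrt y <= x + y.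
Proof.
move=> x0 y0; have := ler_mul2_weighted (Num.sqrt x) (Num.sqrt y) ltr01.
rewrite invr1 !mul1r !sqr_sqrtr//.
by have := mulr_ge0 (sqrtr_ge0 x) (sqrtr_ge0 y); lra.
Qed.

Section clt_rho_star_alpha.
Context {d : measure_display} {Omega : measurableType d} {R : realType}.
Variables (P : probability Omega R) (X : int -> {RV P >-> R}).
Hypothesis X_stationary : strictly_stationary X.
Variables C K : R.
Hypothesis C_gt0 : 0 < C.
Hypothesis K_gt0 : 0 < K.
Hypothesis variance_ub : forall (psi : R -> R) (eps : R) m,
  measurable_fun setT psi -> (forall x, `|psi x| <= eps) ->
  form_norm (lin_form X psi) (block 0 m) ^+ 2 <= C * (m%:R * lin_form X psi 1 1).
Hypothesis fourth_ub : forall (psi : R -> R) (eps : R) a m,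
  measurable_fun setT psi -> (forall x, `|psi x| <= eps) ->
  (forall k, mean P (fun w => psi (X k w)) = 0) ->
  mean P (fun w => lin X psi 0 (block a m) w ^+ 4) <=
    K * ((m%:R * lin_form X psi 1 1) ^+ 2 + m%:R * lin_form X psi 1 1 * eps ^+ 2).
Hypothesis alpha0 : forall e : R, 0 < e -> exists q, (alpha_mix X q.+1 <= e%:E)%E.

Section merge.
Variables (psi : R -> R) (eps : R).
Hypothesis mpsi : measurable_fun setT psi.
Hypothesis hb : forall x, `|psi x| <= eps.
Hypothesis psi0 : forall k, mean P (fun w => psi (X k w)) = 0.
Local Notation v := (lin_form X psi 1 1).
Local Notation s k := (form_norm (lin_form X psi) (block 0 k)).

(** The three error terms come from strong mixing across the gap, with sup norm 1 for the
    trigonometric functions and [M] for the clipped sums, from the discarded gap through [S], and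
    from clipping with a factor [M] in the denominator. *)
Lemma merge_alpha (t a M V S : R) (i m1 m2 q : nat) e1 e2 :
  (alpha_mix X q.+1 <= a%:E)%E -> 0 < M -> (q <= m1)%N ->
  m1%:R * v <= V -> m2%:R * v <= V -> s q * s m2 <= S ->
  eps ^+ 2 <= 1 ->
  cf_close P t (lin X psi 0 (block i m1)) e1 ->
  cf_close P t (lin X psi 0 (block (i + m1) m2)) e2 ->
  cf_close P t (lin X psi 0 (block i (m1 + m2)))
    (e1 + e2 + (a * (16 + 4 * t ^+ 2 * M ^+ 2) + 5 * t ^+ 2 * S +
      2 * t ^+ 2 * ((K * (V ^+ 2 + V) + C * V) / M))).
Proof.
move=> ha M0 qm m1V m2V sS e1' h1 h2.
have psi2 k := bounded_psi_Lfun2 X k mpsi hb.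
have hB := lin_form_stationary X_stationary mpsi psi2.
have v0 : 0 <= v := form_ge0 hB 1.
have V0 : 0 <= V by apply: le_trans m1V; rewrite mulr_ge0.
have C_ge0 := ltW C_gt0; have K_ge0 := ltW K_gt0; have M_ge0 := ltW M0.
have bl p : bounded_rv (lin X psi 0 p).
  apply: bounded_rv_sum => j; apply: bounded_rvZ.
  exact: (bounded_rv_comp mpsi hb).
rewrite blockD.
have -> : lin X psi 0 (block i m1 + block (i + m1) m2) =
    fun w => lin X psi 0 (block i m1) w + lin X psi 0 (block (i + m1) m2) w.
  by apply/funext => w; rewrite linD.
set f := lin X psi 0 (block i m1); set g := lin X psi 0 (block (i + m1) m2).
have t20 := sqr_ge0 t.
have cs (k1 k2 : R -> R) : k1 = cos \/ k1 = sin -> k2 = cos \/ k2 = sin ->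
    `|cov P (fun w => k1 (t * f w)) (fun w => k2 (t * g w))| <= 4 * a + t ^+ 2 * S.
  move=> /(cos_sin_facts t)[mh1 b1 l1] /(cos_sin_facts t)[mh2 b2 l2].
  have := cov_block_alpha X_stationary i m2 ha mpsi hb psi0 mh1 mh2 (normr_ge0 t) ltr01 ltr01
    l1 l2 b1 b2 qm.
  rewrite mulr1 mulr1 real_normK ?num_real// => /le_trans; apply.
  by rewrite lerD2l ler_wpM2l.
have m4 j m : m%:R * v <= V ->
    mean P (fun w => lin X psi 0 (block j m) w ^+ 4) <= K * (V ^+ 2 + V).
  move=> mV; apply: (le_trans (fourth_ub j m mpsi hb psi0)); rewrite ler_wpM2l//.
  have mv0 : 0 <= m%:R * v by rewrite mulr_ge0.
  apply: lerD; first by rewrite lerXn2r ?nnegrE.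
  by rewrite -[leRHS]mulr1; apply: ler_pM => //; exact: sqr_ge0.
have m2' j m : m%:R * v <= V -> cov P (lin X psi 0 (block j m)) (lin X psi 0 (block j m)) <= C * V.
  move=> mV; rewrite -/(lin_form X psi _ _) -(form_normE hB) (form_norm_block hB).
  by apply: (le_trans (variance_ub m mpsi hb)); rewrite ler_wpM2l.
have h0 : forall k, 0 <= mean P (fun w => lin X psi 0 k w ^+ 4).
  by move=> k; apply: mean_ge0 => w; rewrite -[4%N]/(2 * 2)%N exprM sqr_ge0.
have mix x y : 0 <= x -> x <= K * (V ^+ 2 + V) -> 0 <= y -> y <= C * V ->
    Num.sqrt (x / M ^+ 2) * Num.sqrt y <= (K * (V ^+ 2 + V) + C * V) / M.
  move=> x0 hx y0 hy; rewrite sqrtrM// sqrtrV ?sqr_ge0// sqrtr_sqr gtr0_norm//.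
  rewrite mulrAC ler_wpM2r ?invr_ge0//.
  by apply: (le_trans (sqrtrM_le_add x0 y0)); rewrite lerD.
have cfg : `|cov P f g| <= 4 * a * (M * M) + S + 2 * ((K * (V ^+ 2 + V) + C * V) / M).
  apply: (le_trans (cov_clip P M0 (bl _) (bl _))).
  have l1 x y : `|clip M x - clip M y| <= 1 * `|x - y| by rewrite mul1r clip_lipschitz.
  have nc x := @norm_clip_le _ M x M_ge0.
  have := cov_block_alpha X_stationary i m2 ha mpsi hb psi0 (measurable_clip M)
    (measurable_clip M) ler01 M0 M0 l1 l1 nc nc qm.
  rewrite expr1n mul1r -/f -/g => hc.
  have q1 := mix _ _ (h0 _) (m4 i m1 m1V) (cov_ge0 P g) (m2' _ _ m2V).
  have q2 := mix _ _ (h0 _) (m4 (i + m1)%N m2 m2V) (cov_ge0 P f) (m2' _ _ m1V).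
  rewrite [X in _ + X]mulrC; move: q1 q2 hc sS; rewrite -/f -/g; lra.
have cov_le := ler_wpM2l t20 cfg.
apply: cf_close_le (cf_close_merge (bl _).1 (bl _).1 (bounded_rv_Lfun2 P (bl _))
  (bounded_rv_Lfun2 P (bl _)) cs cov_le h1 h2).
rewrite lerD2l le_eqVlt; apply/orP; left; apply/eqP; ring.
Qed.

End merge.

(** Strong mixing comes without a rate, so merge errors cannot be summed over an unbounded number of
    scales. A number [J] of halvings independent of [n] is used instead; the unsplit blocks then
    grow with [n], but their variances are small, and the fourth moment bound handles them. *)
Lemma alpha_block_clt : bounded_block_clt X.
Proof.
move=> C0 t eta C00 eta0.
pose T := t ^+ 2; have T0 : 0 <= T := sqr_ge0 t.
pose t3 := `|t| ^+ 3; have t30 : 0 <= t3 by rewrite exprn_ge0.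
have C_ge0 := ltW C_gt0; have K_ge0 := ltW K_gt0; have C0_ge0 := ltW C00.
have eta4 : 0 < eta / 4 by rewrite divr_gt0.
have small (x y : R) : 0 <= x -> 0 < y -> exists2 z : R, 0 < z & x * z <= y.
  move=> x0 y0; have x1 : 0 < x + 1 by lra.
  exists (y / (x + 1)); first by rewrite divr_gt0.
  by rewrite mulrA ler_pdivrMr// mulrDr mulr1 mulrC lerDl ltW.
(* The unsplit blocks may cost [eta / 4] for third moments, through [ka], and [eta / 4] for squared
   variances, through [d2]; the merges share the remaining [eta / 2]. *)
have [ka ka0 hka] : exists2 ka : R, 0 < ka & C0 * (2 * t3) * ka <= eta / 4.
  by apply: small => //; rewrite mulr_ge0// mulr_ge0.
(* The factor 2 adds the bounds [del] on the block variance and on [eps ^+ 2], the two terms of the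
   fourth moment estimate. *)
have [d1 d10 hd1] : exists2 d1 : R, 0 < d1 & C * K * 2 * d1 <= ka ^+ 2.
  by apply: small; [rewrite !mulr_ge0|rewrite exprn_gt0].
have [d2 d20 hd2] : exists2 d2 : R, 0 < d2 & C0 * (T ^+ 2 * C ^+ 2) * d2 <= eta / 4.
  by apply: small => //; do !apply: mulr_ge0 => //; exact: sqr_ge0.
pose del := Num.min d1 d2; have del0 : 0 < del by rewrite /del lt_min d10.
have dd1 : del <= d1 by rewrite /del ge_min lexx.
have dd2 : del <= d2 by rewrite /del ge_min lexx orbT.
(* After [J] halvings a block has at most [2 * n / 2 ^ J] terms, hence [m%:R * v <= del]. *)
have [J hJ] := exp_ge_nat (2 * C0 / del) (ltr1n R 2).
pose eps := Num.min 1 del; have eps0 : 0 < eps by rewrite /eps lt_min ltr01.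
have eps1 : eps <= 1 by rewrite /eps ge_min lexx.
have epsd : eps ^+ 2 <= del.
  by rewrite expr2 -[leRHS]mul1r ler_pM ?(ltW eps0)// /eps ge_min lexx orbT.
have eps21 : eps ^+ 2 <= 1 by rewrite expr_le1// ltW.
(* A single merge costs at most [es]. Merged blocks have at least [n / 2 ^ J.+1] terms, so as a rate
   this is [x j], and [J] scales add up to [J * 2 ^ J.+1 * es]. *)
have [es es0 hes] : exists2 es : R, 0 < es & J%:R * 2 ^+ J.+1 * es <= eta / 2.
  by apply: small; [rewrite mulr_ge0// exprn_ge0|rewrite divr_gt0].
have es6 : 0 < es / 6 by rewrite divr_gt0.
pose V := 2 * C0; have V0 : 0 <= V by rewrite /V mulr_ge0.
pose H := K * (V ^+ 2 + V) + C * V.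
have H0 : 0 <= H by rewrite /H addr_ge0 ?mulr_ge0 ?addr_ge0 ?sqr_ge0.
have [mi mi0 hmi] : exists2 mi : R, 0 < mi & 2 * T * H * mi <= es / 6.
  by apply: small => //; do !apply: mulr_ge0 => //.
(* The clipping level is fixed before [a], since the strong mixing term grows with [M ^+ 2]; the gap
   [q] then depends on [a]. *)
pose M := mi^-1; have M0 : 0 < M by rewrite /M invr_gt0.
have [tau tau0 htau] : exists2 tau : R, 0 < tau & 5 * T * (C * V) * tau <= es / 6.
  by apply: small => //; do !apply: mulr_ge0 => //.
have [a a0 ha] : exists2 a : R, 0 < a & (16 + 4 * T * M ^+ 2) * a <= es / 6.
  by apply: small => //; apply: addr_ge0 => //; do !apply: mulr_ge0 => //; exact: ltW.
have [q hq] := alpha0 a0.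
(* The gap has a fixed length, so its variance is of order [C0 / n] and this part of the merge error
   vanishes for large [n]. *)
pose F := 5 * T * (tau^-1 * (C * q%:R * C0)).
have F0 : 0 <= F.
  by rewrite /F; do !apply: mulr_ge0 => //; rewrite invr_ge0 ltW.
exists eps => //; exists (maxn (2 ^ (J + q).+2) (Num.truncn (F / (es / 6))).+1) => n psi.
rewrite geq_max => /andP[Jn Fn] mpsi hb psi0 nv.
set v := lin_form X psi 1 1 in nv.
have psi2 k := bounded_psi_Lfun2 X k mpsi hb.
have hB := lin_form_stationary X_stationary mpsi psi2.
have v0 : 0 <= v := form_ge0 hB 1.
have nn0 : (0 < n)%N by rewrite (leq_trans _ Jn)// expn_gt0.
have n0 : 0 < n%:R :> R by rewrite ltr0n.
have Fn' : F / n%:R <= es / 6.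
  rewrite ler_pdivrMr// mulrC -ler_pdivrMr//.
  by apply/ltW/(lt_le_trans (truncnS_gt _)); rewrite ler_nat.
have /andP[jn1 jn2] := @trunc_log_bounds 2 n isT nn0.
set jn := trunc_log 2 n in jn1 jn2.
have Jjn : ((J + q).+2 <= jn)%N by rewrite trunc_log_max.
pose j0 := (jn - J)%N; have jnE : jn = (j0 + J)%N.
  by rewrite /j0; clear - Jjn; lia.
have qj0 : (q.+2 <= j0)%N by rewrite /j0; clear - Jjn; lia.
have bl p : bounded_rv (lin X psi 0 p).
  apply: bounded_rv_sum => j; apply: bounded_rvZ.
  exact: (bounded_rv_comp mpsi hb).
pose Q b m e := cf_close P t (lin X psi 0 (block b m)) e.
pose beta := v * (2 * t3 * ka + T ^+ 2 * C ^+ 2 * del).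
pose x (j : nat) := es * 2 ^+ J.+1 / n%:R.
have smallv m : (m <= 2 ^ jn.+1)%N -> m%:R * v <= V.
  move=> mj; rewrite /V; apply: (@le_trans _ _ (2 * (n%:R * v))); last by rewrite ler_wpM2l.
  rewrite mulrA ler_wpM2r// -natrM ler_nat (leq_trans mj)// expnS.
  by rewrite leq_mul2l jn1 orbT.
have leafv m : (m <= 2 ^ j0.+1)%N -> m%:R * v <= del.
  move=> mj; have mJ : m%:R * 2 ^+ J <= 2 * n%:R :> R.
    rewrite -natrX -!natrM ler_nat (@leq_trans (2 ^ j0.+1 * 2 ^ J))//.
      by rewrite leq_mul2r mj orbT.
    by rewrite -expnD addSn -jnE expnS leq_mul2l jn1 orbT.
  have J0 : 0 < 2 ^+ J :> R by rewrite exprn_gt0.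
  rewrite -(ler_pM2r J0); apply: (@le_trans _ _ (2 * C0)); last first.
    by rewrite [leRHS]mulrC -ler_pdivrMr.
  have := ler_wpM2r v0 mJ; move: nv; lra.
have lt_v b m : (m <= 2 ^ j0.+1)%N -> Q b m (m%:R * beta).
  move=> mj; have mvd := leafv _ mj; have mv0 : 0 <= m%:R * v by rewrite mulr_ge0.
  have ka_ge0 := ltW ka0; have del_ge0 := ltW del0.
  have hvar : cov P (lin X psi 0 (block b m)) (lin X psi 0 (block b m)) <= C * (m%:R * v).
    rewrite -/(lin_form X psi _ _) -(form_normE hB) (form_norm_block hB).
    exact: (variance_ub m mpsi hb).
  have W0 : 0 <= m%:R * v * ka by rewrite mulr_ge0.
  have h4 : C * (m%:R * v) * mean P (fun w => lin X psi 0 (block b m) w ^+ 4) <=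
      (m%:R * v * ka) ^+ 2.
    apply: (@le_trans _ _ (C * (m%:R * v) *
      (K * ((m%:R * v) ^+ 2 + m%:R * v * eps ^+ 2)))).
      by rewrite ler_wpM2l ?mulr_ge0//; exact: fourth_ub.
    rewrite [leRHS]exprMn; apply: (@le_trans _ _ ((m%:R * v) ^+ 2 * (C * K * 2 * del))).
      rewrite [leLHS](_ : _ = (m%:R * v) ^+ 2 * (C * K * (m%:R * v + eps ^+ 2))); last by ring.
      rewrite ler_wpM2l ?sqr_ge0// -[leRHS]mulrA ler_wpM2l ?mulr_ge0//.
      by move: mvd epsd; lra.
    rewrite ler_wpM2l ?sqr_ge0//; apply: le_trans hd1.
    by rewrite ler_wpM2l//; do !apply: mulr_ge0 => //.
  apply: cf_close_le (cf_close_third_moment t (bl _) (mean_lin psi2 psi0 _) hvar W0 h4).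
  rewrite -/t3 -/T /beta.
  have : (m%:R * v) * (m%:R * v) <= (m%:R * v) * del by rewrite ler_wpM2l.
  have TC0 : 0 <= T ^+ 2 * C ^+ 2 by rewrite mulr_ge0 ?sqr_ge0.
  move=> /(ler_wpM2l TC0); lra.
have main b m : (2 ^ (j0 + J) <= m <= 2 ^ (j0 + J).+1)%N ->
    Q b m (m%:R * (beta + \sum_(l < J) x (j0 + l)%N)).
  apply: (@halving_induction _ Q j0 J beta x) => //.
  - by move=> {}b {}m /andP[_]; exact: lt_v.
  - move=> j {}b {}m e1 e2 /andP[jj0 jJ] /andP[m1 m2] Q1 Q2.
    have mV : (m <= 2 ^ jn.+1)%N.
      by rewrite (leq_trans m2)// leq_exp2l//; clear - jJ jnE; lia.
    have mle : (m./2 <= m)%N by clear; lia.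
    have ule : (uphalf m <= m)%N by clear; lia.
    have qm : (q <= m./2)%N.
      have q2 : (q.+2 <= 2 ^ j)%N.
        by rewrite (leq_trans (leq_trans qj0 jj0))// ltnW// ltn_expl.
      have : (2 ^ j.+1 = 2 * 2 ^ j)%N by rewrite expnS.
      by move: m1 q2; clear; lia.
    have hs k : (k <= 2 ^ jn.+1)%N -> form_norm (lin_form X psi) (block 0 k) ^+ 2 <= C * V.
      move=> kn; apply: (le_trans (variance_ub k mpsi hb)).
      by rewrite ler_wpM2l// smallv.
    have sq := variance_ub q mpsi hb; rewrite -/v in sq.
    have s2 := hs _ (leq_trans ule mV).
    have S0 : form_norm (lin_form X psi) (block 0 q) *
        form_norm (lin_form X psi) (block 0 (uphalf m)) <=
        tau^-1 * (C * (q%:R * v)) + tau * (C * V).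
      have := ler_mul2_weighted (form_norm (lin_form X psi) (block 0 q))
        (form_norm (lin_form X psi) (block 0 (uphalf m))) tau0.
      have ti : 0 <= tau^-1 by rewrite invr_ge0 ltW.
      have := ler_wpM2l ti sq; have := ler_wpM2l (ltW tau0) s2.
      have ss0 : 0 <= form_norm (lin_form X psi) (block 0 q) *
        form_norm (lin_form X psi) (block 0 (uphalf m)) by rewrite mulr_ge0 ?sqrtr_ge0.
      by move: ss0; lra.
    have := merge_alpha mpsi hb psi0 hq M0 qm (smallv _ (leq_trans mle mV))
      (smallv _ (leq_trans ule mV)) S0 eps21 Q1 Q2.
    rewrite (_ : m./2 + uphalf m = m)%N; last by clear; lia.
    apply: cf_close_le; rewrite lerD2l -/T -/H.
    have vn : v <= C0 / n%:R by rewrite ler_pdivlMr// mulrC.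
    have CV0 : 0 <= C * V by rewrite mulr_ge0.
    apply: (@le_trans _ _ es); last first.
      have J0 : 0 < 2 ^+ J.+1 :> R by rewrite exprn_gt0.
      rewrite /x mulrA ler_pdivlMr// mulrCA ler_wpM2l ?(ltW es0)//.
      rewrite -natrX -natrM ler_nat.
      rewrite (leq_trans (ltnW jn2))// jnE -addnS expnD leq_mul2r; apply/orP; right.
      by apply: leq_trans m1; rewrite leq_exp2l// (leq_trans jj0).
    have p1 : 5 * T * (tau^-1 * (C * (q%:R * v))) <= es / 6.
      apply: le_trans Fn'.
      rewrite [leRHS](_ : _ = 5 * T * tau^-1 * C * q%:R * (C0 / n%:R)); last first.
        by rewrite /F; ring.
      rewrite [leLHS](_ : _ = 5 * T * tau^-1 * C * q%:R * v); last by ring.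
      rewrite ler_wpM2l//; do !apply: mulr_ge0 => //.
      by rewrite invr_ge0 ltW.
    move: ha htau hmi p1; rewrite /M invrK -/M; lra.
apply: cf_close_le (main 1%N n _); last by rewrite -jnE jn1 ltnW.
rewrite (_ : \sum_(l < J) _ = J%:R * (es * 2 ^+ J.+1 / n%:R)); last first.
  by rewrite sumr_const card_ord mulr_natl.
rewrite [n%:R * (beta + _)]mulrDr /beta.
have nv0 : 0 <= n%:R * v by rewrite mulr_ge0.
have -> : n%:R * (J%:R * (es * 2 ^+ J.+1 / n%:R)) = J%:R * 2 ^+ J.+1 * es.
  by field; rewrite gt_eqF.
have ka_ge0 := ltW ka0; have del_ge0 := ltW del0.
have b1 : n%:R * v * (2 * t3 * ka) <= eta / 4.
  apply: le_trans hka; rewrite -[leRHS]mulrA ler_wpM2r//.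
  by do !apply: mulr_ge0.
have b2 : n%:R * v * (T ^+ 2 * C ^+ 2 * del) <= eta / 4.
  have TC0 : 0 <= T ^+ 2 * C ^+ 2 by rewrite mulr_ge0 ?sqr_ge0.
  apply: le_trans hd2; rewrite -[leRHS]mulrA; apply: ler_pM => //.
    by rewrite mulr_ge0.
  by rewrite ler_wpM2l.
move: b1 b2 hes; lra.
Qed.

End clt_rho_star_alpha.

(** The constants precede [psi]. The rest of the argument uses either mixing hypothesis only through
    this uniform statement and [bounded_block_clt]. *)
Definition linear_variance (d : measure_display) (Omega : measurableType d)
    (R : realType) (P : probability Omega R) (X : int -> {RV P >-> R}) : Prop :=
  exists C : R, exists2 c : R, 0 < C /\ 0 < c & exists N0 : nat,
  forall psi : R -> R, measurable_fun setT psi ->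
  (forall k, (fun w => psi (X k w)) \in Lfun P 2%:E) -> forall m,
  form_norm (lin_form X psi) (block 0 m) ^+ 2 <= C * (m%:R * lin_form X psi 1 1) /\
  ((N0 <= m)%N ->
   c * (m%:R * lin_form X psi 1 1) <= form_norm (lin_form X psi) (block 0 m) ^+ 2).

(** * The two mixing hypotheses *)

Section mixing_cases.
Context {d : measure_display} {Omega : measurableType d} {R : realType}.
Variables (P : probability Omega R) (X : int -> {RV P >-> R}).
Hypothesis X_stationary : strictly_stationary X.

Lemma rho_mixing_case : (rho_mix X 1 < 1)%E ->
  (\sum_(1 <= n <oo) rho_mix X (2 ^ n)%N < +oo)%E ->
  linear_variance X /\ bounded_block_clt X.
Proof.
move=> r1 rsum; pose rho n := fine (rho_mix X n.+1).
have rfin n : rho_mix X n.+1 \is a fin_num.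
  rewrite ge0_fin_numE ?rho_mix_ge0//.
  have h : (rho_mix X n.+1 <= rho_mix X 1)%E by exact: rho_mix_le.
  by rewrite (le_lt_trans h)// (lt_trans r1)// ltry.
have rhoE n : (rho_mix X n.+1 <= (rho n)%:E)%E by rewrite fineK.
have rho0 n : 0 <= rho n by rewrite fine_ge0// rho_mix_ge0.
have rho1 : rho 0%N < 1 by rewrite -lte_fin fineK.
have rho_le n : rho n <= rho 0%N.
  by rewrite -lee_fin !fineK//; exact: rho_mix_le.
pose S := (\sum_(1 <= n <oo) rho_mix X (2 ^ n)%N)%E.
have S0 : (0 <= S)%E by apply: nneseries_ge0 => n _ _; exact: rho_mix_ge0.
have Sfin : S \is a fin_num by rewrite ge0_fin_numE.
(* The given series starts at [rho_mix X 2]; the term [i = 0] is [rho_mix X 1], which is below 1 and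
   accounts for the added constant. *)
have rhoM N : \sum_(i < N) rho (2 ^ i).-1 <= 1 + fine S.
  case: N => [|N]; first by rewrite big_ord0 addr_ge0// fine_ge0.
  rewrite big_ord_recl/=; apply: lerD; first exact: ltW.
  rewrite -lee_fin fineK// -sumEFin.
  rewrite (eq_bigr (fun i : 'I_N => rho_mix X (2 ^ (i.+1)))); last first.
    by move=> i _; rewrite /rho fineK// /bump add1n prednK// expn_gt0.
  rewrite -(big_mkord xpredT (fun i => rho_mix X (2 ^ i.+1))).
  have <- : (\sum_(1 <= i < N.+1) rho_mix X (2 ^ i) =
    \sum_(0 <= i < N) rho_mix X (2 ^ i.+1))%E by rewrite big_add1.
  by apply: (@nneseries_lim_ge _ (fun n => rho_mix X (2 ^ n)) xpredT 1 N.+1) => n _ _; exact: rho_mix_ge0.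
split; last exact: (rho_block_clt X_stationary rhoE rho0 rhoM).
have [C [c Cc [N0 h]]] := block_variance_bounds rho0 rho1 rho_le rhoM.
exists C, c => //; exists N0 => psi mpsi psi2 m; apply: h.
  exact: lin_form_stationary.
exact: lin_form_gap_bound.
Qed.

(** The singletons of 0 and 1 show that the supremum is not over an empty family; together with the
    bound 1 this makes the coefficient finite. *)
Lemma rho_star_ge0 : (0%R <= rho_star_mix X 1)%E.
Proof.
apply: (@le_trans _ _ (rho_coef P (sigma_gen X [set 0%R]) (sigma_gen X [set 1%R]))).
  by apply: rho_coef_ge0; (exact: sigma_gen_set0 || exact: sigma_gen_setT).
apply: ereal_sup_ubound; exists ([set 0], [set 1]) => //=; split.
- by exists 0.
- by exists 1.
- by rewrite -subset0 => x /= [-> /eqP].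
- by apply/ereal_infP => _ [_ -> [_ -> <-]]; rewrite sub0r normrN normr1.
Qed.

Lemma rho_star_mixing_case : (rho_star_mix X 1 < 1)%E ->
  alpha_mix X n @[n --> \oo] --> (0 : \bar R)%E ->
  linear_variance X /\ bounded_block_clt X.
Proof.
move=> r1 a0; pose r := fine (rho_star_mix X 1).
have rfin : rho_star_mix X 1 \is a fin_num.
  by rewrite ge0_fin_numE ?rho_star_ge0// (lt_trans r1)// ltry.
have rE : (rho_star_mix X 1 <= r%:E)%E by rewrite fineK.
have r01 : 0 <= r < 1 by rewrite fine_ge0 ?rho_star_ge0//= -lte_fin fineK.
have [r0 rl1] := andP r01; have r1' : 0 < 1 - r by rewrite subr_gt0.
pose C := (1 + r) / (1 - r).
have C0 : 0 < C by rewrite /C divr_gt0// ltr_wpDr.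
split.
  exists C, C^-1; first by rewrite invr_gt0.
  by exists 0%N => psi mpsi psi2 m; have [? ?] := rho_star_block_bounds X_stationary r01 rE m mpsi psi2.
pose K := 192 * (C + 1) / (1 - r) ^+ 2 + 32 * C ^+ 2.
have K0 : 0 < K.
  have C20 : 0 < 32 * C ^+ 2 by rewrite mulr_gt0 ?exprn_gt0.
  rewrite /K ltr_wpDl//.
  by rewrite divr_ge0 ?exprn_ge0 ?(ltW r1')// mulr_ge0// addr_ge0// ltW.
apply: (alpha_block_clt X_stationary C0 K0).
- move=> psi eps m mpsi hb.
  by have [] := rho_star_block_bounds X_stationary r01 rE m mpsi (fun k => bounded_psi_Lfun2 X k mpsi hb).
- move=> psi eps a m mpsi hb psi0.
  exact: (block_fourth_moment X_stationary r01 rE a m mpsi hb psi0).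
move=> e e0.
move: (a0) => /fine_cvgP[afin /cvgrPdist_lt/(_ e e0) acvg].
have : \forall n \near \oo, (alpha_mix X n <= e%:E)%E.
  near=> n.
  have fn : alpha_mix X n \is a fin_num by near: n.
  rewrite -(fineK fn) lee_fin ltW//.
  have : `|0 - fine (alpha_mix X n)| < e.
    by near: n; exact: acvg.
  by rewrite sub0r normrN; exact/le_lt_trans/ler_norm.
by move=> [N _ hN]; exists N; apply: hN => /=.
Unshelve. all: by end_near. Qed.

End mixing_cases.

(** * Shrinking operators and their second moments *)

Section shrink_facts.
Context {R : realType}.
Implicit Types r x t : R.

Lemma norm_shrink r x : 0 <= r -> `|shrink r x| = Num.max (`|x| - r) 0.
Proof.
move=> r0; have [x0|x0|->] := ltgtP x 0.
- by rewrite shrink_neg// normrN ger0_norm ?le_max ?lexx ?orbT// ltr0_norm.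
- by rewrite shrink_pos// ger0_norm ?le_max ?lexx ?orbT// gtr0_norm.
- rewrite /shrink eqxx normr0 sub0r; symmetry; apply/max_idPr.
  by rewrite oppr_le0.
Qed.

Lemma shrink_tail r x t : 0 <= r -> 0 <= t -> (t < `|shrink r x|) = (t + r < `|x|).
Proof.
by move=> r0 t0; rewrite norm_shrink// lt_max ltrBrDr [t < 0]ltNge t0 orbF.
Qed.

Lemma shrink_eq0 r x : 0 <= r -> `|x| <= r -> shrink r x = 0.
Proof.
by move=> r0 xr; apply/eqP; rewrite -normr_le0 norm_shrink// ge_max subr_le0 xr lexx.
Qed.

Lemma shrink_lipschitz r r' x : 0 <= r -> 0 <= r' ->
  `|shrink r x - shrink r' x| <= `|r - r'|.
Proof.
wlog rr : r r' / r <= r'.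
  move=> h r0 r'0; case: (leP r r') => [|/ltW] rr; first exact: h.
  by rewrite distrC [leRHS]distrC; apply: h.
move=> r0 r'0; rewrite [leRHS]distrC [leRHS]ger0_norm ?subr_ge0// !shrinkE// ler_norml.
by case: (ltP r x); case: (ltP r' x); case: (ltP x (- r)); case: (ltP x (- r')) => ? ? ? ?; lra.
Qed.

(** Both shrunk values have the sign of [x] or vanish, and the one for the larger level is closer to
    0. *)
Lemma shrink_sub_sqr r r' x : 0 <= r -> r <= r' ->
  (shrink r x - shrink r' x) ^+ 2 <= shrink r x ^+ 2.
Proof.
move=> r0 rr; have r'0 := le_trans r0 rr; rewrite -subr_ge0 subr_sqr !shrinkE//.
case: (lerP 0 x) => x0; [apply: mulr_ge0|apply: mulr_le0];
case: (ltP r x); case: (ltP r' x); case: (ltP x (- r)); case: (ltP x (- r')) => ? ? ? ?; lra.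
Qed.

End shrink_facts.

Section shrunk_second_moment.
Context {d : measure_display} {Omega : measurableType d} {R : realType}.
Variables (P : probability Omega R) (X : int -> {RV P >-> R}).

Lemma integral_id_itv (y : R) : 0 <= y ->
  (\int[lebesgue_measure]_(t in `[0%R, y[) t%:E = (y ^+ 2 / 2)%:E)%E.
Proof.
rewrite le_eqVlt => /predU1P[<-|y0].
  by rewrite set_itv_ge ?bnd_simp// integral_set0 expr0n/= mul0r.
pose F (x : R) : R := x ^+ 2 / 2.
have cF : continuous F.
  by move=> x; apply: cvgM; [exact: exprn_continuous|exact: cvg_cst].
rewrite integral_itv_bndo_bndc//.
rewrite (@continuous_FTC2 _ id F)//.
- by rewrite /F expr0n/= mul0r sube0.
- by move=> x; apply: continuous_subspaceT => z.
- split.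
  + by move=> x _; apply: derivableM => //; exact: exprn_derivable.
  + exact/cvg_at_right_filter/cF.
  + exact/cvg_at_left_filter/cF.
- move=> x _; rewrite derive1E deriveM// derive_cst scaler0 add0r.
  by rewrite exp_derive expr1 scaler_nat /GRing.scale/= -mulr_natr; field.
Qed.

(** Tonelli on the region [A]: for a fixed outcome, [t] runs from 0 up to the absolute value of the
    shrunk variable, and its integral is half the square. *)
Lemma shrink_second_moment r : 0 <= r ->
  ('E_P[fun w => (shrink r (X 0 w) ^+ 2)%R] = 2%:E * tail_moment X r)%E.
Proof.
move=> r0; pose GR := measurableTypeR R.
pose A := [set p : GR * Omega | p.1 + r < `|X 0 p.2|].
have mA : measurable A.
  rewrite -[A]setTI; apply: (measurable_fun_ltr (f := fun p : GR * Omega => p.1 + r)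
    (g := fun p : GR * Omega => `|X 0 p.2|)) => //.
  - exact: measurable_funD.
  - apply: measurableT_comp => //; exact: measurableT_comp.
(* The maximum with 0 makes the integrand nonnegative on the whole line and null for negative [t],
   so the half line disappears from the domain. *)
pose F (p : GR * Omega) : \bar R := (Num.max p.1 0 * \1_A p)%:E.
have mF : measurable_fun setT F.
  apply/measurable_EFinP/measurable_funM; last exact: measurable_indic.
  exact: measurable_maxr.
have F0 p : (0 <= F p)%E by rewrite lee_fin mulr_ge0// le_max lexx orbT.
have -> : tail_moment X r = (\int[lebesgue_measure]_t \int[P]_w F (t, w))%E.
  rewrite /tail_moment integral_mkcond; apply: eq_integral => t _.
  rewrite patchE; case: ifPn => [|].
    rewrite inE/= in_itv/= andbT => t0.
    pose B := [set w | t + r < `|X 0 w|].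
    have mB : measurable B.
      rewrite -[B]setTI; apply: (measurable_fun_ltr (f := cst (t + r))
        (g := fun w => `|X 0 w|)) => //.
      exact: measurableT_comp.
    transitivity (\int[P]_w (t%:E * (\1_B w)%:E))%E.
      rewrite ge0_integralZl_EFin//; last exact/measurable_EFinP/measurable_indic.
      by rewrite integral_indic// setIT.
    apply: eq_integral => w _; rewrite /F/= (max_idPl t0) EFinM; congr (_ * _)%E.
  rewrite notin_setE/= in_itv/= andbT => /negP; rewrite -ltNge => t0.
  rewrite /F/= (max_idPr (ltW t0)) integral0_eq// => w _.
  by rewrite mul0r.
have fub := (fubini_tonelli (m1 := lebesgue_measure) (m2 := P) F mF F0).
rewrite fub.
have inner w : (\int[lebesgue_measure]_t F (t, w) = (shrink r (X 0 w) ^+ 2 / 2)%:E)%E.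
  rewrite -real_normK ?num_real// -integral_id_itv//.
  rewrite [RHS]integral_mkcond; apply: eq_integral => t _; rewrite patchE /F/= indicE.
  have [t0|t0] := leP 0 t.
    case: ifPn; rewrite ?inE ?notin_setE/= in_itv/= t0/= shrink_tail//.
      by move=> h; rewrite mem_set// mulr1.
    by move=> h; rewrite memNset// mulr0.
  rewrite mul0r ifN// notin_setE/= in_itv/= => /andP[]; lra.
under eq_integral do rewrite inner.
rewrite unlock -ge0_integralZl_EFin//.
- by apply: eq_integral => w _; rewrite -EFinM; congr EFin; field.
- by move=> w _; rewrite lee_fin divr_ge0 ?sqr_ge0.
- apply/measurable_EFinP/measurable_funM => //; apply: measurable_funX.
  exact: (measurableT_comp (measurable_shrink r)).
Qed.

Hypothesis X_stationary : strictly_stationary X.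
Hypothesis G_pos_fin : forall r : R, 0 <= r -> (0 < tail_moment X r < +oo)%E.

Lemma integral_marginal k (h : R -> \bar R) : measurable_fun setT h ->
  (forall x, 0 <= h x)%E -> (\int[P]_w h (X k w) = \int[P]_w h (X 0 w))%E.
Proof.
move=> mh h0; pose F (t : 1.-tuple R) := h (tnth t ord0).
have mF : measurable_fun setT F by apply: measurableT_comp => //; exact: measurable_tnth.
have E a : (\int[P]_w h (X a w) = \int[distribution P (window X a 0)]_t F t)%E.
  rewrite ge0_integral_distribution//; last by move=> ?; exact: h0.
  by apply: eq_integral => w _; rewrite /F/= tnth_mktuple addr0.
rewrite !E; apply: eq_measure_integral => B mB _; exact: (X_stationary k 0 mB).
Qed.

Lemma cov_le_second_moment (f : Omega -> R) : f \in Lfun P 2%:E ->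
  cov P f f <= mean P (fun w => f w ^+ 2).
Proof.
move=> /(cov_le_mean_sqr 0) /le_trans; apply; rewrite le_eqVlt; apply/orP; left.
by apply/eqP; congr mean; apply/funext => w; rewrite subr0.
Qed.

Local Notation U r k := (fun w => shrink r (X k w)).
Local Notation G r := (fine (tail_moment X r)).

Lemma tail_moment_fin r : 0 <= r -> tail_moment X r \is a fin_num.
Proof. by move=> /G_pos_fin/andP[h1 h2]; rewrite ge0_fin_numE// ltW. Qed.

Lemma tail_moment_gt0 r : 0 <= r -> 0 < G r.
Proof. by move=> /G_pos_fin h; rewrite fine_gt0. Qed.

Lemma measurable_shrinkX r k : measurable_fun setT (U r k).
Proof. exact: (measurableT_comp (measurable_shrink r)). Qed.

Lemma shrink_Lfun2 r k : 0 <= r -> U r k \in Lfun P 2%:E.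
Proof.
move=> r0; apply: Lfun2_of_sqr; first exact: measurable_shrinkX.
have mh : measurable_fun setT (fun x : R => (shrink r x ^+ 2)%:E).
  by apply/measurable_EFinP; apply: (measurable_funX 2); exact: measurable_shrink.
have h0 (x : R) : (0%R <= (shrink r x ^+ 2)%:E)%E by rewrite lee_fin sqr_ge0.
rewrite unlock (integral_marginal k mh h0).
have := shrink_second_moment r0; rewrite unlock => ->.
by rewrite lte_mul_pinfty// ?lte_fin//; have /andP[] := G_pos_fin r0.
Qed.

Lemma mean_shrink_sqr r : 0 <= r -> mean P (fun w => shrink r (X 0 w) ^+ 2) = 2 * G r.
Proof.
by move=> r0; rewrite /mean shrink_second_moment// fineM// tail_moment_fin.
Qed.

Lemma tail_moment_le r r' : 0 <= r -> r <= r' -> G r' <= G r.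
Proof.
move=> r0 rr; have r'0 := le_trans r0 rr.
rewrite -(ler_pM2l (ltr0n R 2)) -!mean_shrink_sqr//.
apply: le_mean; try exact/Lfun2_mean_sqr/shrink_Lfun2.
move=> w; rewrite -[leLHS]real_normK ?num_real// -[leRHS]real_normK ?num_real//.
rewrite lerXn2r ?nnegrE// !norm_shrink// ge_max !le_max lexx orbT andbT.
by rewrite lerB.
Qed.

Lemma cov_shrink_le r : 0 <= r -> cov P (U r 0) (U r 0) <= 2 * G r.
Proof. by move=> r0; rewrite -mean_shrink_sqr//; apply/cov_le_second_moment/shrink_Lfun2. Qed.

(** The shrunk variable vanishes off [A], so Cauchy-Schwarz bounds its squared mean by P(A) times
    its second moment 2 G(r). Chebyshev with E X_0^2 = 2 G(0) gives P(A) <= 1/2, hence centering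
    removes at most half. *)
Lemma cov_shrink_ge r : 0 < r -> 4 * G 0 <= r ^+ 2 ->
  G r <= cov P (U r 0) (U r 0).
Proof.
move=> r_gt0 hr; have r0 := ltW r_gt0.
pose A := [set w | r < `|X 0 w|].
have mA : measurable A.
  rewrite -[A]setTI; apply: (measurable_fun_ltr (f := cst r) (g := fun w => `|X 0 w|)) => //.
  exact: measurableT_comp.
have b1 : bounded_rv (\1_A : Omega -> R).
  by split; [exact: measurable_indic|exists 1 => w; rewrite indicE; case: (_ \in _); rewrite ?normr1 ?normr0].
have := mean_CS (shrink_Lfun2 0 r0) (bounded_rv_Lfun2 P b1).
have -> : (fun w => shrink r (X 0 w) * \1_A w) = U r 0.
  apply/funext => w; rewrite indicE; case: (boolP (w \in A)) => wA; rewrite ?mulr1//.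
  rewrite mulr0 shrink_eq0//; move: wA; rewrite notin_setE /A/=.
  by move=> /negP; rewrite -leNgt.
have -> : (fun w => \1_A w ^+ 2) = (\1_A : Omega -> R).
  by apply/funext => w; rewrite indicE; case: (_ \in _); rewrite ?expr1n ?expr0n.
rewrite mean_shrink_sqr// => hU.
have r20 : 0 < r ^+ 2 by rewrite exprn_gt0.
have h1 : mean P (\1_A : Omega -> R) <= 2 * G 0 / r ^+ 2.
  rewrite mulrC -mean_shrink_sqr// -meanZ; last exact/Lfun2_mean_sqr/shrink_Lfun2.
  apply: le_mean; first exact: bounded_rv_Lfun1.
    have h := Lfun2_mean_sqr (Lfun2Z (r^-1) (shrink_Lfun2 0 (lexx 0))).
    rewrite (_ : (fun w => (r ^+ 2)^-1 * _) = (fun w => (r^-1 * shrink 0 (X 0 w)) ^+ 2))//.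
    by apply/funext => w; rewrite exprMn exprVn.
  move=> w; rewrite indicE; case: (boolP (w \in A)) => wA.
    rewrite mulrC ler_pdivlMr// mul1r -[leRHS]real_normK ?num_real// norm_shrink// subr0.
    rewrite lerXn2r ?nnegrE// ?le_max ?lexx ?orbT//.
    by move: wA; rewrite inE /A/= => /ltW ->.
  by rewrite mulr_ge0 ?invr_ge0 ?sqr_ge0.
have h2 : 2 * G 0 / r ^+ 2 <= 1 / 2 by rewrite ler_pdivrMr//; lra.
have UU := shrink_Lfun2 0 r0.
rewrite covE// -expr2.
have -> : mean P (fun w => shrink r (X 0 w) * shrink r (X 0 w)) = 2 * G r.
  by rewrite -mean_shrink_sqr//; congr mean; apply/funext => w; rewrite expr2.
have G0 := ltW (tail_moment_gt0 r0).
have := ler_wpM2l G0 (le_trans h1 h2); lra.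
Qed.

Hypothesis G_ratio : forall eps : R, 0 < eps -> G (r + eps) / G r @[r --> +oo] --> (0 : R).

Lemma tail_moment_ratio (e x : R) : 0 < e -> 0 < x ->
  exists B, forall r, B <= r -> 0 <= r -> G (r + e) <= x * G r.
Proof.
move=> e0 x0; have /cvgrPdist_lt/(_ x x0) := G_ratio e0.
move=> [B [_ hB]]; exists (B + 1) => r rB r0.
have /hB : B < r by lra.
rewrite sub0r normrN => /ltW /(le_trans (ler_norm _)).
by rewrite ler_pdivrMr// tail_moment_gt0.
Qed.

(** The ratio condition with step 1 eventually halves the tail moment on each unit step;
    monotonicity covers the levels in between. *)
Lemma tail_moment_cvg0 (x : R) : 0 < x -> exists B, forall r, B <= r -> 0 <= r -> G r <= x.
Proof.
move=> x0; have h : 0 < (1 / 2 : R) by lra.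
have [B0 hB0] := tail_moment_ratio ltr01 h.
pose B := Num.max B0 0; have B_ge0 : 0 <= B by rewrite /B le_max lexx orbT.
have step k : G (B + k%:R) <= G B / 2 ^+ k.
  elim: k => [|k IH]; first by rewrite addr0 expr0 divr1.
  rewrite -addn1 natrD addrA (le_trans (hB0 _ _ _))//.
  - by rewrite ler_wpDr// /B le_max lexx.
  - by rewrite addr_ge0.
  - by rewrite addn1 exprS invfM mulrCA mul1r ler_wpM2l.
have [k hk] := exp_ge_nat (G B / x) (ltr1n R 2).
exists (B + k%:R) => r Br r0; apply: le_trans (tail_moment_le _ Br) _.
  by rewrite addr_ge0.
apply: (le_trans (step k)).
by rewrite ler_pdivrMr ?exprn_gt0// mulrC -ler_pdivrMr.
Qed.

End shrunk_second_moment.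

(** The supremum of the levels with [1 <= s x] gives two things at once: [s r = 1] by continuity,
    and [x <= r] for all such levels, which later drives the levels to infinity. If there is no such
    level, any positive [r] will do. *)
Lemma last_crossing (R : realType) (s : R -> R) (L B : R) : 0 <= L ->
  (forall x y, 0 <= x -> 0 <= y -> `|s x - s y| <= L * `|x - y|) ->
  (forall x, B <= x -> 0 <= x -> s x < 1) ->
  exists2 r : R, 0 < r & forall x, 0 < x -> 1 <= s x -> x <= r /\ s r = 1.
Proof.
move=> L0 sL sB.
pose E := [set x : R | 0 < x /\ 1 <= s x].
have [E0|nE] := pselect (E !=set0); last first.
  by exists 1 => // x x0 sx; exfalso; apply: nE; exists x.
have Eub x : E x -> x <= B.
  by move=> [x0 sx]; rewrite leNgt; apply/negP => /ltW/sB/(_ (ltW x0)); rewrite ltNge sx.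
have supE : has_sup E by split => //; exists B => x; exact: Eub.
have le_sup x : E x -> x <= sup E by move=> Ex; exact: (ub_le_sup supE.2).
have [x0 [x0_gt0 sx0]] := E0.
have r_gt0 : 0 < sup E by rewrite (lt_le_trans x0_gt0)// le_sup.
exists (sup E) => // x xgt0 sx; split; first exact: le_sup.
have L1 : 0 < L + 1 by rewrite ltr_wpDl.
apply/eqP; rewrite eq_le; apply/andP; split.
  rewrite leNgt; apply/negP => sr.
  pose e := (s (sup E) - 1) / (L + 1).
  have e0 : 0 < e by rewrite /e divr_gt0// subr_gt0.
  have re0 : 0 < sup E + e by rewrite addr_gt0.
  have := sL _ _ (ltW r_gt0) (ltW re0).
  rewrite opprD addrA subrr add0r normrN (gtr0_norm e0) => hn; have h := le_trans (ler_norm _) hn.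
  have Le : L * e <= s (sup E) - 1.
    rewrite /e mulrA ler_pdivrMr// mulrC ler_wpM2l ?lerDl//.
    by rewrite subr_ge0 ltW.
  have : E (sup E + e) by split => //; lra.
  by move=> /le_sup; lra.
apply/ler_addgt0Pr => e e0.
have d0 : 0 < e / (L + 1) by rewrite divr_gt0.
have [y [y0 sy] hy] := sup_adherent d0 supE.
have yr : y <= sup E by apply: le_sup.
have := sL _ _ (ltW y0) (ltW r_gt0).
rewrite [X in _ * X]distrC [X in _ * X]ger0_norm ?subr_ge0// => hn; have h := le_trans (ler_norm _) hn.
have : L * (sup E - y) <= e; last by lra.
apply: (@le_trans _ _ ((L + 1) * (e / (L + 1)))); last by rewrite mulrC divfK// gt_eqF.
apply: ler_pM => //; rewrite ?subr_ge0 ?lerDl//; lra.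
Qed.

(** * Standard deviations and the choice of the shrinking levels *)

Section standard_deviation.
Context {d : measure_display} {Omega : measurableType d} {R : realType}.
Variable P : probability Omega R.
Implicit Types f g : Omega -> R.

Definition sd f : R := Num.sqrt (cov P f f).

Lemma sd_ge0 f : 0 <= sd f. Proof. exact: sqrtr_ge0. Qed.

Lemma sqr_sd f : sd f ^+ 2 = cov P f f.
Proof. by rewrite sqr_sqrtr// cov_ge0. Qed.

Lemma cov_sqrD f g : f \in Lfun P 2%:E -> g \in Lfun P 2%:E ->
  cov P (fun w => f w + g w) (fun w => f w + g w) =
  cov P f f + 2 * cov P f g + cov P g g.
Proof.
move=> f2 g2; have fg2 := Lfun2D f2 g2; rewrite covDl//.
rewrite (covC P f) (covC P g) !covDl// (covC P g f); ring.
Qed.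

Lemma sd_sub_le f g : f \in Lfun P 2%:E -> g \in Lfun P 2%:E ->
  sd f - sd g <= sd (fun w => f w - g w).
Proof.
move=> f2 g2; have h2 := Lfun2B f2 g2.
rewrite lerBlDl -(@ler_pXn2r _ 2)// ?nnegrE ?addr_ge0 ?sd_ge0// sqrrD !sqr_sd.
set h := fun w => f w - g w.
have -> : f = (fun w => g w + h w) by apply/funext => w; rewrite /h addrC subrK.
rewrite cov_sqrD//.
have := le_trans (ler_norm _) (cov_CS g2 h2); rewrite -/(sd g) -/(sd h); lra.
Qed.

Lemma sd_dist_le f g : f \in Lfun P 2%:E -> g \in Lfun P 2%:E ->
  `|sd f - sd g| <= sd (fun w => f w - g w).
Proof.
move=> f2 g2; rewrite ler_norml sd_sub_le// andbT lerNl opprB.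
apply: (le_trans (sd_sub_le g2 f2)); rewrite le_eqVlt; apply/orP; left; apply/eqP.
have -> : (fun w => g w - f w) = (fun w => -1 * (f w - g w)).
  by apply/funext => w; rewrite mulN1r opprB.
have h2 := Lfun2B f2 g2.
have hN : (fun w => -1 * (f w - g w)) \in Lfun P 2%:E by exact: Lfun2Z.
by rewrite /sd covZl// (covC P _ (fun w => -1 * _)) covZl// mulrA mulrNN !mul1r.
Qed.

Lemma sd_bounded f M : measurable_fun setT f -> (forall w, `|f w| <= M) -> 0 <= M -> sd f <= M.
Proof.
move=> mf fM M0; have bf : bounded_rv f by split=> //; exists M.
rewrite -(@ler_pXn2r _ 2)// ?nnegrE ?sd_ge0// sqr_sd.
apply: (le_trans (cov_le_second_moment (bounded_rv_Lfun2 P bf))).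
rewrite -[leRHS](mean_cst P); apply: le_mean.
- exact/bounded_rv_Lfun1/bounded_rvX.
- exact/bounded_rv_Lfun1/bounded_rv_cst.
- by move=> w /=; rewrite -[leLHS]real_normK ?num_real// lerXn2r// ?nnegrE.
Qed.

End standard_deviation.

Section shrinking_sequence.
Context {d : measure_display} {Omega : measurableType d} {R : realType}.
Variables (P : probability Omega R) (X : int -> {RV P >-> R}).
Hypothesis X_stationary : strictly_stationary X.
Hypothesis G_pos_fin : forall r : R, 0 <= r -> (0 < tail_moment X r < +oo)%E.
Local Notation G r := (fine (tail_moment X r)).
Hypothesis G_ratio : forall eps : R, 0 < eps -> G (r + eps) / G r @[r --> +oo] --> (0 : R).
Hypothesis X_variance : linear_variance X.

Local Notation S r n := (lin X (shrink r) 0 (block 1 n)).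

Let U2 r k (r0 : 0 <= r) : (fun w => shrink r (X k w)) \in Lfun P 2%:E :=
  shrink_Lfun2 X_stationary G_pos_fin k r0.

Lemma shrunk_sum_Lfun2 r n : 0 <= r -> S r n \in Lfun P 2%:E.
Proof. by move=> r0; apply: lin_Lfun2 => k; exact: U2. Qed.

Lemma shrink_form1 r : lin_form X (shrink r) 1 1 =
  cov P (fun w => shrink r (X 0 w)) (fun w => shrink r (X 0 w)).
Proof. by rewrite /lin_form; congr (cov P _ _); apply/funext => w; rewrite lin1. Qed.

Lemma sqr_sd_shrunk_sum r n : 0 <= r ->
  sd P (S r n) ^+ 2 = form_norm (lin_form X (shrink r)) (block 0 n) ^+ 2.
Proof.
move=> r0; have hB := lin_form_stationary X_stationary (measurable_shrink r) (fun k => U2 k r0).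
by rewrite sqr_sd -(form_norm_block hB 1) (form_normE hB).
Qed.

Lemma sd_shrunk_sum_lipschitz n r r' : 0 <= r -> 0 <= r' ->
  `|sd P (S r n) - sd P (S r' n)| <= n%:R * `|r - r'|.
Proof.
move=> r0 r'0; apply: (le_trans (sd_dist_le (shrunk_sum_Lfun2 n r0) (shrunk_sum_Lfun2 n r'0))).
apply: sd_bounded => [|w|]; last by rewrite mulr_ge0.
  by apply: measurable_funB; apply: measurable_lin; exact: measurable_shrink.
rewrite !lin_block -sumrB (le_trans (ler_norm_sum _ _ _))//.
rewrite mulr_natl -[n in leRHS]card_ord -sumr_const; apply: ler_sum => i _.
exact: shrink_lipschitz.
Qed.

(** For fixed [n] the variance is at most a multiple of [n%:R * G r], which falls below 1 for large
    [r], so a last crossing of 1 is available. At a fixed level [K'] it is at least a multiple of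
    [n%:R * G K'], which exceeds 1 for large [n], so the crossing exists and lies beyond [K']. *)
Lemma shrinking_levels : exists r : nat -> R,
  [/\ forall n, 0 < r n,
      forall K : R, exists N, forall n, (N <= n)%N -> K <= r n &
      exists N, forall n, (N <= n)%N -> sd P (S (r n) n) = 1].
Proof.
have [C [c [C0 c0] [N0 hv]]] := X_variance.
have C_ge0 := ltW C0.
have bounds r n : 0 <= r -> sd P (S r n) ^+ 2 <= C * (n%:R * (2 * G r)) /\
    ((N0 <= n)%N -> 0 < r -> 4 * G 0 <= r ^+ 2 -> c * (n%:R * G r) <= sd P (S r n) ^+ 2).
  move=> r0; have [h1 h2] := hv _ (measurable_shrink r) (fun k => U2 k r0) n.
  rewrite sqr_sd_shrunk_sum//; split.
    apply: (le_trans h1); rewrite shrink_form1 ler_wpM2l// ler_wpM2l//.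
    exact: (cov_shrink_le X_stationary G_pos_fin).
  move=> Nn r_gt0 hr; apply: le_trans (h2 Nn).
  rewrite shrink_form1 ler_wpM2l ?(ltW c0)// ler_wpM2l//.
  exact: (cov_shrink_ge X_stationary G_pos_fin).
have level n : exists r : R, 0 < r /\ forall x, 0 < x -> 1 <= sd P (S x n) ->
    x <= r /\ sd P (S r n) = 1.
  pose x := (2 * (2 * C * n%:R + 1))^-1.
  have D0 : 0 < 2 * (2 * C * n%:R + 1).
    by rewrite mulr_gt0// ltr_wpDl// !mulr_ge0.
  have x0 : 0 < x by rewrite /x invr_gt0.
  have [B hB] := tail_moment_cvg0 X_stationary G_pos_fin G_ratio x0.
  have sB r : B <= r -> 0 <= r -> sd P (S r n) < 1.
    move=> Br r0; rewrite -(@ltr_pXn2r _ 2)// ?nnegrE ?sd_ge0// expr1n.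
    apply: (le_lt_trans (bounds r n r0).1).
    apply: (@le_lt_trans _ _ (C * (n%:R * (2 * x)))).
      by rewrite ler_wpM2l// ler_wpM2l// ler_wpM2l// hB.
    have -> : C * (n%:R * (2 * x)) = (2 * C * n%:R) / (2 * (2 * C * n%:R + 1)).
      by rewrite /x; ring.
    rewrite ltr_pdivrMr// mul1r; have : 0 <= 2 * C * n%:R by rewrite !mulr_ge0.
    lra.
  have [r r0 hr] := last_crossing (ler0n R n) (sd_shrunk_sum_lipschitz n) sB.
  by exists r.
have [r hr] := choice level.
have r_large K : exists N, forall n, (N <= n)%N -> K <= r n /\ sd P (S (r n) n) = 1.
  (* Being at least 1 and at least [4 * G 0], the level [K'] satisfies the condition of
     [cov_shrink_ge]. *)
  pose K' := Num.max (Num.max K 1) (4 * G 0).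
  have K'1 : 1 <= K' by rewrite /K' !le_max lexx orbT.
  have KK' : K <= K' by rewrite /K' !le_max lexx.
  have K'G : 4 * G 0 <= K' by rewrite /K' !le_max lexx orbT.
  have K'0 : 0 < K' by apply: lt_le_trans K'1.
  have hK : 4 * G 0 <= K' ^+ 2.
    by rewrite (le_trans K'G)// expr2 ler_peMl// ltW.
  have cG : 0 < c * G K' by rewrite mulr_gt0// (tail_moment_gt0 G_pos_fin)// ltW.
  exists (maxn N0 (Num.truncn (c * G K')^-1).+1) => n; rewrite geq_max => /andP[Nn nn].
  have := (bounds K' n (ltW K'0)).2 Nn K'0 hK => hb.
  have sd1 : 1 <= sd P (S K' n).
    rewrite -(@ler_pXn2r _ 2)// ?nnegrE ?sd_ge0// expr1n; apply: le_trans hb.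
    rewrite mulrCA -ler_pdivrMr// mul1r.
    by apply/ltW/(lt_le_trans (truncnS_gt _)); rewrite ler_nat.
  by have [h1 h2] := (hr n).2 _ K'0 sd1; split=> //; exact: le_trans h1.
exists r; split=> [n|K|]; first by have [] := hr n.
- by have [N hN] := r_large K; exists N => n /hN[].
- by have [N hN] := r_large 0; exists N => n /hN[].
Qed.

End shrinking_sequence.

(** * Characteristic functions of the centered shrunk sums *)

Section shrunk_sum_cf.
Context {d : measure_display} {Omega : measurableType d} {R : realType}.
Variables (P : probability Omega R) (X : int -> {RV P >-> R}).
Hypothesis X_stationary : strictly_stationary X.
Hypothesis G_pos_fin : forall r : R, 0 <= r -> (0 < tail_moment X r < +oo)%E.
Local Notation G r := (fine (tail_moment X r)).
Hypothesis G_ratio : forall eps : R, 0 < eps -> G (r + eps) / G r @[r --> +oo] --> (0 : R).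
Hypothesis X_variance : linear_variance X.
Hypothesis X_clt : bounded_block_clt X.

Local Notation U r k := (fun w => shrink r (X k w)).
Local Notation S r n := (lin X (shrink r) 0 (block 1 n)).
Local Notation m r := (mean P (U r 0)).

Let U2 r k (r0 : 0 <= r) : U r k \in Lfun P 2%:E :=
  shrink_Lfun2 X_stationary G_pos_fin k r0.
Let S2 r n (r0 : 0 <= r) : S r n \in Lfun P 2%:E :=
  shrunk_sum_Lfun2 X_stationary G_pos_fin n r0.

Lemma mean_marginal (psi : R -> R) k : measurable_fun setT psi ->
  (forall k, (fun w => psi (X k w)) \in Lfun P 1) ->
  mean P (fun w => psi (X k w)) = mean P (fun w => psi (X 0 w)).
Proof. by move=> mpsi; exact: (mean_psi_shift X_stationary k mpsi (@measurable_id _ _ setT)). Qed.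

Lemma mean_shrunk_sum r n : 0 <= r -> mean P (S r n) = n%:R * m r.
Proof.
move=> r0; rewrite (_ : S r n = fun w => \sum_(i < n) shrink r (X (0 + (1 + i)%N%:Z) w)); last first.
  by apply/funext => w; rewrite lin_block.
rewrite mean_sum; last by move=> i; exact/Lfun2_sub_Lfun1/U2.
rewrite (eq_bigr (fun=> m r)); first by rewrite sumr_const card_ord mulr_natl.
move=> i _; rewrite (mean_marginal _ (measurable_shrink r))// => k.
exact/Lfun2_sub_Lfun1/U2.
Qed.

Lemma centered_shrunk_sumE r n : centered_shrunk_sum X r n = fun w => S r n w - n%:R * m r.
Proof.
apply/funext => w; rewrite /centered_shrunk_sum lin_block; congr (_ - _).
by rewrite big_add1 big_mkord; apply: eq_bigr => i _; rewrite add0r.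
Qed.

Lemma centered_shrunk_sum_Lfun2 r n : 0 <= r -> centered_shrunk_sum X r n \in Lfun P 2%:E.
Proof. by move=> r0; rewrite centered_shrunk_sumE; apply: Lfun2B; [exact: S2|exact: Lfun2_cst]. Qed.

Lemma mean_centered_shrunk_sum r n : 0 <= r -> mean P (centered_shrunk_sum X r n) = 0.
Proof.
move=> r0; rewrite centered_shrunk_sumE meanB ?mean_cst ?mean_shrunk_sum ?subrr//.
- exact/Lfun2_sub_Lfun1/S2.
- exact/Lfun2_sub_Lfun1/Lfun2_cst.
Qed.

Lemma mean_sqr_centered_shrunk_sum r n : 0 <= r ->
  mean P (fun w => centered_shrunk_sum X r n w ^+ 2) = sd P (S r n) ^+ 2.
Proof.
move=> r0; rewrite sqr_sd cov_centered mean_shrunk_sum//; congr mean.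
by apply/funext => w; rewrite centered_shrunk_sumE expr2.
Qed.

Lemma sd_centered_shrunk_sum r n : 0 <= r ->
  sd P (centered_shrunk_sum X r n) = sd P (S r n).
Proof.
move=> r0; rewrite {1}/sd; have Y2 := centered_shrunk_sum_Lfun2 n r0.
rewrite covE// mean_centered_shrunk_sum// mul0r subr0.
by rewrite -[RHS]ger0_norm ?sd_ge0// -sqrtr_sqr -mean_sqr_centered_shrunk_sum.
Qed.

Section band.
Variables (r eps : R).
Hypothesis r0 : 0 <= r.
Hypothesis eps0 : 0 <= eps.

(** The signed overshoot of [x] beyond level [r], cut at height [eps] and centered for the law of
    [X 0]. It is the bounded function to which [bounded_block_clt] is applied. *)
Definition band (x : R) := shrink r x - shrink (r + eps) x - (m r - m (r + eps)).

Let re0 : 0 <= r + eps. Proof. by rewrite addr_ge0. Qed.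

Lemma measurable_band : measurable_fun setT band.
Proof.
by apply: measurable_funB => //; apply: measurable_funB; exact: measurable_shrink.
Qed.

Let UB1 k : (fun w => U r k w - U (r + eps) k w) \in Lfun P 1.
Proof. by apply/Lfun2_sub_Lfun1/Lfun2B; exact: U2. Qed.

Let norm_diff x : `|shrink r x - shrink (r + eps) x| <= eps.
Proof.
by rewrite (le_trans (shrink_lipschitz _ r0 re0))// opprD addrA subrr add0r normrN ger0_norm.
Qed.

Lemma norm_band x : `|band x| <= 2 * eps.
Proof.
rewrite /band (le_trans (ler_normB _ _))// mulr_natl mulr2n lerD//.
rewrite -meanB; [|exact/Lfun2_sub_Lfun1/U2|exact/Lfun2_sub_Lfun1/U2].
apply: mean_bound => [|w]; last exact: norm_diff.
by apply: measurable_funB; exact: measurable_shrinkX.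
Qed.

Lemma mean_band k : mean P (fun w => band (X k w)) = 0.
Proof.
rewrite (mean_marginal _ measurable_band); last first.
  move=> j; apply/Lfun2_sub_Lfun1.
  exact: (bounded_psi_Lfun2 X j measurable_band norm_band).
rewrite /band meanB ?mean_cst; [|exact: UB1|exact/Lfun2_sub_Lfun1/Lfun2_cst].
rewrite meanB ?subrr//; exact/Lfun2_sub_Lfun1/U2.
Qed.

Lemma band_form : lin_form X band 1 1 <= 2 * G r.
Proof.
rewrite /lin_form.
have -> : lin X band 0 1 = fun w => band (X 0 w) by apply/funext => w; rewrite lin1.
apply: (le_trans (cov_le_mean_sqr (- (m r - m (r + eps)))
  (bounded_psi_Lfun2 X 0 measurable_band norm_band))).
rewrite -(mean_shrink_sqr G_pos_fin r0); apply: le_mean.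
- rewrite (_ : (fun w => _) = (fun w => (U r 0 w - U (r + eps) 0 w) ^+ 2)).
    by apply/Lfun2_mean_sqr/Lfun2B; exact: U2.
  by apply/funext => w; rewrite /band opprK subrK.
- exact/Lfun2_mean_sqr/U2.
- by move=> w; rewrite /band opprK subrK; apply: shrink_sub_sqr => //; rewrite lerDl.
Qed.

Lemma band_sum n w : centered_shrunk_sum X r n w - lin X band 0 (block 1 n) w =
  centered_shrunk_sum X (r + eps) n w.
Proof.
rewrite !centered_shrunk_sumE !lin_block /band sumrB sumr_const card_ord sumrB.
rewrite -[_ *+ n]mulr_natl; ring.
Qed.

End band.

(** The centered sum is the band sum plus the centered sum at a slightly higher level. The ratio
    condition makes the variance of the latter small next to the total, which is 1, so the band sum
    has variance close to 1 and its approximate normality passes to the whole. *)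
Lemma shrunk_sum_cf (r : nat -> R) :
  (forall n, 0 < r n) ->
  (forall K : R, exists N, forall n, (N <= n)%N -> K <= r n) ->
  (exists N, forall n, (N <= n)%N -> sd P (S (r n) n) = 1) ->
  forall t e : R, 0 < e -> exists N, forall n, (N <= n)%N ->
    `|mean P (fun w => cos (t * centered_shrunk_sum X (r n) n w)) - expR (- (t ^+ 2 / 2))| <= e /\
    `|mean P (fun w => sin (t * centered_shrunk_sum X (r n) n w))| <= e.
Proof.
move=> r_gt0 r_large [N1 r_sd] t e e0.
have [C [c [C0 c0] [N0 hv]]] := X_variance.
have C_ge0 := ltW C0; have c_ge0 := ltW c0.
have T0 : 0 <= t ^+ 2 := sqr_ge0 t.
have D0 : 0 < `|t| + 2 * t ^+ 2 + 1 by rewrite ltr_wpDl// addr_ge0// mulr_ge0.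
(* [b] will bound the standard deviation of the remainder. Discarding the remainder moves the cosine
   and sine means by at most |t| b and the Gaussian exponent by at most 2 t^2 b. *)
have [b b0 [b1 hb]] : exists2 b : R, 0 < b & b <= 1 /\ (`|t| + 2 * t ^+ 2) * b <= e / 2.
  exists (Num.min 1 (e / 2 / (`|t| + 2 * t ^+ 2 + 1))).
    by rewrite lt_min ltr01 !divr_gt0.
  split; first by rewrite ge_min lexx.
  apply: (@le_trans _ _ ((`|t| + 2 * t ^+ 2 + 1) * (e / 2 / (`|t| + 2 * t ^+ 2 + 1)))).
    apply: ler_pM => //.
    - by rewrite addr_ge0// mulr_ge0.
    - by rewrite le_min ler01 !divr_ge0// ltW.
    - by rewrite lerDl.
    - by rewrite ge_min lexx orbT.
  by rewrite mulrC divfK// gt_eqF.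
have b_ge0 := ltW b0.
(* With this ratio the upper variance bound of the remainder equals [b ^+ 2 * (c * (n%:R * G r))],
   and the second factor is at most 1 because it bounds the unit variance from below. *)
pose x := b ^+ 2 * c / (2 * C).
have x0 : 0 < x by rewrite /x divr_gt0 ?mulr_gt0 ?exprn_gt0.
have C00 : 0 < 2 / c by rewrite divr_gt0.
have e20 : 0 < e / 2 by rewrite divr_gt0.
have [eps eps0 [N2 hclt]] := X_clt t C00 e20.
have eps20 : 0 < eps / 2 by rewrite divr_gt0.
have eps2_ge0 := ltW eps20.
have [B hB] := tail_moment_ratio G_pos_fin G_ratio eps20 x0.
have [N3 hN3] := r_large (Num.max B (Num.max 1 (4 * G 0))).
exists (maxn (maxn N0 N1) (maxn N2 N3)) => n.
rewrite !geq_max => /andP[/andP[n0 n1] /andP[n2 n3]].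
have rn0 := ltW (r_gt0 n); have {}hN3 := hN3 n n3; have sd1 := r_sd n n1.
move: (r n) (r_gt0 n) rn0 hN3 sd1 => {r_gt0 r_large r_sd r} r r_gt0 r0.
rewrite !ge_max => /andP[rB /andP[r1 rG]] sd1.
have re0 : 0 <= r + eps / 2 by rewrite addr_ge0.
have nG : c * (n%:R * G r) <= 1.
  have [_ /(_ n0)] := hv _ (measurable_shrink r) (fun k => U2 k r0) n.
  rewrite -(sqr_sd_shrunk_sum X_stationary G_pos_fin)// sd1 expr1n; apply: le_trans.
  rewrite ler_wpM2l// ler_wpM2l// shrink_form1.
  apply: (cov_shrink_ge X_stationary G_pos_fin) => //.
  by rewrite (le_trans rG)// expr2 ler_peMl.
pose Y := centered_shrunk_sum X r n; pose A := lin X (band r (eps / 2)) 0 (block 1 n).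
have hYA w : Y w - A w = centered_shrunk_sum X (r + eps / 2) n w by exact: band_sum.
have mb := measurable_band r (eps / 2).
have nb z : `|band r (eps / 2) z| <= eps.
  by apply: (le_trans (norm_band r0 eps2_ge0 z)); rewrite mulrC divfK.
have psi2 k := bounded_psi_Lfun2 X k mb nb.
have A2 : A \in Lfun P 2%:E by exact: lin_Lfun2.
have Y2 : Y \in Lfun P 2%:E by exact: centered_shrunk_sum_Lfun2.
have sdB : sd P (S (r + eps / 2) n) <= b.
  rewrite -(@ler_pXn2r _ 2)// ?nnegrE ?sd_ge0//.
  rewrite (sqr_sd_shrunk_sum X_stationary G_pos_fin)//.
  have [/le_trans h _] := hv _ (measurable_shrink (r + eps / 2)) (fun k => U2 k re0) n.
  apply: h; rewrite shrink_form1.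
  apply: (@le_trans _ _ (C * (n%:R * (2 * (x * G r))))).
    rewrite ler_wpM2l// ler_wpM2l//.
    apply: (le_trans (cov_shrink_le X_stationary G_pos_fin re0)).
    by rewrite ler_wpM2l// hB.
  rewrite [leLHS](_ : _ = b ^+ 2 * (c * (n%:R * G r))); last first.
    by rewrite /x; field; rewrite gt_eqF.
  by rewrite -[leRHS]mulr1 ler_wpM2l ?sqr_ge0.
have meanB2 : Num.sqrt (mean P (fun w => (Y w - A w) ^+ 2)) <= b.
  rewrite (_ : (fun w => _) = fun w => centered_shrunk_sum X (r + eps / 2) n w ^+ 2).
    by rewrite mean_sqr_centered_shrunk_sum// sqrtr_sqr ger0_norm ?sd_ge0.
  by apply/funext => w; rewrite hYA.
have sdA : `|1 - sd P A| <= b.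
  have sdY : sd P Y = 1 by rewrite /Y sd_centered_shrunk_sum.
  rewrite -sdY; apply: (le_trans (sd_dist_le Y2 A2)).
  rewrite (_ : (fun w => _) = centered_shrunk_sum X (r + eps / 2) n).
    by rewrite sd_centered_shrunk_sum.
  by apply/funext => w; rewrite hYA.
have nC0 : n%:R * lin_form X (band r (eps / 2)) 1 1 <= 2 / c.
  rewrite ler_pdivlMr// (@le_trans _ _ (2 * (c * (n%:R * G r))))//; last first.
    by rewrite -[leRHS]mulr1 ler_wpM2l.
  rewrite [leRHS](_ : _ = n%:R * (2 * G r) * c); last by ring.
  by rewrite ler_wpM2r// ler_wpM2l// band_form.
have [_] := hclt n _ n2 mb nb (mean_band r0 eps2_ge0) nC0.
rewrite -/A => hA.
have hAc : `|mean P (fun w => cos (t * A w)) - expR (- (t ^+ 2 * cov P A A / 2))| <= e / 2.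
  rewrite -(@ler_pXn2r _ 2)// ?nnegrE// ?(ltW e20)// real_normK ?num_real//.
  by apply: le_trans hA; rewrite lerDl sqr_ge0.
have hAs : `|mean P (fun w => sin (t * A w))| <= e / 2.
  rewrite -(@ler_pXn2r _ 2)// ?nnegrE// ?(ltW e20)// real_normK ?num_real//.
  by apply: le_trans hA; rewrite lerDr sqr_ge0.
have lip (h : R -> R) : h = cos \/ h = sin ->
    `|mean P (fun w => h (t * Y w)) - mean P (fun w => h (t * A w))| <= `|t| * b.
  move=> /(cos_sin_facts t)[mh h1 hl].
  have bh (f : Omega -> R) : f \in Lfun P 2%:E -> bounded_rv (fun w => h (t * f w)).
    by move=> f2; apply: (bounded_rv_comp mh h1); exact: Lfun_measurable f2.
  apply: (le_trans (mean_lipschitz_close hl (normr_ge0 t) Y2 A2 (bh _ Y2) (bh _ A2))).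
  by rewrite ler_wpM2l.
have lc := lip cos (or_introl erefl); have ls := lip sin (or_intror erefl).
have hv1 : `|expR (- (t ^+ 2 * cov P A A / 2)) - expR (- (t ^+ 2 / 2))| <= 2 * t ^+ 2 * b.
  apply: (le_trans (dist_expRN_le _ _)).
  - by rewrite divr_ge0// mulr_ge0// cov_ge0.
  - by rewrite divr_ge0.
  have -> : t ^+ 2 * cov P A A / 2 - t ^+ 2 / 2 = t ^+ 2 / 2 * (cov P A A - 1) by ring.
  rewrite normrM ger0_norm ?divr_ge0//.
  (* [sd P A] is within [b <= 1] of 1, so its square is within [b * (2 + b)] of 1. *)
  have : `|cov P A A - 1| <= 3 * b.
    rewrite -sqr_sd; move: sdA; rewrite !ler_norml; have := sd_ge0 P A.
    move: (sd P A) => s s0 /andP[h1 h2]; apply/andP; split; nra.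
  move=> /(ler_wpM2l T0); move: (mulr_ge0 T0 b_ge0); lra.
split.
  have := ler_normD (mean P (fun w => cos (t * Y w)) - mean P (fun w => cos (t * A w)))
    (mean P (fun w => cos (t * A w)) - expR (- (t ^+ 2 * cov P A A / 2)) +
     (expR (- (t ^+ 2 * cov P A A / 2)) - expR (- (t ^+ 2 / 2)))).
  have := ler_normD (mean P (fun w => cos (t * A w)) - expR (- (t ^+ 2 * cov P A A / 2)))
     (expR (- (t ^+ 2 * cov P A A / 2)) - expR (- (t ^+ 2 / 2))).
  rewrite !addrA !subrK -/Y; lra.
have := ler_normD (mean P (fun w => sin (t * Y w)) - mean P (fun w => sin (t * A w)))
  (mean P (fun w => sin (t * A w))).
have := mulr_ge0 T0 b_ge0; rewrite subrK -/Y; lra.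
Qed.

End shrunk_sum_cf.

(** * From characteristic functions to distribution functions *)

Fixpoint abs_poly (R : realType) (k : nat) (u : R) : R :=
  if k is k'.+1 then abs_poly k' u + (u ^+ 2 - abs_poly k' u ^+ 2) / 2 else 0.

(* The error e_k = |u| - p_k satisfies e_{k+1} = e_k (1 - (|u| + p_k)/2), hence
   e_k <= |u| (1 - |u|/2)^k. *)
Lemma abs_poly_le (R : realType) (k : nat) (u : R) : `|u| <= 1 ->
  0 <= `|u| - abs_poly k u <= 2 / k.+1%:R.
Proof.
move=> u1; set a := `|u| in u1 *; have a0 : 0 <= a by exact: normr_ge0.
have ua : u ^+ 2 = a ^+ 2 by rewrite real_normK ?num_real.
suff [p0 [h1 h2]] : 0 <= abs_poly k u /\ 0 <= a - abs_poly k u /\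
    (a - abs_poly k u) * (1 + k%:R * (a / 2)) <= a.
  rewrite h1/= ler_pdivlMr// -natr1.
  have [a_0|a_0] := eqVneq a 0.
    have -> : abs_poly k u = 0 by apply/eqP; rewrite eq_le p0 andbT; lra.
    by rewrite a_0 subrr mul0r.
  have ag : 0 < a by rewrite lt_def a_0.
  rewrite -(ler_pM2r ag); have : 0 <= (a - abs_poly k u) * (2 - a) by apply: mulr_ge0; lra.
  by move: h2; lra.
elim: k => [|k [p0 [h1 h2]]] /=.
  by rewrite subr0 mul0r addr0 mulr1.
rewrite ua; set p := abs_poly k u in p0 h1 h2 *.
have E : a - (p + (a ^+ 2 - p ^+ 2) / 2) = (a - p) * (1 - (a + p) / 2) by field.
have pa : p <= a by lra.
split; first by nra.
rewrite E; split; first by apply: mulr_ge0 => //; lra.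
apply: le_trans h2; rewrite -mulrA ler_wpM2l//.
have ka : 0 <= k%:R * (a / 2) by rewrite mulr_ge0// divr_ge0.
have pa0 : 0 <= (a + p) / 2 by rewrite divr_ge0// addr_ge0.
have a20 : 0 <= a / 2 by rewrite divr_ge0.
have := mulr_ge0 pa0 ka; have := mulr_ge0 pa0 a20.
rewrite -[k.+1%:R]natr1; lra.
Qed.

(** [h] is [v] clamped between 0 and 1, written with absolute values because these can be
    approximated by polynomials. [v] is affine in a cosine centered at the midpoint of [[-L, x]] and
    decreases from 1 to 0 between the distances [rho] and [rho + delta]; the half period [W] reaches
    past [L], so no second bump occurs there. *)
Lemma cos_bump (R : realType) (L x delta : R) : 0 < delta -> 0 < L -> - L < x ->
  exists a b s d : R, let v y := a + b * cos (s * y + d) in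
  let h y := (1 + `|v y| - `|v y - 1|) / 2 in
  [/\ forall y, 0 <= h y <= 1, forall y, - L <= y <= x -> h y = 1 &
      forall y, x + delta <= y <= L -> h y = 0].
Proof.
move=> d0 L0 Lx.
pose rho := (x + L) / 2; pose c := (x - L) / 2; pose W := rho + delta + 2 * L.
have rho0 : 0 < rho by rewrite /rho divr_gt0// -ltrBlDr sub0r.
have W0 : 0 < W by rewrite /W; lra.
pose s := pi / W; have s0 : 0 < s by rewrite /s divr_gt0// pi_gt0.
have sW : s * W = pi by rewrite /s divfK// gt_eqF.
have decr u v : 0 <= u -> u < v -> v <= W -> cos (s * v) < cos (s * u).
  move=> u0 uv vW; rewrite ltr_cos ?in_itv/=.
  - by rewrite ltr_pM2l.
  - by rewrite -sW ler_pM2l// (le_trans (ltW uv))// andbT mulr_ge0 ?(ltW s0).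
  - by rewrite -sW ler_pM2l// vW andbT mulr_ge0 ?(ltW s0)// (le_trans u0)// ltW.
pose A := cos (s * rho); pose B := cos (s * (rho + delta)).
have BA : 0 < A - B by rewrite subr_gt0 decr//; rewrite /W; lra.
exists (- B / (A - B)), (A - B)^-1, s, (- (s * c)) => v h.
have hv y : v y = (cos (s * (y - c)) - B) / (A - B) by rewrite /v mulrBr; ring.
split=> y.
- rewrite /h; case: (ger0P (v y)) => h1; case: (ger0P (v y - 1)) => h2; lra.
- move=> /andP[y1 y2].
  have : 1 <= v y.
    rewrite hv ler_pdivlMr// mul1r lerB//.
    have yc : `|y - c| <= rho by rewrite ler_norml /c /rho; lra.
    have -> : cos (s * (y - c)) = cos (s * `|y - c|).
      by rewrite -[in RHS](gtr0_norm s0) -normrM cos_norm.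
    move: yc; rewrite le_eqVlt => /predU1P[->//|yc].
    by rewrite ltW// decr//; rewrite /W; lra.
  rewrite /h => v1; rewrite !ger0_norm; lra.
- move=> /andP[y1 y2].
  have : v y <= 0.
    rewrite hv ler_pdivrMr// mul0r subr_le0.
    have : rho + delta <= y - c by rewrite /rho /c; lra.
    rewrite le_eqVlt => /predU1P[<-//|yc].
    by rewrite ltW// decr//; [lra|rewrite /W /c /rho; lra].
  rewrite /h => v0; rewrite !ler0_norm; lra.
Qed.

Section trigonometric_convergence.
Context {d : measure_display} {Omega : measurableType d} {R : realType}.
Variables (P : probability Omega R) (Y : nat -> Omega -> R).
Hypothesis mY : forall n, measurable_fun setT (Y n).
Variable mu : probability (measurableTypeR R) R.
Hypothesis hcos : forall t : R,
  mean P (fun w => cos (t * Y n w)) @[n --> \oo] --> mean mu (fun x => cos (t * x)).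
Hypothesis hsin : forall t : R,
  mean P (fun w => sin (t * Y n w)) @[n --> \oo] --> mean mu (fun x => sin (t * x)).

Definition mean_cvg (g : R -> R) : Prop :=
  mean P (fun w => g (Y n w)) @[n --> \oo] --> mean mu g.

Definition char_cvg (g : R -> R) : Prop :=
  forall t c : R, mean_cvg (fun x => g x * cos (t * x + c)).

(** Convergence of means is not stable under products. Multipliers that preserve convergence against
    all phases compose by definition, so they form an algebra, which is moreover closed under
    uniform limits. *)
Definition char_multiplier (f : R -> R) : Prop := bounded_rv f /\
  forall g : R -> R, bounded_rv g -> char_cvg g -> char_cvg (fun x => f x * g x).

Lemma bounded_rv_Y (g : R -> R) n : bounded_rv g -> bounded_rv (fun w => g (Y n w)).
Proof. by move=> [mg [M hM]]; exact: (bounded_rv_comp mg hM). Qed.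

Lemma bounded_rv_affcos (t c : R) : bounded_rv (fun x : R => cos (t * x + c)).
Proof.
split; last by exists 1 => x; exact: cos_max.
apply: measurableT_comp; first exact: continuous_measurable_fun (@continuous_cos R).
by apply: measurable_funD => //; exact: measurable_funM.
Qed.

Lemma mean_cvgD (f g : R -> R) : bounded_rv f -> bounded_rv g ->
  mean_cvg f -> mean_cvg g -> mean_cvg (fun x => f x + g x).
Proof.
move=> bf bg hf hg; rewrite /mean_cvg.
rewrite (meanD (bounded_rv_Lfun1 mu bf) (bounded_rv_Lfun1 mu bg)).
rewrite (_ : (fun n => _) = (fun n => mean P (fun w => f (Y n w)) + mean P (fun w => g (Y n w)))).
  exact: cvgD.
apply/funext => n; rewrite meanD//; exact/bounded_rv_Lfun1/bounded_rv_Y.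
Qed.

Lemma mean_cvgZ (k : R) (f : R -> R) : bounded_rv f ->
  mean_cvg f -> mean_cvg (fun x => k * f x).
Proof.
move=> bf hf; rewrite /mean_cvg (meanZ k (bounded_rv_Lfun1 mu bf)).
rewrite (_ : (fun n => _) = (fun n => k * mean P (fun w => f (Y n w)))).
  exact: cvgMr.
apply/funext => n; rewrite meanZ//; exact/bounded_rv_Lfun1/bounded_rv_Y.
Qed.

Lemma mean_cvg_ext (f g : R -> R) : f =1 g -> mean_cvg f -> mean_cvg g.
Proof. by move=> /funext ->. Qed.

Lemma mean_cvg_unif (f : R -> R) : bounded_rv f ->
  (forall e : R, 0 < e -> exists g, [/\ bounded_rv g, mean_cvg g & forall x, `|f x - g x| <= e]) ->
  mean_cvg f.
Proof.
move=> bf hf; apply/cvgrPdist_le => e e0.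
have e3 : 0 < e / 3 by rewrite divr_gt0.
have [g [bg /cvgrPdist_le/(_ _ e3) hg fg]] := hf _ e3.
near=> n.
have h1 : `|mean mu f - mean mu g| <= e / 3.
  rewrite -meanB; [|exact: bounded_rv_Lfun1|exact: bounded_rv_Lfun1].
  by apply: mean_bound => //; case: (bounded_rvB bf bg).
have h2 : `|mean P (fun w => f (Y n w)) - mean P (fun w => g (Y n w))| <= e / 3.
  rewrite -meanB; [|exact/bounded_rv_Lfun1/bounded_rv_Y|exact/bounded_rv_Lfun1/bounded_rv_Y].
  by apply: mean_bound => //; case: (bounded_rvB (bounded_rv_Y n bf) (bounded_rv_Y n bg)).
have h3 : `|mean mu g - mean P (fun w => g (Y n w))| <= e / 3 by near: n.
move: h1 h2 h3; rewrite !ler_norml => /andP[? ?] /andP[? ?] /andP[? ?].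
by apply/andP; split; lra.
Unshelve. all: by end_near. Qed.

Lemma char_multiplierD f g : char_multiplier f -> char_multiplier g ->
  char_multiplier (fun x => f x + g x).
Proof.
move=> [bf hf] [bg hg]; split; first exact: bounded_rvD.
move=> h bh hh t c; have bc := bounded_rv_affcos t c.
apply: (mean_cvg_ext _ (mean_cvgD _ _ (hf h bh hh t c) (hg h bh hh t c))).
- by move=> x; rewrite -mulrDl -mulrDl.
- by apply: bounded_rvM => //; exact: bounded_rvM.
- by apply: bounded_rvM => //; exact: bounded_rvM.
Qed.

Lemma char_multiplierM f g : char_multiplier f -> char_multiplier g ->
  char_multiplier (fun x => f x * g x).
Proof.
move=> [bf hf] [bg hg]; split; first exact: bounded_rvM.
move=> h bh hh t c; apply: (mean_cvg_ext _ (hf _ (bounded_rvM bg bh) (hg h bh hh) t c)) => x.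
by rewrite !mulrA.
Qed.

Lemma char_multiplier_cst k : char_multiplier (fun=> k).
Proof.
split; first exact: bounded_rv_cst.
move=> h bh hh t c; have bc := bounded_rv_affcos t c.
have := mean_cvgZ (k := k) (bounded_rvM bh bc) (hh t c).
apply: mean_cvg_ext.
by move=> x; rewrite mulrA.
Qed.

(** The product formula replaces a cosine of phase [t] by cosines of phases [s + t] and [s - t],
    which the hypothesis on [h] already covers. *)
Lemma char_multiplier_cos s c : char_multiplier (fun x => cos (s * x + c)).
Proof.
split; first exact: bounded_rv_affcos.
move=> h bh hh t c'.
have b1 t' c'' : bounded_rv (fun x => h x * cos (t' * x + c'')).
  by apply: bounded_rvM => //; exact: bounded_rv_affcos.
apply: (mean_cvg_ext _ (mean_cvgZ (k := 2^-1) _ (mean_cvgD _ _ (hh (s + t) (c + c')) (hh (s - t) (c - c'))))) => //.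
  move=> x.
  have -> : (s + t) * x + (c + c') = (s * x + c) + (t * x + c') by ring.
  have -> : (s - t) * x + (c - c') = (s * x + c) - (t * x + c') by ring.
  by rewrite cosD cosB; field.
exact: bounded_rvD.
Qed.

Lemma char_multiplier_unif (f : R -> R) : bounded_rv f ->
  (forall e : R, 0 < e -> exists g, char_multiplier g /\ forall x, `|f x - g x| <= e) ->
  char_multiplier f.
Proof.
move=> bf hf; split=> // h bh hh t c; have bc := bounded_rv_affcos t c.
apply: mean_cvg_unif => [|e e0].
  by apply: bounded_rvM => //; exact: bounded_rvM.
have [M hM] := bh.2; have M0 : 0 <= M := le_trans (normr_ge0 _) (hM 0).
have M1 : 0 < M + 1 by lra.
have e1 : 0 < e / (M + 1) by rewrite divr_gt0.
have [g [[bg hg] fg]] := hf _ e1.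
exists (fun x => g x * h x * cos (t * x + c)); split; last 1 first.
- move=> x; rewrite -mulrBl -mulrBl !normrM -[leRHS]mulr1; apply: ler_pM => //.
    apply: (@le_trans _ _ (e / (M + 1) * (M + 1))); last by rewrite divfK// gt_eqF.
    by apply: ler_pM => //; rewrite (le_trans (hM x))// lerDl.
  exact: cos_max.
- by apply: bounded_rvM => //; exact: bounded_rvM.
- exact: hg.
Qed.

(** Weierstrass argument: once scaled into the interval from -1 to 1, the absolute value is a
    uniform limit of the polynomials [abs_poly], and polynomials in [f] stay in the algebra. *)
Lemma char_multiplier_abs (f : R -> R) : char_multiplier f -> char_multiplier (fun x => `|f x|).
Proof.
move=> hf; have [bf _] := hf; have [M hM] := bf.2.
have M0 : 0 <= M := le_trans (normr_ge0 _) (hM 0).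
have M1 : 0 < M + 1 by lra.
have Mi : 0 < (M + 1)^-1 by rewrite invr_gt0.
pose u x := (M + 1)^-1 * f x.
have hu : char_multiplier u by apply: char_multiplierM => //; exact: char_multiplier_cst.
have u1 x : `|u x| <= 1.
  rewrite /u normrM gtr0_norm// mulrC ler_pdivrMr// mul1r (le_trans (hM x))// lerDl//.
have hp k : char_multiplier (fun x => abs_poly k (u x)).
  elim: k => [|k IH] /=; first exact: char_multiplier_cst.
  apply: char_multiplierD => //.
  apply: (@char_multiplierM _ (fun=> 2^-1)); last exact: char_multiplier_cst.
  apply: char_multiplierD; first exact: char_multiplierM.
  have -> : (fun x => - abs_poly k (u x) ^+ 2) = (fun x => -1 * (abs_poly k (u x) * abs_poly k (u x))).
    by apply/funext => x; rewrite mulN1r expr2.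
  by apply: char_multiplierM; [exact: char_multiplier_cst|exact: char_multiplierM].
have -> : (fun x => `|f x|) = (fun x => (M + 1) * `|u x|).
  by apply/funext => x; rewrite /u normrM gtr0_norm// mulVKf// gt_eqF.
apply: char_multiplierM; first exact: char_multiplier_cst.
apply: char_multiplier_unif => [|e e0]; first exact/bounded_rv_norm/hu.1.
exists (fun x => abs_poly (Num.truncn (2 / e)) (u x)); split=> // x.
have /andP[h1 h2] := abs_poly_le (Num.truncn (2 / e)) (u1 x).
rewrite ger0_norm// (le_trans h2)// ler_pdivrMr// mulrC -ler_pdivrMr//.
by apply/ltW; exact: truncnS_gt.
Qed.

(** The multiplier acts on the constant 1, whose convergence against all phases is what [hcos] and
    [hsin] provide. *)
Lemma char_multiplier_mean_cvg f : char_multiplier f -> mean_cvg f.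
Proof.
move=> [bf hf].
have b1 := bounded_rv_cst (Omega := R) (1 : R).
have h1 : char_cvg (fun=> 1).
  move=> t c.
  have bc : bounded_rv (fun x : R => cos (t * x)) by exact: bounded_rv_cos.
  have bs : bounded_rv (fun x : R => sin (t * x)) by exact: bounded_rv_sin.
  have h := mean_cvgD (bounded_rvZ (cos c) bc) (bounded_rvZ (- sin c) bs)
    (mean_cvgZ (k := cos c) bc (@hcos t)) (mean_cvgZ (k := - sin c) bs (@hsin t)).
  by apply: mean_cvg_ext h => x; rewrite mul1r cosD; ring.
apply: mean_cvg_ext (hf _ b1 h1 0 0) => x.
by rewrite mul0r addr0 cos0 !mulr1.
Qed.

Lemma bump_mean_cvg (a b s c : R) : let v y := a + b * cos (s * y + c) in
  mean_cvg (fun y => (1 + `|v y| - `|v y - 1|) / 2).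
Proof.
move=> v; apply: char_multiplier_mean_cvg.
have hv k : char_multiplier (fun y => v y + k).
  apply: char_multiplierD; last exact: char_multiplier_cst.
  apply: char_multiplierD; first exact: char_multiplier_cst.
  by apply: char_multiplierM; [exact: char_multiplier_cst|exact: char_multiplier_cos].
apply: char_multiplierM; last exact: char_multiplier_cst.
apply: char_multiplierD.
  apply: char_multiplierD; first exact: char_multiplier_cst.
  apply: char_multiplier_abs; have := hv 0; congr char_multiplier.
  by apply/funext => y; rewrite addr0.
have -> : (fun x => - `|v x - 1|) = (fun x => -1 * `|v x - 1|).
  by apply/funext => x; rewrite mulN1r.
apply: char_multiplierM; first exact: char_multiplier_cst.
exact/char_multiplier_abs/hv.
Qed.

End trigonometric_convergence.

(** Seen as a random variable on the limit law, the identity has the distribution function of that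
    law, so the limits of a [cdf] at infinity apply to it. *)
Definition real_id (R : realType) : measurableTypeR R -> R := fun x => x.

Lemma measurable_real_id (R : realType) : measurable_fun setT (@real_id R).
Proof. exact: measurable_id. Qed.

HB.instance Definition _ (R : realType) :=
  isMeasurableFun.Build _ _ _ _ (@real_id R) (@measurable_real_id R).

Section levy.
Context {d : measure_display} {Omega : measurableType d} {R : realType}.
Variables (P : probability Omega R) (Y : nat -> {RV P >-> R}).
Variable mu : probability (measurableTypeR R) R.
Hypothesis hcos : forall t : R,
  mean P (fun w => cos (t * Y n w)) @[n --> \oo] --> mean mu (fun x => cos (t * x)).
Hypothesis hsin : forall t : R,
  mean P (fun w => sin (t * Y n w)) @[n --> \oo] --> mean mu (fun x => sin (t * x)).
Hypothesis Y_second_moment : exists N, forall n, (N <= n)%N ->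
  (Y n : Omega -> R) \in Lfun P 2%:E /\ mean P (fun w => Y n w ^+ 2) <= 1.

Local Notation I x := (\1_[set` `]-oo, x]] : R -> R).
Local Notation F x := (fine (mu [set` `]-oo, x]%R])).

Lemma bounded_rv_I (x : R) : bounded_rv (I x).
Proof.
split; first by apply: measurable_indic; exact: measurable_itv.
by exists 1 => y; rewrite indicE; case: (_ \in _); rewrite ?normr1 ?normr0.
Qed.

Lemma mean_I (x : R) : mean mu (I x) = F x.
Proof. by rewrite /mean expectation_indic//; exact: measurable_itv. Qed.

Lemma mean_IY n (x : R) : mean P (fun w => I x (Y n w)) = fine (cdf (Y n) x).
Proof.
have mA : measurable (Y n @^-1` [set` `]-oo, x]]).
  by rewrite -[X in measurable X]setTI; exact: measurable_funPT.
by rewrite -[RHS]/(fine (P (Y n @^-1` _))) -expectation_indic.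
Qed.

Lemma in_I (x y : R) : I x y = (y <= x)%R%:R.
Proof. by rewrite indicE mem_setE in_itv. Qed.

Lemma law_tail (K e : R) : 0 < e -> exists2 L : R, 0 < L /\ K <= L &
  [/\ (L ^+ 2)^-1 <= e, F (- L) <= e & 1 - F L <= e].
Proof.
move=> e0.
have /fine_cvgP[_ /cvgrPdist_le/(_ e e0)[A1 [_ hA1]]] :=
  cvg_cdfNy0 (@real_id R : {RV mu >-> R}).
have /fine_cvgP[_ /cvgrPdist_le/(_ e e0)[A2 [_ hA2]]] :=
  cvg_cdfy1 (@real_id R : {RV mu >-> R}).
pose L := Num.max (Num.max K 1) (Num.max e^-1 (Num.max (1 - A1) (A2 + 1))).
have /= [LK L1 Le LA1 LA2] : [/\ K <= L, 1 <= L, e^-1 <= L, 1 - A1 <= L & A2 + 1 <= L].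
  by rewrite /L !le_max !lexx !orbT.
have L0 : 0 < L by lra.
exists L => //; split.
- by rewrite invf_ple ?posrE ?exprn_gt0// (le_trans Le)// expr2 ler_peMl// ltW.
- have /hA1/= : - L < A1 by lra.
  by rewrite sub0r normrN => h; exact: (le_trans (ler_norm _) h).
- have /hA2/= : A2 < L by lra.
  by move=> h; exact: (le_trans (ler_norm _) h).
Qed.

Lemma law_continuity (x e : R) : {for x, continuous (fun t : R => mu [set` `]-oo, t]%R])} ->
  0 < e -> exists2 del : R, 0 < del & `|F x - F (x + del)| <= e /\ `|F x - F (x - del)| <= e.
Proof.
move=> hx e0; have Ffin z : mu [set` `]-oo, z]%R] \is a fin_num by exact: fin_num_measure.
have : (fun t : R => mu [set` `]-oo, t]%R]) @ x --> (F x)%:E by rewrite fineK.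
move=> /fine_cvgP[_ /cvgrPdist_le/(_ e e0)] /nbhs_ballP[r /= r0 hr].
have r2 : 0 < r / 2 by rewrite divr_gt0.
exists (r / 2) => //; split; apply: hr; rewrite /ball/=.
  by rewrite opprD addrA subrr sub0r normrN gtr0_norm//; lra.
by rewrite opprB addrCA subrr addr0 gtr0_norm//; lra.
Qed.

(** The indicator of the half line is squeezed between the bumps [k] and [h], up to y^2 / L^2. This
    term covers the region beyond [L], where periodic bumps are uncontrolled, and its mean is small
    by the second moment bound. Continuity of the limit at [x] closes the gap of width [del]. *)
Lemma char_cvg_in_distribution : cvg_in_distribution P Y mu.
Proof.
move=> x hx.
have Ffin z : mu [set` `]-oo, z]%R] \is a fin_num by exact: fin_num_measure.
suff h : fine (cdf (Y n) x) @[n --> \oo] --> F x.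
  rewrite -[X in _ --> X]fineK//; apply/fine_cvgP; split=> //.
  by near=> n; rewrite /cdf fin_num_measure.
apply/cvgrPdist_le => e e0.
have e4 : 0 < e / 4 by rewrite divr_gt0.
have [del del0 [Fp Fm]] := law_continuity hx e4.
have [L [L0 Lx] [L2 FmL FL]] := law_tail (`|x| + del + 1) e4.
have absx : - `|x| <= x by have := ler_norm (- x); rewrite normrN; lra.
have Lx1 : - L < x by lra.
have Lx2 : - L < x - del by lra.
have bump z : - L < z -> exists2 h : R -> R, bounded_rv h /\ mean_cvg P Y mu h &
    [/\ forall y, 0 <= h y <= 1, forall y, - L <= y <= z -> h y = 1 &
      forall y, z + del <= y <= L -> h y = 0].
  move=> Lz; have [a [b [s [c]]]] := cos_bump del0 L0 Lz.
  move=> hh; exists (fun y => (1 + `|a + b * cos (s * y + c)| - `|a + b * cos (s * y + c) - 1|) / 2) => //.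
  split; last exact: (bump_mean_cvg (fun n => measurable_funPT (Y n)) hcos hsin
    (a := a) (b := b) (s := s) (c := c)).
  split; last first.
    by exists 1 => y; have [/(_ y)/andP[h0 h1] _ _] := hh; rewrite ger0_norm.
  have bv : bounded_rv (fun y : R => a + b * cos (s * y + c)).
    apply: bounded_rvD; first exact: bounded_rv_cst.
    by apply: bounded_rvZ; exact: bounded_rv_affcos.
  apply: (bounded_rvM _ (bounded_rv_cst _)).1.
  apply: bounded_rvB; first by apply: bounded_rvD; [exact: bounded_rv_cst|exact: bounded_rv_norm].
  by apply: bounded_rv_norm; apply: bounded_rvB => //; exact: bounded_rv_cst.
have [h [bh hh] [h01 h1 h0]] := bump x Lx1.
have [k [bk hk] [k01 k1 k0]] := bump (x - del) Lx2.
move/cvgrPdist_le: hh => /(_ _ e4) hh; move/cvgrPdist_le: hk => /(_ _ e4) hk.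
have [N hN] := Y_second_moment.
have L20 : 0 < L ^+ 2 by rewrite exprn_gt0.
have chebyshev y : L < `|y| -> 1 <= (L ^+ 2)^-1 * y ^+ 2.
  move=> Ly; rewrite mulrC ler_pdivlMr// mul1r -[leRHS]real_normK ?num_real//.
  by rewrite lerXn2r ?nnegrE ?(ltW L0)// ltW.
have cheb0 y : 0 <= (L ^+ 2)^-1 * y ^+ 2 by rewrite mulr_ge0 ?invr_ge0 ?sqr_ge0.
near=> n.
have [Y2 EY2] : (Y n : Omega -> R) \in Lfun P 2%:E /\ mean P (fun w => Y n w ^+ 2) <= 1.
  by apply: hN; near: n; exists N.
have YY := Lfun2_mean_sqr Y2.
have bI := bounded_rv_Lfun1 P (bounded_rv_Y (fun n => measurable_funPT (Y n)) n (bounded_rv_I x)).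
have bYh := bounded_rv_Lfun1 P (bounded_rv_Y (fun n => measurable_funPT (Y n)) n bh).
have bYk := bounded_rv_Lfun1 P (bounded_rv_Y (fun n => measurable_funPT (Y n)) n bk).
have cY1 : (fun w => (L ^+ 2)^-1 * Y n w ^+ 2) \in Lfun P 1.
  rewrite (_ : (fun w => _) = (fun w => (L^-1 * Y n w) ^+ 2)); first exact/Lfun2_mean_sqr/Lfun2Z.
  by apply/funext => w; rewrite exprMn exprVn.
have cY : mean P (fun w => (L ^+ 2)^-1 * Y n w ^+ 2) <= e / 4.
  by rewrite meanZ// (le_trans _ L2)// -[leRHS]mulr1 ler_wpM2l// invr_ge0 ltW.
have up : fine (cdf (Y n) x) <= mean P (fun w => h (Y n w)) + e / 4.
  rewrite -mean_IY; apply: (@le_trans _ _ (mean P (fun w => h (Y n w) + (L ^+ 2)^-1 * Y n w ^+ 2))).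
    apply: le_mean => // [|w]; first exact: (rpredD bYh cY1).
    rewrite in_I; case: (lerP (Y n w) x) => hy.
      case: (lerP (- L) (Y n w)) => hL; first by rewrite h1 ?hL// lerDl.
      have := chebyshev (Y n w); rewrite ltr_normr ltrNr hL orbT => /(_ isT).
      by have /andP[h2 _] := h01 (Y n w); rewrite mulr1n; lra.
    by rewrite addr_ge0//; case/andP: (h01 (Y n w)).
  by rewrite meanD// lerD2l.
have lo : mean P (fun w => k (Y n w)) <= fine (cdf (Y n) x) + e / 4.
  rewrite -mean_IY; apply: (@le_trans _ _ (mean P (fun w => I x (Y n w) + (L ^+ 2)^-1 * Y n w ^+ 2))).
    apply: le_mean => // [|w]; first exact: (rpredD bI cY1).
    have /andP[k2 k3] := k01 (Y n w); have := cheb0 (Y n w).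
    rewrite in_I; case: (lerP (Y n w) x) => hy; first by move=> ?; rewrite ler_wpDr.
    case: (lerP (Y n w) L) => hL ?.
      by rewrite k0 ?addr_ge0// subrK hL ltW.
    have := chebyshev (Y n w); rewrite ltr_normr hL/= => /(_ isT).
    by rewrite add0r => /(le_trans k3).
  by rewrite meanD// lerD2l.
have muI z := bounded_rv_Lfun1 mu (bounded_rv_I z).
have up' : mean mu h <= F (x + del) + (1 - F L).
  rewrite -!mean_I -[X in _ + (X - _)](mean_cst mu) -meanB//; last exact/bounded_rv_Lfun1/bounded_rv_cst.
  have b2 := bounded_rv_Lfun1 mu (bounded_rvB (bounded_rv_cst (1 : R)) (bounded_rv_I L)).
  rewrite -meanD//; apply: le_mean => [||y]; first exact: bounded_rv_Lfun1.
    exact: (rpredD (muI _) b2).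
  rewrite !in_I; have /andP[h2 h3] := h01 y.
  case: (lerP y (x + del)) => hy; case: (lerP y L) => hL; rewrite ?mulr1n ?mulr0n; last 1 first.
  - by lra.
  - by lra.
  - by lra.
  - by rewrite h0 ?(ltW hy) ?hL// subrr addr0.
have lo' : F (x - del) <= mean mu k + F (- L).
  rewrite -!mean_I -meanD//; last exact: bounded_rv_Lfun1.
  apply: le_mean => [//||y].
    exact: (rpredD (bounded_rv_Lfun1 mu bk) (muI _)).
  rewrite !in_I; have /andP[k2 k3] := k01 y.
  case: (lerP y (x - del)) => hy; case: (lerP y (- L)) => hL; rewrite ?mulr1n ?mulr0n.
  - by lra.
  - by rewrite k1 ?hy ?(ltW hL)// addr0.
  - by lra.
  - by lra.
have hn : `|mean mu h - mean P (fun w => h (Y n w))| <= e / 4 by near: n.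
have kn : `|mean mu k - mean P (fun w => k (Y n w))| <= e / 4 by near: n.
move: hn kn Fp Fm; rewrite !ler_norml => /andP[? ?] /andP[? ?] /andP[? ?] /andP[? ?].
by apply/andP; split; lra.
Unshelve. all: by end_near. Qed.

End levy.

(** * The standard normal law and its characteristic function *)

Section standard_normal.
Context {R : realType}.
Local Notation leb := (@lebesgue_measure R).
Local Notation nu := (@normal_prob R 0 1).
Local Notation p := (@normal_pdf R 0 1).

Lemma std_normal_pdfE (x : R) : p x = normal_peak 1 * expR (- (x ^+ 2 / 2)).
Proof.
by rewrite normal_pdfE ?oner_neq0// /normal_fun subr0 expr1n -mulr_natr mul1r mulNr.
Qed.

(** Change of variables produces the Radon-Nikodym derivative; it agrees almost everywhere with the
    explicit density because both have the same integrals over measurable sets. *)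
Lemma normal_density_ae :
  ae_eq leb setT (Radon_Nikodym_SigmaFinite.f nu leb) (EFin \o p).
Proof.
have dom := @normal_prob_dominates R 0 1.
apply: integral_ae_eq => //.
- exact: Radon_Nikodym_SigmaFinite.f_integrable.
- by apply/measurable_EFinP; exact: measurable_normal_pdf.
- by move=> A _ mA; rewrite -Radon_Nikodym_SigmaFinite.f_integral.
Qed.

Lemma ge0_integral_normal_prob (f : R -> \bar R) : (forall x, 0 <= f x)%E ->
  measurable_fun setT f -> (\int[nu]_x f x = \int[leb]_x (f x * (p x)%:E))%E.
Proof.
move=> f0 mf; have dom := @normal_prob_dominates R 0 1.
rewrite -(Radon_Nikodym_SigmaFinite.change_of_variables dom)//.
apply: ae_eq_integral => //.
- apply: emeasurable_funM => //.
  exact: measurable_int (Radon_Nikodym_SigmaFinite.f_integrable dom).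
- by apply: emeasurable_funM => //; apply/measurable_EFinP; exact: measurable_normal_pdf.
- exact/ae_eqe_mul2l/normal_density_ae.
Qed.

Lemma integral_normal_prob (f : R -> \bar R) : nu.-integrable setT f ->
  (\int[nu]_x f x = \int[leb]_x (f x * (p x)%:E))%E.
Proof.
move=> fi; have mf := measurable_int _ fi; have dom := @normal_prob_dominates R 0 1.
rewrite -(Radon_Nikodym_change_of_variables dom)//.
apply: ae_eq_integral => //.
- by apply: emeasurable_funM => //; apply: measurable_int; exact: Radon_Nikodym_integrable.
- by apply: emeasurable_funM => //; apply/measurable_EFinP; exact: measurable_normal_pdf.
- apply: ae_eqe_mul2l; apply: ae_eq_trans normal_density_ae.
  by apply: ae_eq_sym; exact: ae_eq_Radon_Nikodym_SigmaFinite.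
Qed.

Lemma mul_expRN_le1 (y : R) : y * expR (- y) <= 1.
Proof.
rewrite expRN ler_pdivrMr ?expR_gt0// mul1r.
by have := expR_ge1Dx y; lra.
Qed.

(** Half of the exponent absorbs the factor [x ^+ 2], by [y * expR (- y) <= 1], and the other half
    is a multiple of the normal density of variance 2. *)
Lemma normal_second_moment_lty : (\int[nu]_x (x ^+ 2)%:E < +oo)%E.
Proof.
have s0 : Num.sqrt 2 != 0 :> R by rewrite gt_eqF// sqrtr_gt0.
have k0 : 0 < normal_peak (Num.sqrt 2 : R) by exact: normal_peak_gt0.
pose C := 4 * normal_peak 1 / normal_peak (Num.sqrt 2 : R).
have C0 : 0 <= C by rewrite /C divr_ge0 ?mulr_ge0 ?normal_peak_ge0.
have dom (x : R) : x ^+ 2 * p x <= C * normal_pdf 0 (Num.sqrt 2) x.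
  rewrite std_normal_pdfE (normal_pdfE 0 s0) /normal_fun subr0 sqr_sqrtr//.
  have -> : - x ^+ 2 / (2 *+ 2) = - (x ^+ 2 / 4) :> R by field.
  rewrite /C mulrA divfK ?gt_eqF//.
  have -> : x ^+ 2 / 2 = x ^+ 2 / 4 + x ^+ 2 / 4 by field.
  rewrite opprD expRD [leLHS](_ : _ = 4 * normal_peak 1 * (x ^+ 2 / 4 * expR (- (x ^+ 2 / 4))) *
    expR (- (x ^+ 2 / 4))); last by field.
  rewrite ler_wpM2r ?expR_ge0// -[leRHS]mulr1 ler_wpM2l ?mulr_ge0 ?normal_peak_ge0//.
  exact: mul_expRN_le1.
rewrite ge0_integral_normal_prob; last 2 first.
- by move=> x; rewrite lee_fin sqr_ge0.
- by apply/measurable_EFinP; exact: measurable_funX.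
apply: (@le_lt_trans _ _ (\int[leb]_x (C%:E * (normal_pdf 0 (Num.sqrt 2) x)%:E))%E).
  apply: ge0_le_integral => //.
  - by move=> x _; rewrite mule_ge0 ?lee_fin ?sqr_ge0 ?normal_pdf_ge0.
  - apply: emeasurable_funM; apply/measurable_EFinP; first exact: measurable_funX.
    exact: measurable_normal_pdf.
  - by apply: emeasurable_funM => //; apply/measurable_EFinP; exact: measurable_normal_pdf.
  - by move=> x _; rewrite -!EFinM lee_fin.
rewrite ge0_integralZl_EFin//.
- by rewrite integral_normal_pdf mule1 ltry.
- by move=> x _; rewrite lee_fin normal_pdf_ge0.
- by apply/measurable_EFinP; exact: measurable_normal_pdf.
Qed.

Lemma normal_id_Lfun2 : (fun x : measurableTypeR R => x : R) \in Lfun nu 2%:E.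
Proof. by apply: Lfun2_of_sqr => //; rewrite unlock; exact: normal_second_moment_lty. Qed.

Section integration_by_parts.
Variables t c : R.

Let a (x : R) : R := t * x + c.
Let h (x : R) : R := t * cos (t * x + c) - x * sin (t * x + c).
Let G (x : R) : R := sin (t * x + c) * p x.

Let da (x : R) : is_derive x 1 a t.
Proof.
have -> : a = cst t * id + cst c by apply/funext.
by apply: is_derive_eq; rewrite /GRing.scale/= !mulr1 mulr0 !addr0.
Qed.

Let dp (x : R) : is_derive x 1 (p : R -> R) (- x * p x).
Proof.
pose b (x : R) : R := - (x ^+ 2 / 2).
have db : is_derive x 1 b (- x).
  have -> : b = cst (- 2^-1) * (id * id) by apply/funext => y; rewrite /b/= expr2 mulNr mulrC.
  by apply: is_derive_eq; rewrite /GRing.scale/= mulr1 mulr0 addr0; field.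
rewrite std_normal_pdfE; have -> : (p : R -> R) = cst (normal_peak 1) * (expR \o b).
  by apply/funext => y; rewrite std_normal_pdfE.
by apply: is_derive_eq; rewrite /GRing.scale/= /b; ring.
Qed.

Let dG (x : R) : is_derive x 1 G (h x * p x).
Proof.
have dax := da x; have dpx := dp x.
have -> : G = (sin \o a) * (p : R -> R) by apply/funext => y.
by apply: is_derive_eq; rewrite /GRing.scale/= /a /h; ring.
Qed.

Let continuous_G : continuous G.
Proof.
move=> x; have := dG x => dGx.
by apply: differentiable_continuous; apply/derivable1_diffP.
Qed.

Let continuous_hp : continuous (fun x : R => h x * p x).
Proof.
have ca : continuous a.
  move=> x; have := da x => dax.
  by apply: differentiable_continuous; apply/derivable1_diffP.
move=> x; apply: cvgM; last by apply: continuous_normal_pdf; exact: oner_neq0.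
apply: cvgB; apply: cvgM.
- exact: cvg_cst.
- exact: (continuous_comp (ca x) (@continuous_cos R (a x))).
- exact: cvg_id.
- exact: (continuous_comp (ca x) (@continuous_sin R (a x))).
Qed.

Let h_Lfun1 : (h : measurableTypeR R -> R) \in Lfun nu 1.
Proof.
have bc : bounded_rv (fun x : measurableTypeR R => cos (t * x + c)) by exact: bounded_rv_affcos.
have bs : bounded_rv (fun x : measurableTypeR R => sin (t * x + c)).
  split; last by exists 1 => x; exact: sin_max.
  apply: measurableT_comp; first exact: continuous_measurable_fun (@continuous_sin R).
  by apply: measurable_funD => //; exact: measurable_funM.
have b1 := Lfun2_mean_mul normal_id_Lfun2 (bounded_rv_Lfun2 nu bs).
have b2 := bounded_rv_Lfun1 nu (bounded_rvZ t bc).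
have hN : (fun x : measurableTypeR R => - (x * sin (t * x + c))) \in Lfun nu 1 by rewrite rpredN.
exact: (rpredD b2 hN).
Qed.

(** The integrand times the density is the derivative of [G], which vanishes at infinity. Dominated
    convergence over growing symmetric intervals reduces the claim to the boundary values of [G]. *)
Lemma normal_integration_by_parts : mean nu h = 0.
Proof.
have hi : nu.-integrable setT (EFin \o h) by exact/Lfun1_integrable.
rewrite /mean unlock (integral_normal_prob hi).
pose g (x : R) : R := h x * p x.
have mh := measurable_int _ hi.
have mg : measurable_fun setT (EFin \o g).
  by apply/measurable_EFinP; apply: continuous_measurable_fun.
have gi : leb.-integrable setT (EFin \o g).
  apply/integrableP; split=> //.
  have /integrableP[_] := hi; rewrite ge0_integral_normal_prob//; last exact: measurableT_comp.
  apply: le_lt_trans; rewrite le_eqVlt; apply/orP; left; apply/eqP.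
  by apply: eq_integral => x _; rewrite /= /g normrM EFinM (ger0_norm (normal_pdf_ge0 _ _ _)).
pose D n : set R := `[- n.+1%:R, n.+1%:R]%classic.
pose f_ n := (EFin \o g) \_ (D n).
have mf n : measurable_fun setT (f_ n).
  have mD : measurable (D n) by exact: measurable_itv.
  apply: (proj1 (measurable_restrictT (EFin \o g) mD)); exact: measurable_funTS.
have f_g : {ae leb, forall x, setT x -> f_ ^~ x @ \oo --> (EFin \o g) x}.
  apply: aeW => x _; apply: cvg_near_cst; near=> n.
  rewrite /f_ patchE mem_set// /D/= in_itv/= -ler_norml.
  near: n; exists (Num.truncn `|x|) => // n /= hn.
  by apply/ltW/(lt_le_trans (truncnS_gt _)); rewrite ler_nat.
have f_le : {ae leb, forall x n, setT x -> (`|f_ n x| <= (abse \o (EFin \o g)) x)%E}.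
  apply: aeW => x n _; rewrite /f_ patchE; case: ifPn => // _.
  by rewrite abse0 abse_ge0.
have [_ _] := @dominated_convergence _ _ _ leb _ measurableT _ _ _ mf mg f_g (integrable_abse gi) f_le.
have -> : [sequence (\int[leb]_x f_ n x)%E]_n = (fun n => (G n.+1%:R - G (- n.+1%:R))%:E).
  apply/funext => n /=; rewrite /f_ -integral_mkcond.
  rewrite (@continuous_FTC2 _ g G).
  - by rewrite EFinB.
  - by have := ltr0Sn R n; move: (n.+1%:R : R) => z; lra.
  - exact: continuous_subspaceT.
  - split=> [x _||]; [by have := dG x|exact/cvg_at_right_filter/continuous_G|exact/cvg_at_left_filter/continuous_G].
  - by move=> x _; rewrite derive1E; have := dG x => dGx; rewrite derive_val.
move=> hlim; have E : (\int[leb]_x ((EFin \o h) x * (p x)%:E) = \int[leb]_x (EFin \o g) x)%E.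
  by apply: eq_integral => x _.
rewrite E.
have lim0 : (G n.+1%:R - G (- n.+1%:R))%:E @[n --> \oo] --> (0 : \bar R)%E.
  apply: cvg_EFin; first exact: nearW.
  apply/cvgrPdist_le => e e0.
  have k0 : 0 <= normal_peak 1 :> R by exact: normal_peak_ge0.
  have tail (x y : R) : 1 <= y -> x ^+ 2 = y ^+ 2 -> `|G x| <= 2 * normal_peak 1 / y.
    move=> y1 xy; have y0 : 0 < y by lra.
    rewrite /G normrM std_normal_pdfE xy -[leRHS]mul1r.
    apply: ler_pM => //; first exact: sin_max.
    rewrite ger0_norm ?mulr_ge0 ?expR_ge0//. rewrite (mulrC 2) -[leRHS]mulrA ler_wpM2l//.
    rewrite ler_pdivlMr//; have := mul_expRN_le1 (y ^+ 2 / 2).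
    have := ler_wpM2r (expR_ge0 (- (y ^+ 2 / 2))) (ler_wpM2r (ltW y0) y1).
    rewrite mul1r -expr2; lra.
  near=> n.
  have n1 : 1 <= n.+1%:R :> R by rewrite ler1n.
  have h1 := tail _ _ n1 erefl.
  have h2 := tail (- n.+1%:R) _ n1 (sqrrN _).
  have h3 : 4 * normal_peak 1 / n.+1%:R <= e.
    rewrite ler_pdivrMr ?ltr0n// [leRHS]mulrC -ler_pdivrMr//.
    near: n; exists (Num.truncn (4 * normal_peak 1 / e)) => // n /= hn.
    by apply/ltW/(lt_le_trans (truncnS_gt _)); rewrite ler_nat.
  rewrite sub0r normrN (le_trans (ler_normB _ _))//.
  by apply: (le_trans (lerD h1 h2)); apply: le_trans h3; rewrite -mulrDl -mulrDl -natrD.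
by rewrite (cvg_unique _ hlim lim0).
Unshelve. all: by end_near. Qed.

End integration_by_parts.

End standard_normal.

(** A quadratic remainder bound on the integrand passes to the mean, so this criterion allows
    differentiation under the integral sign without taking limits inside it. *)
Lemma is_derive_quadratic (R : realType) (f : R -> R) (t d M : R) :
  (forall u, `|f (t + u) - f t - u * d| <= M * u ^+ 2) -> is_derive t 1 f d.
Proof.
move=> hf; have M0 : 0 <= M by have := le_trans (normr_ge0 _) (hf 1); rewrite expr1n mulr1.
have M1 : 0 < M + 1 by rewrite ltr_wpDl.
have lim : h^-1 *: ((f \o shift t) (h *: 1) - f t) @[h --> 0^'] --> d.
  apply/cvgrPdist_le => e e0; near=> u.
  have u0 : u != 0 by near: u; exact: nbhs_dnbhs_neq.
  have au : 0 < `|u| by rewrite normr_gt0.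
  have ue : `|u| <= e / (M + 1).
    near: u; apply: dnbhs0_le; exact: divr_gt0.
  rewrite /= /GRing.scale/= mulr1 [u + t]addrC -(ler_pM2l au) -normrM mulrBr mulVKf//.
  rewrite distrC; apply: (le_trans (hf u)).
  rewrite -[u ^+ 2]real_normK ?num_real// expr2 mulrCA ler_wpM2l//.
  apply: (le_trans (ler_wpM2l M0 ue)).
  by rewrite mulrA ler_pdivrMr// mulrC ler_wpM2l ?(ltW e0)// lerDl.
by apply: DeriveDef; [apply/cvg_ex; exists d|exact: cvg_lim].
Unshelve. all: by end_near. Qed.

Lemma norm_cos_taylor1 (R : realType) (a u : R) :
  `|cos (a + u) - cos a + u * sin a| <= 2 * u ^+ 2.
Proof.
have -> : cos (a + u) - cos a + u * sin a =
    sin a * (u - sin u) - cos a * (1 - cos u) by rewrite cosD; ring.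
apply: (le_trans (ler_normB _ _)); rewrite !normrM.
have h1 : `|sin a| * `|u - sin u| <= 1 * u ^+ 2.
  by apply: ler_pM => //; [exact: sin_max|exact: norm_sub_sin_le2].
have h2 : `|cos a| * `|1 - cos u| <= 1 * (u ^+ 2 / 2).
  apply: ler_pM => //; first exact: cos_max.
  by rewrite ger0_norm ?subr_ge0 ?cos_le1// one_sub_cos_le.
have := sqr_ge0 u; lra.
Qed.

Section normal_characteristic_function.
Context {R : realType}.
Local Notation nu := (@normal_prob R 0 1).
Variable c : R.

Let phi (t : R) : R := mean nu (fun x : R => cos (t * x + c)).

Let bc (t : R) : bounded_rv (fun x : measurableTypeR R => cos (t * x + c)).
Proof. exact: bounded_rv_affcos. Qed.

Let xs1 (t : R) : (fun x : measurableTypeR R => x * sin (t * x + c)) \in Lfun nu 1.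
Proof.
apply: Lfun2_mean_mul; first exact: normal_id_Lfun2.
apply: bounded_rv_Lfun2; split; last by exists 1 => x; exact: sin_max.
apply: measurableT_comp; first exact: continuous_measurable_fun (@continuous_sin R).
by apply: measurable_funD => //; exact: measurable_funM.
Qed.

Let mean_xs (t : R) : mean nu (fun x : R => x * sin (t * x + c)) = t * phi t.
Proof.
have := normal_integration_by_parts t c.
rewrite meanB ?meanZ//; [|exact: bounded_rv_Lfun1|exact/bounded_rv_Lfun1/bounded_rvZ].
by move/eqP; rewrite subr_eq0 => /eqP <-.
Qed.

(** The derivative is minus the mean of [x * sin (t * x + c)], which integration by parts turns into
    [t * phi t]; the second moment controls the remainder. *)
Let phi_derive (t : R) : is_derive t 1 phi (- t * phi t).
Proof.
pose M := mean nu (fun x : R => x ^+ 2).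
apply: (@is_derive_quadratic _ _ _ _ (2 * M)) => u.
have c1 s := bounded_rv_Lfun1 nu (bc s).
have cc1 : (fun x : measurableTypeR R => cos ((t + u) * x + c) - cos (t * x + c)) \in Lfun nu 1.
  exact: (rpredB (c1 _) (c1 _)).
have uxs : (fun x : measurableTypeR R => u * (x * sin (t * x + c))) \in Lfun nu 1.
  have -> : (fun x : measurableTypeR R => u * (x * sin (t * x + c))) =
    u *: (fun x : measurableTypeR R => x * sin (t * x + c)) by apply/funext.
  exact: rpredZ.
have -> : phi (t + u) - phi t - u * (- t * phi t) = mean nu (fun x : R =>
    cos ((t + u) * x + c) - cos (t * x + c) + u * (x * sin (t * x + c))).
  by rewrite meanD// meanB// meanZ// mean_xs /phi; ring.
have x2 := Lfun2_mean_sqr (@normal_id_Lfun2 R).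
have x21 : (fun x : measurableTypeR R => 2 * u ^+ 2 * x ^+ 2) \in Lfun nu 1.
  have -> : (fun x : measurableTypeR R => 2 * u ^+ 2 * x ^+ 2) =
    (2 * u ^+ 2) *: (fun x : measurableTypeR R => (x : R) ^+ 2) by apply/funext.
  exact: rpredZ.
have L1 : (fun x : measurableTypeR R => cos ((t + u) * x + c) - cos (t * x + c) +
    u * (x * sin (t * x + c))) \in Lfun nu 1 by exact: (rpredD cc1 uxs).
apply: (le_trans (ler_norm_mean L1)).
rewrite [leRHS](_ : _ = mean nu (fun x : R => 2 * u ^+ 2 * x ^+ 2)); last first.
  by rewrite (meanZ (2 * u ^+ 2) x2) /M; ring.
apply: le_mean => [|//|x].
  exact: (Lfun_norm L1).
have -> : (t + u) * x + c = (t * x + c) + u * x by ring.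
by rewrite mulrA (le_trans (norm_cos_taylor1 _ _))// exprMn mulrA.
Qed.

(** By the differential equation, [phi t * expR (t ^+ 2 / 2)] is constant and equal to [phi 0]. The
    free phase [c] yields the cosine and the sine from one computation. *)
Lemma normal_cf (t : R) : mean nu (fun x : R => cos (t * x + c)) = cos c * expR (- (t ^+ 2 / 2)).
Proof.
pose b (s : R) : R := s ^+ 2 / 2.
have db (s : R) : is_derive s 1 b s.
  have -> : b = cst 2^-1 * (id * id) by apply/funext => y; rewrite /b/= expr2 mulrC.
  by apply: is_derive_eq; rewrite /GRing.scale/= mulr1 mulr0 addr0; field.
have dpsi (s : R) : is_derive s 1 (phi * (expR \o b)) 0.
  have := db s; have := phi_derive s => dphi dbs.
  by apply: is_derive_eq; rewrite /GRing.scale/=; ring.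
have := is_derive_0_is_cst t 0 dpsi; rewrite /= /GRing.mul/= /b expr0n/= mul0r expR0 mulr1.
have -> : phi 0 = cos c.
  rewrite /phi -[RHS](mean_cst nu); congr mean; apply/funext => x.
  by rewrite mul0r add0r.
by move=> <-; rewrite -[RHS]mulrA -expRD subrr expR0 mulr1.
Qed.

End normal_characteristic_function.

Lemma normal_cos_sin (R : realType) (t : R) :
  mean (@normal_prob R 0 1) (fun x : R => cos (t * x)) = expR (- (t ^+ 2 / 2)) /\
  mean (@normal_prob R 0 1) (fun x : R => sin (t * x)) = 0.
Proof.
split.
  rewrite (_ : (fun x : R => cos (t * x)) = (fun x => cos (t * x + 0))).
    by rewrite normal_cf cos0 mul1r.
  by apply/funext => x; rewrite addr0.
rewrite (_ : (fun x : R => sin (t * x)) = (fun x => cos (t * x - pi / 2))).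
  by rewrite normal_cf cosN cos_pihalf mul0r.
by apply/funext => x; rewrite cosBpihalf.
Qed.

Theorem theorem2p1 (R : realType) (d : measure_display)
    (Omega : measurableType d) (P : probability Omega R)
    (X : int -> {RV P >-> R})
    (X_stationary : strictly_stationary X)
    (G_pos_fin : forall r : R, 0 <= r -> (0 < tail_moment X r < +oo)%E)
    (G_ratio : forall eps : R, 0 < eps ->
      fine (tail_moment X (r + eps)) / fine (tail_moment X r)
        @[r --> +oo] --> (0 : R)) :
  (forall r : R, 0 <= r ->
    ('E_P[fun w => (`|shrink r (X 0 w)| ^+ 2)%R] < +oo)%E) /\
  (((rho_mix X 1 < 1)%E /\
      (\sum_(1 <= n <oo) rho_mix X (2 ^ n)%N < +oo)%E) \/
   ((rho_star_mix X 1 < 1)%E /\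
      alpha_mix X n @[n --> \oo] --> (0 : \bar R)%E) ->
   exists r : nat -> R,
     [/\ forall n, 0 < r n,
         r n @[n --> \oo] --> +oo &
         cvg_in_distribution P
           (fun n => centered_shrunk_sum X (r n) n)
           (normal_prob 0 1)]).
Proof.
split.
  move=> r r0; rewrite (_ : (fun w => _) = (fun w => shrink r (X 0 w) ^+ 2)); last first.
    by apply/funext => w; rewrite real_normK ?num_real.
  rewrite shrink_second_moment// lte_mul_pinfty// ?lte_fin//.
  by have /andP[] := G_pos_fin r r0.
move=> mixing.
have [X_variance X_clt] : linear_variance X /\ bounded_block_clt X.
  case: mixing => -[h1 h2]; first exact: rho_mixing_case.
  exact: rho_star_mixing_case.
have [r [r_gt0 r_large r_sd]] :=
  shrinking_levels X_stationary G_pos_fin G_ratio X_variance.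
have cf := shrunk_sum_cf X_stationary G_pos_fin G_ratio X_variance X_clt r_gt0 r_large r_sd.
exists r; split=> //.
  apply/cvgryPge => A; have [N hN] := r_large A.
  by exists N.
apply: char_cvg_in_distribution => [t|t|].
- rewrite (normal_cos_sin t).1; apply/cvgrPdist_le => e e0; have [N hN] := cf t e e0.
  by exists N => // n /= /hN[h _]; rewrite distrC.
- rewrite (normal_cos_sin t).2; apply/cvgrPdist_le => e e0; have [N hN] := cf t e e0.
  by exists N => // n /= /hN[_ h]; rewrite sub0r normrN.
(* The levels make the second moment equal to 1 for large [n], which is the tightness required. *)
have [N hN] := r_sd; exists N => n Nn.
have rn0 := ltW (r_gt0 n); split.
  exact: (centered_shrunk_sum_Lfun2 X_stationary G_pos_fin).
by rewrite (mean_sqr_centered_shrunk_sum X_stationary G_pos_fin)// hN// expr1n.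
Qed.
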